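(* Let $V$ be a $C_\infty$-algebra and put $P:=\prod_{i=1}^\infty(\Sigma V^* )^{\hat\otimes i}$ and $P_{\mathrm{cyc}}:=\prod_{i=1}^\infty\bigl((\Sigma V^* )^{\hat\otimes i}\bigr)_{Z_i}$. (i) The cyclic Hochschild complex $CC^\bullet_{\mathrm{Hoch}}(V)$ splits as a direct product of the subcomplexes $\Sigma(e(j)[P_{\mathrm{cyc}}])$: $$CC^\bullet_{\mathrm{Hoch}}(V)=\prod_{j=1}^\infty\bigl(\Sigma(e(j)[P_{\mathrm{cyc}}]),b'\bigr).$$ (ii) Let $Q_j:=\Sigma(e(j)[P])$ and $\widetilde Q_j:=\Sigma(\tilde e(j)[P])$. The Tsygan bicomplex splits as a direct product of subcomplexes $$CC^{\bullet\bullet}_{\mathrm{Tsygan}}(V)=\prod_{j=0}^\infty\Gamma_j,$$ where $\Gamma_j$ is the subcomplex $$(\widetilde Q_j,b)\xrightarrow{1-z}(Q_j,b')\xrightarrow{N}(\widetilde Q_{j-1},b)\xrightarrow{1-z}(Q_{j-1},b')\xrightarrow{N}\cdots\xrightarrow{1-z}(Q_1,b')\xrightarrow{N}(\widetilde Q_0,b).$$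
   Context: Conventions. $\mathbb K$ is an evenly graded commutative ring containing $\mathbb Q$; all modules are graded $\mathbb K$-modules obtained by extension of scalars from vector spaces over a subfield $k\subset\mathbb K$; gradings are cohomological and the Koszul sign rule is used. $(\Sigma V)^i:=V^{i+1}$, and $\Sigma V^*$ means $\mathrm{Hom}_{\mathbb K}(\Sigma V,\mathbb K)$. A profinite module is an inverse limit of free modules of finite rank with the inverse limit topology (e.g. the dual of a free module); $\hat\otimes$ is the completed tensor product; ''linear combinations'' in profinite modules are convergent and possibly infinite. For $W$ profinite, $\widehat TW:=\prod_{i\ge0}W^{\hat\otimes i}$ and $\widehat LW\subset\widehat TW$ is the Lie subalgebra (under the graded commutator) of all convergent linear combinations of Lie monomials. A vector field is a continuous derivation. $C_\infty$-algebras. A $C_\infty$-structure on a free graded module $V$ is a continuous derivation $m$ of degree one of the Lie algebra $\widehat L\Sigma V^*$ with $m^2=0$; $V$ with $m$ is a $C_\infty$-algebra. Such $m$ extends uniquely to a continuous derivation $m$ of the associative algebra $\widehat T\Sigma V^*$. Forms. $\Omega^\bullet_{\mathrm{Ass}}(\widehat TW)$ is the (formal) differential envelope of $\widehat TW$: the pro-free associative algebra on $W\oplus dW$ ($dW$ a copy of $W$ with degrees raised by one), with the continuous derivation $d$ of degree $1$, $d(w)=dw$, $d^2=0$. $DR^\bullet_{\mathrm{Ass}}(\widehat TW)=\Omega^\bullet_{\mathrm{Ass}}/[\Omega^\bullet_{\mathrm{Ass}},\Omega^\bullet_{\mathrm{Ass}}]$ (graded commutators); $DR^0_{\mathrm{Ass}}=\widehat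 TW/[\widehat TW,\widehat TW]$, and $DR^1_{\mathrm{Ass}}$ is the part with one $d$, regraded so that $x\,dy$ has degree $|x|+|y|$. For a vector field $\xi$, the Lie derivative $L_\xi$ is the derivation of $\Omega^\bullet_{\mathrm{Ass}}$ with $L_\xi(x)=\xi(x)$, $L_\xi(dx)=(-1)^{|\xi|}d(\xi(x))$; it descends to $DR^\bullet_{\mathrm{Ass}}$. There is an isomorphism $\Theta: W\hat\otimes\widehat TW=\prod_{i\ge1}W^{\hat\otimes i}\to DR^1_{\mathrm{Ass}}(\widehat TW)$, $x\hat\otimes y\mapsto dx\cdot y$. Operators. $b':P\to P$ is the restriction of $m$ to $P\subset\widehat T\Sigma V^*$; $b:=\Theta^{-1}L_m\Theta:P\to P$. The cyclic group $Z_n$ has generator $z_n$ acting by $z_n(x_1\hat\otimes\cdots\hat\otimes x_n)=(-1)^{|x_1|(|x_2|+\cdots+|x_n|)}x_2\hat\otimes\cdots\hat\otimes x_n\hat\otimes x_1$; $z$ acts on $P$ with components $z_n$, and $N$ has components $N_n=1+z_n+\cdots+z_n^{n-1}$. Subscript $Z_i$ denotes coinvariants. Complexes. The cyclic Hochschild complex $CC^\bullet_{\mathrm{Hoch}}(V)$ is $\Sigma$ of the submodule of elements of $DR^0_{\mathrm{Ass}}(\widehat T\Sigma V^* )$ with vanishing constant term, with differential induced by $L_m$; equivalently it is $(\Sigma P_{\mathrm{cyc}},b')$, with $b'$ induced on coinvariants. The Tsygan bicomplex $CC^{\bullet\bullet}_{\mathrm{Tsygan}}(V)$ is $(\Sigma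 P,b)\xrightarrow{1-z}(\Sigma P,b')\xrightarrow{N}(\Sigma P,b)\xrightarrow{1-z}\cdots$, with an element of bidegree $(i,j)$ lying in the $i$th column (starting at $i=0$) and having degree $j$ in $\Sigma P$. Projections. Let $\mu$ be the multiplication of $\widehat TW$ and $\Delta:\widehat TW\to\widehat TW\hat\otimes\widehat TW$ the continuous algebra homomorphism with $\Delta(w)=w\otimes1+1\otimes w$ for $w\in W$. The modified shuffle operator is $s:=\mu\Delta$, with components $s_n:W^{\hat\otimes n}\to W^{\hat\otimes n}$. With $\lambda_i:=2^i$, set $e_n(j):=\bigl[\prod_{0\le r\le n,r\ne j}(\lambda_j-\lambda_r)\bigr]^{-1}\prod_{0\le r\le n,r\ne j}(s_n-\lambda_r\mathrm{id})$ for $0\le j\le n$ and $e_n(j):=0$ for $j>n$; $e(j):\widehat TW\to\widehat TW$ has components $e_n(j)$. Under $\prod_{i\ge1}W^{\hat\otimes i}=W\hat\otimes\widehat TW$ put $\tilde e(j):=1\hat\otimes e(j)$. Here $W=\Sigma V^*$. For $j\ge1$, $e(j)\circ(1-z)=(1-z)\circ\tilde e(j)$, so $e(j)$ induces a map on $P_{\mathrm{cyc}}$, also written $e(j)$. *)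

(* Defs.v *)
From HB Require Import structures.
From mathcomp Require Import all_boot all_order all_algebra generic_quotient ring_quotient.
From mathcomp Require Import boolp classical_sets functions cardinality fsbigop.

Set Implicit Arguments.
Unset Strict Implicit.
Unset Printing Implicit Defensive.

Import Order.TTheory GRing.Theory.
Local Open Scope classical_set_scope.
Local Open Scope ring_scope.

Definition even_grading (K : comNzRingType) (gr : int -> set K) : Prop :=
  [/\ (forall n, gr n 0) /\ (forall n x y, gr n x -> gr n y -> gr n (x - y)),
      gr 0 1 /\ (forall p q x y, gr p x -> gr q y -> gr (p + q) (x * y)),
      (forall n x, odd `|n|%N -> gr n x -> x = 0),
      (forall x, exists (s : seq int) (c : int -> K),
         (forall n, gr n (c n)) /\ x = \sum_(n <- s) c n) &
      (forall (s : seq int) (c : int -> K), uniq s -> (forall n, gr n (c n)) ->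
         \sum_(n <- s) c n = 0 -> forall n, n \in s -> c n = 0)].

(* [prof K X] is the profinite K-module with topological basis X, i.e. the
   dual of the free module on X.  A function f stands for the convergent
   linear combination of the basis elements x with coefficients f x.  The
   topology is that of pointwise convergence, K being discrete. *)
Definition prof (K : comNzRingType) (X : Type) := X -> K.

Section ProfLmodule.
Variables (K : comNzRingType) (X : Type).

HB.instance Definition _ := GRing.Zmodule.copy (prof K X) (X -> K).

Definition prof_scale (c : K) (f : prof K X) : prof K X := fun x => c * f x.

Fact prof_scaleA a b v : prof_scale a (prof_scale b v) = prof_scale (a * b) v.
Proof. by apply/funext => x; rewrite /prof_scale mulrA. Qed.
Fact prof_scale1 : left_id 1 prof_scale.
Proof. by move=> v; apply/funext => x; rewrite /prof_scale mul1r. Qed.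
Fact prof_scaleDr : right_distributive prof_scale +%R.
Proof. by move=> a u v; apply/funext => x; rewrite /prof_scale mulrDr. Qed.
Fact prof_scaleDl v : {morph prof_scale^~ v : a b / a + b}.
Proof. by move=> a b; apply/funext => x; rewrite /prof_scale mulrDl. Qed.

HB.instance Definition _ := GRing.Zmodule_isLmodule.Build K (prof K X)
  prof_scaleA prof_scale1 prof_scaleDr prof_scaleDl.

End ProfLmodule.

(* Quotient of a module by a submodule, given as a classical set. *)
Record submodule (K : comNzRingType) (M : lmodType K) := Submodule {
  sub_set : set M;
  sub_set0 : sub_set 0;
  sub_setP : forall a x y, sub_set x -> sub_set y -> sub_set (a *: x + y) }.

Section ModuleQuotient.
Variables (K : comNzRingType) (M : lmodType K) (S : submodule M).

Definition sub_pred : {pred M} := fun x => `[< sub_set S x >].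

Fact sub_pred_closed : zmod_closed sub_pred.
Proof.
split=> [|x y /asboolP Sx /asboolP Sy]; first exact/asboolP/sub_set0.
apply/asboolP; rewrite addrC -scaleN1r; exact: sub_setP.
Qed.

HB.instance Definition _ := GRing.isZmodClosed.Build M sub_pred sub_pred_closed.

Definition mquot := Quotient.quot sub_pred.
HB.instance Definition _ := GRing.Zmodule.on mquot.

Definition cls (x : M) : mquot := (\pi_(Quotient.quot sub_pred) x)%qT.

(* The map induced on the quotient by a linear map of M preserving S *)
Definition induced (phi : M -> M) (q : mquot) : mquot := cls (phi (repr q)).

Lemma clsP x y : cls x = cls y <-> sub_set S (x - y).
Proof.
split=> [/eqP|Sxy]; first by rewrite /cls -Quotient.idealrBE => /asboolP.
by apply/eqP; rewrite /cls -Quotient.idealrBE; apply/asboolP.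
Qed.

Lemma cls_repr q : cls (repr q) = q. Proof. exact: reprK. Qed.

Lemma clsD x y : cls (x + y) = cls x + cls y.
Proof. exact: (raddfD (\pi_(Quotient.quot sub_pred))%qT). Qed.

Definition mquot_scale (c : K) := induced (fun x => c *: x).

Lemma clsZ c x : cls (c *: x) = mquot_scale c (cls x).
Proof.
apply/clsP; rewrite -scalerBr -[_ *: _]addr0; apply: sub_setP; last exact: sub_set0.
by apply/clsP; rewrite cls_repr.
Qed.

Fact mquot_scaleA a b v : mquot_scale a (mquot_scale b v) = mquot_scale (a * b) v.
Proof. by rewrite -[v]cls_repr -!clsZ scalerA. Qed.
Fact mquot_scale1 : left_id 1 mquot_scale.
Proof. by move=> v; rewrite -[v]cls_repr -clsZ scale1r. Qed.
Fact mquot_scaleDr : right_distributive mquot_scale +%R.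
Proof.
by move=> a u v; rewrite -[u]cls_repr -[v]cls_repr -clsD -!clsZ scalerDr clsD.
Qed.
Fact mquot_scaleDl v : {morph mquot_scale^~ v : a b / a + b}.
Proof. by move=> a b; rewrite -[v]cls_repr -!clsZ scalerDl clsD. Qed.

HB.instance Definition _ := GRing.Zmodule_isLmodule.Build K mquot
  mquot_scaleA mquot_scale1 mquot_scaleDr mquot_scaleDl.

End ModuleQuotient.

(* Koszul sign (-1)^n for n : int *)
Definition ksgn (K : comNzRingType) (n : int) : K := (-1) ^+ `|n|%N.

Section ConvergentSpan.
Variables (K : comNzRingType) (X : choiceType).

(* Convergent, possibly infinite, linear combinations of elements of A *)
Definition conv_span (A : set (prof K X)) : set (prof K X) :=
  [set h | exists (S : choiceType) (c : S -> K) (a : S -> prof K X),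
     (forall s, A (a s)) /\
     forall x, finite_set [set s | c s * a s x != 0] /\
               h x = \sum_(s \in [set: S]) c s * a s x].

Fact conv_span0 A : conv_span A 0.
Proof.
exists void, (fun=> 0), (fun=> 0); split=> [[]|x]; split.
  by apply: (sub_finite_set (B := set0)) => [[]|].
by rewrite fsbig1 // => -[].
Qed.

Fact conv_spanP A a x y :
  conv_span A x -> conv_span A y -> conv_span A (a *: x + y).
Proof.
move=> [S [c [u [Au xE]]]] [T [d [v [Av yE]]]].
pose F (st : S + T) := match st with inl s => a * c s | inr t => d t end.
pose G (st : S + T) := match st with inl s => u s | inr t => v t end.
exists (S + T)%type, F, G; split.
  by case=> [s|t]; [exact: Au | exact: Av].
move=> w.
have [[finS xw] [finT yw]] := (xE w, yE w).
pose L := [set s | c s * u s w != 0]; pose R := [set t | d t * v t w != 0].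
have supp : [set st | F st * G st w != 0] `<=` inl @` L `|` inr @` R.
  move=> [s|t] /= nz; [left; exists s => // | right; exists t => //].
  by apply: contra_neq nz => cu0; rewrite -mulrA cu0 mulr0.
have fin : finite_set (inl @` L `|` inr @` R : set (S + T)).
  by rewrite finite_setU; split; exact: finite_image.
split; first exact: sub_finite_set supp fin.
rewrite -(fsbig_widen (inl @` L `|` inr @` R)) //; last first.
  move=> st [_ nst] /=; apply/eqP/negPn/negP => nz; exact/nst/supp.
rewrite fsbigU0 //=; try exact: finite_image; last first.
  by move=> st [[s _ <-] [t _]].
rewrite !fsbig_image /=; try by move=> ? ? _ _ [].
rewrite -[LHS]/(a * x w + y w) xw yw.
rewrite -(fsbig_widen L [set: S]) //; last first.
  by move=> s [_ ns] /=; apply/eqP/negPn/negP.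
rewrite -(fsbig_widen R [set: T]) //; last first.
  by move=> t [_ nt] /=; apply/eqP/negPn/negP.
rewrite !(fsbig_finite _ _ finS) mulr_sumr.
by congr (_ + _); apply: eq_bigr => s _; rewrite mulrA.
Qed.

Definition conv_submodule (A : set (prof K X)) : submodule (prof K X) :=
  Submodule (conv_span0 A) (@conv_spanP A).

End ConvergentSpan.

Section Series.
Variables (K : comNzRingType) (gr : int -> set K).

Definition basis_elt (X : choiceType) (x : X) : prof K X := fun y => (y == x)%:R.

(* The continuous linear map with phi x the image of the basis element x;
   the sums are finite as soon as phi x tends to 0. *)
Definition cont_ext (X : choiceType) (Y : Type) (phi : X -> prof K Y)
  (f : prof K X) : prof K Y := fun y => \sum_(x \in [set: X]) f x * phi x y.

Section Tensor.
Variables (J : choiceType) (deg : J -> int).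

(* [tens] is the completed tensor algebra on the profinite module with
   topological basis J, where j : J has degree deg j: its topological basis
   consists of the words in J, of length i for the i-th tensor power. *)
Definition tens := prof K (seq J).

Definition wdeg (w : seq J) : int := \sum_(j <- w) deg j.

(* Elements of degree n; coefficients contribute to the degree. *)
Definition homog (n : int) (f : tens) : Prop := forall w, gr (n - wdeg w) (f w).

Definition tmono (w : seq J) : tens := basis_elt w.
Definition tgen (j : J) : tens := tmono [:: j].

Definition tmul (f g : tens) : tens :=
  fun w => \sum_(k < (size w).+1) f (take k w) * g (drop k w).

(* Graded commutator of elements f, g of degrees p, q *)
Definition tcomm (p q : int) (f g : tens) : tens :=
  tmul f g - ksgn K (p * q) *: tmul g f.

(* The continuous derivation of degree p with value X j on the generator j *)
Fixpoint leibniz (p : int) (X : J -> tens) (w : seq J) : tens :=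
  if w is j :: v
  then tmul (X j) (tmono v) + ksgn K (p * deg j) *: tmul (tgen j) (leibniz p X v)
  else 0.

Definition cont_der (p : int) (X : J -> tens) : tens -> tens :=
  cont_ext (leibniz p X).

Inductive lie_monomial : int -> tens -> Prop :=
| lie_gen j : lie_monomial (deg j) (tgen j)
| lie_bracket p q x y : lie_monomial p x -> lie_monomial q y ->
    lie_monomial (p + q) (tcomm p q x y).

(* The Lie algebra of convergent combinations of Lie monomials *)
Definition Lhat : set tens := conv_span [set x | exists p, lie_monomial p x].

(* The (closed) submodule of graded commutators *)
Definition commutators : submodule tens :=
  conv_submodule [set h | exists p q (f g : tens),
    [/\ homog p f, homog q g & h = tcomm p q f g]].

(* Completed tensor square of [tens], with the Koszul product
   (a (x) b) (c (x) d) = (-1)^(|b||c|) ac (x) bd. *)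
Definition tens2 := prof K (seq J * seq J)%type.

Definition tmul2 (F G : tens2) : tens2 := fun uv =>
  let: (u, v) := uv in
  \sum_(a < (size u).+1) \sum_(b < (size v).+1)
    ksgn K (wdeg (take b v) * wdeg (drop a u)) *
    (F (take a u, take b v) * G (drop a u, drop b v)).

Definition tprod (f g : tens) : tens2 := fun uv => f uv.1 * g uv.2.

(* The continuous algebra homomorphism with j |-> j (x) 1 + 1 (x) j *)
Definition coprod : tens -> tens2 :=
  cont_ext (fun w => foldr
    (fun j F => tmul2 (tprod (tgen j) (tmono [::]) + tprod (tmono [::]) (tgen j)) F)
    (tprod (tmono [::]) (tmono [::])) w).

Definition tmult : tens2 -> tens :=
  fun F w => \sum_(k < (size w).+1) F (take k w, drop k w).

(* The modified shuffle operator mu Delta *)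
Definition shuffle (f : tens) : tens := tmult (coprod f).

Definition trunc (n : nat) (f : tens) : tens :=
  fun w => if size w == n then f w else 0.

(* z (x_1 ... x_n) = (-1)^(|x_1| (|x_2| + ... + |x_n|)) x_2 ... x_n x_1, so the
   coefficient of z f at a word w comes from the rotation of w to the right. *)
Definition cyc_sign (w : seq J) : K :=
  if w is j :: v then ksgn K (deg j * wdeg v) else 1.

Definition cyc (f : tens) : tens :=
  fun w => cyc_sign (rotr 1 w) * f (rotr 1 w).

Definition cyc_norm (f : tens) : tens :=
  fun w => \sum_(i < size w) iter i cyc f w.

Fact cyc_linear a x y : cyc (a *: x + y) = a *: cyc x + cyc y.
Proof.
apply/funext => w.
rewrite -[LHS]/(_ * (a * _ + _)) -[RHS]/(a * (_ * _) + (_ * _)).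
by rewrite mulrDr mulrCA.
Qed.

(* The submodule (1 - z) [tens].  Since z preserves the tensor powers, the
   quotient is the product of the coinvariants of the tensor powers. *)
Definition cyc_image : set tens := [set f | exists h, f = h - cyc h].

Fact cyc_image0 : cyc_image 0.
Proof.
exists 0; apply/funext => w.
by rewrite -[RHS]/(0 - _ * 0) mulr0 subr0.
Qed.

Fact cyc_imageP a x y : cyc_image x -> cyc_image y -> cyc_image (a *: x + y).
Proof.
move=> [h ->] [g ->]; exists (a *: h + g).
by rewrite cyc_linear scalerBr opprD addrACA.
Qed.

Definition cyc_submodule : submodule tens := Submodule cyc_image0 cyc_imageP.

End Tensor.
End Series.

Section Eulerian.
Variables (k : fieldType) (K : comNzRingType) (iota : {rmorphism k -> K}).
Variables (J : choiceType) (deg : J -> int).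

Let lam (i : nat) : k := 2%:R ^+ i.

(* Restricted to words of length n this is e_n(j), j <= n: [shuffle]
   preserves the length of words, so only its component s_n intervenes. *)
Definition eulerian_n (n j : nat) (f : tens K J) : tens K J :=
  iota ((\prod_(0 <= r < n.+1 | r != j) (lam j - lam r))^-1) *:
  (\big[@comp _ _ _/id]_(0 <= r < n.+1 | r != j)
     (fun g : tens K J => shuffle deg g - iota (lam r) *: g)) f.

Definition eulerian (j : nat) (f : tens K J) : tens K J :=
  fun w => if (j <= size w)%N then eulerian_n (size w) j f w else 0.

(* 1 (x) e(j) *)
Definition eulerian' (j : nat) (f : tens K J) : tens K J :=
  fun w => if w is i :: v then eulerian j (fun u => f (i :: u)) v else 0.

End Eulerian.

Section Forms.
Variables (K : comNzRingType) (gr : int -> set K) (I : choiceType) (deg : I -> int).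

(* Differential envelope: inl i is the generator i and inr i its differential *)
Definition form_deg (x : I + I) : int :=
  match x with inl i => deg i | inr i => deg i + 1 end.
Definition form := tens K (I + I)%type.

Definition form_d : form -> form :=
  cont_der form_deg 1 (fun x =>
    match x with inl i => tgen K (inr i) | inr _ => 0 end).

Definition form_inj : tens K I -> form :=
  cont_ext (fun w => tmono K [seq inl i | i <- w]).

(* Lie derivative of a vector field xi of degree p *)
Definition lie_der (p : int) (xi : tens K I -> tens K I) : form -> form :=
  cont_der form_deg p (fun x =>
    match x with
    | inl i => form_inj (xi (tgen K i))
    | inr i => ksgn K p *: form_d (form_inj (xi (tgen K i)))
    end).

Definition DR := mquot (commutators gr form_deg).

Definition Theta : tens K I -> DR := fun f =>
  cls (commutators gr form_deg)
    (cont_ext (fun w => if w is i :: v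
                        then tmono K (inr i :: [seq inl j | j <- v])
                        else 0) f).

(* Inverse of Theta on its domain, the series without constant term *)
Definition Theta_inv (q : DR) : tens K I :=
  xget 0 [set f | f [::] = 0 /\ Theta f = q].

End Forms.

(* A graded free K-module with a homogeneous basis *)
Record gfree (K : comNzRingType) (gr : int -> set K) := GFree {
  gf_mod :> lmodType K;
  gf_gr : int -> set gf_mod;
  gf_idx : choiceType;
  gf_basis : gf_idx -> gf_mod;
  gf_deg : gf_idx -> int;
  gf_span : forall v, exists (s : seq gf_idx) (c : gf_idx -> K),
    v = \sum_(i <- s) c i *: gf_basis i;
  gf_free : forall (s : seq gf_idx) (c : gf_idx -> K), uniq s ->
    \sum_(i <- s) c i *: gf_basis i = 0 -> forall i, i \in s -> c i = 0;
  gf_grP : forall n v, gf_gr n v <-> exists (s : seq gf_idx) (c : gf_idx -> K),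
    (forall i, gr (n - gf_deg i) (c i)) /\ v = \sum_(i <- s) c i *: gf_basis i }.

Section Dual.
Variables (K : comNzRingType) (gr : int -> set K) (V : gfree gr).
Local Notation I := (gf_idx V).
Implicit Types (r : seq (K * I)) (f : prof K I).

Lemma gfree_relation r f :
  \sum_(p <- r) p.1 *: gf_basis p.2 = 0 -> \sum_(p <- r) p.1 * f p.2 = 0.
Proof.
pose u := undup [seq p.2 | p <- r].
pose c i := \sum_(p <- r | p.2 == i) p.1.
have collect (M : zmodType) (g : K -> I -> M) :
    (forall i, {morph g^~ i : x y / x + y}) -> (forall i, g 0 i = 0) ->
    \sum_(p <- r) g p.1 p.2 = \sum_(i <- u) g (c i) i.
  move=> gD g0.
  transitivity (\sum_(i <- u) \sum_(p <- r | p.2 == i) g p.1 p.2); last first.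
    apply: eq_bigr => i _; rewrite /c (big_morph (g^~ i) (gD i) (g0 i)).
    by apply: eq_bigr => p /eqP ->.
  rewrite (exchange_big_dep xpredT) //= big_seq [RHS]big_seq.
  apply: eq_bigr => p pr.
  rewrite -big_filter (eq_filter (a2 := pred1 p.2)) => [|i /=]; last exact: eq_sym.
  by rewrite filter_pred1_uniq ?undup_uniq ?big_seq1 // mem_undup map_f.
rewrite (collect V (fun a i => a *: gf_basis i)); last 2 first.
- by move=> i x y; rewrite scalerDl.
- by move=> i; rewrite scale0r.
move=> /(gf_free (undup_uniq _)) c0.
rewrite (collect K (fun a i => a * f i)); last 2 first.
- by move=> i x y; rewrite mulrDl.
- by move=> i; rewrite mul0r.
by rewrite big_seq big1 // => i /c0 ->; rewrite mul0r.
Qed.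

(* The K-linear forms on V are the elements of [prof K I]: a form is
   determined by its arbitrary values on the basis. *)
Lemma gfree_dual f :
  exists! x : V -> K, scalar x /\ forall i, x (gf_basis i) = f i.
Proof.
have ex v : exists r : seq (K * I), v = \sum_(p <- r) p.1 *: gf_basis p.2.
  have [s [c ->]] := gf_span v.
  by exists [seq (c i, i) | i <- s]; rewrite big_map.
pose R v := sval (cid (ex v)).
have RE v : v = \sum_(p <- R v) p.1 *: gf_basis p.2 := svalP (cid (ex v)).
exists (fun v => \sum_(p <- R v) p.1 * f p.2); split.
  split=> [a v w|i]; apply/eqP; rewrite -subr_eq0; apply/eqP.
  - pose r := R (a *: v + w) ++ [seq (- (a * p.1), p.2) | p <- R v]
              ++ [seq (- p.1, p.2) | p <- R w].
    have /(gfree_relation f) : \sum_(p <- r) p.1 *: gf_basis p.2 = 0.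
      rewrite !big_cat /= !big_map -RE /=.
      under eq_bigr do rewrite scaleNr -scalerA.
      under [X in _ + (_ + X)]eq_bigr do rewrite scaleNr.
      by rewrite !sumrN -scaler_sumr -!RE -opprD subrr.
    rewrite !big_cat /= !big_map /=.
    under [X in _ + (X + _)]eq_bigr do rewrite mulNr -mulrA.
    under [X in _ + (_ + X)]eq_bigr do rewrite mulNr.
    by rewrite !sumrN -mulr_sumr opprD.
  - pose r := R (gf_basis i) ++ [:: (-1, i)].
    have /(gfree_relation f) : \sum_(p <- r) p.1 *: gf_basis p.2 = 0.
      by rewrite big_cat /= big_seq1 -RE scaleN1r subrr.
    by rewrite big_cat /= big_seq1 mulN1r.
move=> x [x_lin xE]; apply/funext => v; rewrite [in RHS](RE v).
have x0 : x 0 = 0.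
  by have := x_lin (-1) 0 0; rewrite scaler0 addr0 mulN1r addNr.
elim: (R v) => [|p r IHr]; first by rewrite !big_nil x0.
by rewrite !big_cons x_lin IHr xE.
Qed.

End Dual.

Section Complexes.
Variables (K : comNzRingType) (gr : int -> set K).

Definition graded_submodule (M : lmodType K) (A : int -> set M) : Prop :=
  [/\ forall n, A n 0,
      forall n x y, A n x -> A n y -> A n (x + y) &
      forall p n c x, gr p c -> A n x -> A (p + n) (c *: x)].

(* Cochain complexes and bicomplexes whose homogeneous parts lie in a module M *)
Record complex (M : lmodType K) := Complex {
  cx_gr : int -> set M;
  cx_d : M -> M }.

Record bicomplex (M : lmodType K) := Bicomplex {
  bi_gr : nat -> int -> set M;
  bi_ver : nat -> M -> M;
  bi_hor : nat -> M -> M }.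

Definition subcomplex (M : lmodType K) (C : complex M) (B : int -> set M) :=
  [/\ forall n, B n `<=` cx_gr C n,
      graded_submodule B &
      forall n x, B n x -> B (n + 1) (cx_d C x)].

Definition subbicomplex (M : lmodType K) (C : bicomplex M)
    (B : nat -> int -> set M) :=
  [/\ forall i n, B i n `<=` bi_gr C i n,
      forall i, graded_submodule (B i),
      forall i n x, B i n x -> B i (n + 1) (bi_ver C i x) &
      forall i n x, B i n x -> B i.+1 n (bi_hor C i x)].

(* The module A is the internal direct product of the B j: every family
   (y_j) with y_j in B j has a sum in A, and every element of A is the sum of
   a unique such family.  Sums converge in the product topology over the
   tensor lengths, comp l being the component of length l.  For complexes,
   the differentials are moreover computed termwise in such sums. *)
Definition sums_to (M : lmodType K) (comp : nat -> M -> M)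
    (y : nat -> M) (x : M) : Prop :=
  forall l, exists m0, forall m, (m0 <= m)%N ->
    comp l (\sum_(j < m) y j) = comp l x.

Definition direct_product (M : lmodType K) (comp : nat -> M -> M)
    (A : set M) (B : nat -> set M) : Prop :=
  (forall y : nat -> M, (forall j, B j (y j)) ->
     exists! x, A x /\ sums_to comp y x) /\
  (forall x, A x ->
     exists! y : nat -> M, (forall j, B j (y j)) /\ sums_to comp y x).

Definition complex_product (M : lmodType K) (comp : nat -> M -> M)
    (C : complex M) (B : nat -> int -> set M) : Prop :=
  (forall j, subcomplex C (B j)) /\
  (forall n, direct_product comp (cx_gr C n) (fun j => B j n)) /\
  (forall n y x, (forall j, B j n (y j)) -> cx_gr C n x -> sums_to comp y x ->
     sums_to comp (fun j => cx_d C (y j)) (cx_d C x)).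

Definition bicomplex_product (M : lmodType K) (comp : nat -> M -> M)
    (C : bicomplex M) (B : nat -> nat -> int -> set M) : Prop :=
  (forall j, subbicomplex C (B j)) /\
  (forall i n, direct_product comp (bi_gr C i n) (fun j => B j i n)) /\
  (forall i n y x, (forall j, B j i n (y j)) -> bi_gr C i n x ->
     sums_to comp y x ->
     sums_to comp (fun j => bi_ver C i (y j)) (bi_ver C i x) /\
     sums_to comp (fun j => bi_hor C i (y j)) (bi_hor C i x)).

End Complexes.

Section CInfinity.
Variables (k : fieldType) (K : comNzRingType) (iota : {rmorphism k -> K}).
Variables (gr : int -> set K) (V : gfree gr).

Local Notation I := (gf_idx V).

(* Degree of the element of the dual of Sigma V dual to the suspension of the
   basis element e_i, where Sigma e_i has degree |e_i| - 1. *)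
Definition sdeg (i : I) : int := 1 - gf_deg i.

Local Notation T := (tens K I).
Local Notation L := (Lhat (K := K) sdeg).

(* A C_infty-structure on V is a map on the Lie algebra Lhat; the values of
   m outside of Lhat are irrelevant. *)
Record Cinfty (m : T -> T) : Prop := {
  Cinfty_Lhat : forall x, L x -> L (m x);
  Cinfty_linear : forall a x y, L x -> L y -> m (a *: x + y) = a *: m x + m y;
  Cinfty_continuous : forall w, exists F : seq (seq I), forall x, L x ->
    (forall u, u \in F -> x u = 0) -> m x w = 0;
  Cinfty_degree : forall n x, L x -> homog gr sdeg n x -> homog gr sdeg (n + 1) (m x);
  Cinfty_derivation : forall p q x y, L x -> L y ->
    homog gr sdeg p x -> homog gr sdeg q y ->
    m (tcomm p q x y) = tcomm (p + 1) q (m x) y + ksgn K p *: tcomm p (q + 1) x (m y);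
  Cinfty_square : forall x, L x -> m (m x) = 0 }.

Variable m : T -> T.

(* The extension of m to a continuous derivation of the associative algebra *)
Definition Cinfty_ext : T -> T := cont_der sdeg 1 (fun i => m (tgen K i)).

Definition Pgr (n : int) : set T := [set f | f [::] = 0 /\ homog gr sdeg n f].

Definition Hoch_b' : T -> T := Cinfty_ext.

Definition Hoch_b (f : T) : T :=
  Theta_inv (induced (lie_der sdeg 1 Cinfty_ext) (Theta gr sdeg f)).

Definition Pcyc := mquot (cyc_submodule K sdeg).

Definition to_Pcyc : T -> Pcyc := cls (cyc_submodule K sdeg).

Definition Pcyc_gr (n : int) : set Pcyc := to_Pcyc @` Pgr n.

Definition Pcyc_comp (l : nat) : Pcyc -> Pcyc := induced (trunc l).

(* As (Sigma A)^n = A^(n + 1), the degrees are shifted by one below. *)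
Definition CC_Hoch : complex Pcyc :=
  Complex (fun n => Pcyc_gr (n + 1)) (induced Hoch_b').

Definition CC_Hoch_part (j : nat) (n : int) : set Pcyc :=
  induced (eulerian iota sdeg j) @` Pcyc_gr (n + 1).

Definition CC_Tsygan : bicomplex T :=
  Bicomplex (fun _ n => Pgr (n + 1))
    (fun i => if odd i then Hoch_b' else Hoch_b)
    (fun i => if odd i then cyc_norm sdeg else fun f => f - cyc sdeg f).

Definition Qpart (j : nat) (n : int) : set T := eulerian iota sdeg j @` Pgr (n + 1).
Definition Qtilde (j : nat) (n : int) : set T := eulerian' iota sdeg j @` Pgr (n + 1).

(* Column 2c of Gamma_j is Qtilde_(j-c) for c <= j, column 2c+1 is Qpart_(j-c) for
   c < j, and the remaining columns vanish. *)
Definition Gamma (j i : nat) (n : int) : set T :=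
  let c := i./2 in
  if odd i then (if (c < j)%N then Qpart (j - c) n else [set 0])
  else (if (c <= j)%N then Qtilde (j - c) n else [set 0]).

End CInfinity.

(* Main.v *)
Require Import Defs.
From HB Require Import structures.
From mathcomp Require Import all_boot all_order all_algebra.
From mathcomp Require Import boolp classical_sets functions cardinality fsbigop.
From mathcomp Require Import ring.

Set Implicit Arguments.
Unset Strict Implicit.
Unset Printing Implicit Defensive.

Import Order.TTheory GRing.Theory.
Local Open Scope classical_set_scope.
Local Open Scope ring_scope.

(** Everything rests on the operator [s = mu Delta] of [shuffle], whose
    eigenspaces the Eulerian projections cut out.

    A product of [r] Lie elements is, modulo products of fewer Lie elements, an
    eigenvector of [s] with eigenvalue [2 ^ r] ([shuffle_product]): each factor
    is primitive, hence goes to the left or to the right part of the coproduct,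
    and putting the parts back in order costs brackets.  Words are products of
    letters, so a word of length [n > 0] is a sum of eigenvectors with eigenvalues
    [2 ^ j], [1 <= j <= n] ([eigen_sum_word]).  On these the products defining
    [e(j)] reduce to scalars, so the [e(j)] are orthogonal projections onto the
    eigenspaces and add up to the identity ([word_eigen], [eulerian_eigen]).  A
    continuous operator which carries eigenvectors to eigenvectors therefore
    intertwines the projections ([intertwine_projections]), and it remains to
    compare [s], and [1 (x) s], which belongs to the projections [1 (x) e(j)],
    with the four maps of the bicomplex.

    - [b'] is a derivation with Lie values on the generators.  As Lie elements are
      primitive, it is also a coderivation and commutes with [s] ([shuffle_der]).
    - [1 - z] maps [x (x) f] to the bracket [x, f].  Brackets with [x] are
      derivations of the same kind, so [s (1 - z) = (1 - z) (1 (x) s)]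
      ([shuffle_sub_cyc]).
    - [N] satisfies [N s = 2 (1 (x) s) N] ([cyc_norm_shuffle]), whence the shift of
      the index by one.  A rotation which occurs in [N s] chooses a letter in the
      left or in the right part of the coproduct; both choices give the same by
      cocommutativity, and the first one is computed by [lift_shuffle_cyc_der].
    - [b] is, up to sign, the map [x (x) v -> C(m x, v) + (-1)^|x| x (x) m v],
      where the cyclic derivative [C(u, v)] represents [du . v] modulo commutators
      ([hoch], [Theta_inv_lie_der]).  It commutes with [1 (x) s]: for a Lie
      element [u], the map [C(u, -)] is assembled from inner derivations
      ([hoch_lift_shuffle]).

    To identify [b] one has to know the closed space of graded commutators of
    forms.  In characteristic 0 it is the image of [1 - z], which is the kernel of
    [N] in positive length ([commutators_cyc]); so membership can be tested by
    [N], on words.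

    All operators are linear and continuous for pointwise convergence, and such
    operators are compared on words ([cont_eq]).  None of the four maps lowers the
    length of words, which makes the infinite sums legitimate
    ([direct_product_projections], [sums_to_map]). *)

(** * Continuous linear maps between profinite modules *)

Section Pointwise.
Variables (K : comNzRingType) (X : Type).
Implicit Types f g : prof K X.

Lemma profD f g x : (f + g) x = f x + g x. Proof. by []. Qed.
Lemma profN f x : (- f) x = - f x. Proof. by []. Qed.
Lemma profB f g x : (f - g) x = f x - g x. Proof. by []. Qed.
Lemma profZ c f x : (c *: f) x = c * f x. Proof. by []. Qed.
Lemma prof0 x : (0 : prof K X) x = 0. Proof. by []. Qed.

Lemma prof_sum I (r : seq I) (P : pred I) (F : I -> prof K X) x :
  (\sum_(i <- r | P i) F i) x = \sum_(i <- r | P i) F i x.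
Proof. by apply: (big_morph (fun f : prof K X => f x)). Qed.

End Pointwise.

Definition profE := (profD, profN, profZ, prof0, prof_sum).

Section Continuity.
Variable K : comNzRingType.
Implicit Types X Y Z : choiceType.

(** Continuity for the topology of pointwise convergence with [K] discrete:
    each coordinate of the value depends on finitely many coordinates. *)
Record cont X Y (A : prof K X -> prof K Y) : Prop := Cont {
  cont_linear : linear A;
  cont_coord : forall y, exists F : seq X,
    forall f, (forall x, x \in F -> f x = 0) -> A f y = 0 }.

Lemma basis_eltN X (x y : X) : x != y -> basis_elt K x y = 0.
Proof. by rewrite /basis_elt eq_sym => /negPf ->. Qed.

Lemma basis_elt_id X (x : X) : basis_elt K x x = 1.
Proof. by rewrite /basis_elt eqxx. Qed.

Section Linear.
Variables (X Y : choiceType) (A : prof K X -> prof K Y).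
Hypothesis contA : cont A.

Lemma cont0 : A 0 = 0.
Proof. by have := cont_linear contA (-1) 0 0; rewrite scaler0 addr0 scaleN1r addNr. Qed.
Lemma contD f g : A (f + g) = A f + A g.
Proof. by have := cont_linear contA 1 f g; rewrite !scale1r. Qed.
Lemma contZ c f : A (c *: f) = c *: A f.
Proof. by have := cont_linear contA c f 0; rewrite cont0 !addr0. Qed.
Lemma contN f : A (- f) = - A f.
Proof. by rewrite -scaleN1r contZ scaleN1r. Qed.
Lemma contB f g : A (f - g) = A f - A g.
Proof. by rewrite contD contN. Qed.
Lemma cont_sum I (r : seq I) (P : pred I) (F : I -> prof K X) :
  A (\sum_(i <- r | P i) F i) = \sum_(i <- r | P i) A (F i).
Proof. exact: (big_morph A contD cont0). Qed.

Lemma basis_expand (F : seq X) (f : prof K X) x :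
  uniq F -> x \in F -> (\sum_(u <- F) f u *: basis_elt K u) x = f x.
Proof.
move=> uF xF; rewrite prof_sum (bigD1_seq x) //= profZ /basis_elt eqxx mulr1.
by rewrite big1 ?addr0 // => u ux; rewrite profZ eq_sym (negPf ux) mulr0.
Qed.

Lemma cont_coordE y : exists2 F : seq X, uniq F &
  forall f, A f y = \sum_(u <- F) f u * A (basis_elt K u) y.
Proof.
have [F AF] := cont_coord contA y; exists (undup F); first exact: undup_uniq.
move=> f; pose g := \sum_(u <- undup F) f u *: basis_elt K u.
have: A (f - g) y = 0.
  apply: AF => x xF; rewrite profB /g basis_expand ?undup_uniq ?mem_undup //.
  by rewrite subrr.
rewrite contB profB => /eqP; rewrite subr_eq0 => /eqP ->.
by rewrite /g cont_sum prof_sum; apply: eq_bigr => u _; rewrite contZ.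
Qed.

End Linear.

Lemma cont_eq X Y (A B : prof K X -> prof K Y) : cont A -> cont B ->
  (forall x, A (basis_elt K x) = B (basis_elt K x)) -> A =1 B.
Proof.
move=> cA cB AB f; apply/funext => y.
have cAB : cont (fun f => A f - B f).
  split=> [a u v|z].
    by rewrite (cont_linear cA) (cont_linear cB) scalerBr opprD addrACA.
  have [[F FA] [G GB]] := (cont_coord cA z, cont_coord cB z).
  exists (F ++ G) => h h0; rewrite profB FA ?GB ?subrr // => x xF;
    by rewrite h0 // mem_cat xF ?orbT.
have [F _ AF] := cont_coordE cAB y.
apply/eqP; rewrite -subr_eq0 -[_ - _]/((A f - B f) y) AF big1 // => u _.
by rewrite AB subrr mulr0.
Qed.

Lemma cont_id X : cont (fun f : prof K X => f).
Proof. by split=> [//|y]; exists [:: y] => f -> //; rewrite mem_head. Qed.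

Lemma cont_zero X Y : cont (fun _ : prof K X => 0 : prof K Y).
Proof. by split=> [a u v|y]; [rewrite scaler0 addr0 | exists [::]]. Qed.

Lemma cont_scale X Y (A : prof K X -> prof K Y) c :
  cont A -> cont (fun f => c *: A f).
Proof.
move=> cA; split=> [a u v|y].
  by rewrite (cont_linear cA) scalerDr !scalerA mulrC.
have [F FA] := cont_coord cA y; exists F => f f0.
by rewrite profZ FA // mulr0.
Qed.

Lemma cont_add X Y (A B : prof K X -> prof K Y) :
  cont A -> cont B -> cont (fun f => A f + B f).
Proof.
move=> cA cB; split=> [a u v|y].
  by rewrite (cont_linear cA) (cont_linear cB) scalerDr addrACA.
have [[F FA] [G GB]] := (cont_coord cA y, cont_coord cB y).
exists (F ++ G) => f f0; rewrite profD FA ?GB ?addr0 // => x xF;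
  by rewrite f0 // mem_cat xF ?orbT.
Qed.

Lemma cont_opp X Y (A : prof K X -> prof K Y) : cont A -> cont (fun f => - A f).
Proof.
move=> /(cont_scale (-1)); congr cont.
by apply/funext => f; rewrite scaleN1r.
Qed.

Lemma cont_sub X Y (A B : prof K X -> prof K Y) :
  cont A -> cont B -> cont (fun f => A f - B f).
Proof. by move=> cA cB; apply: cont_add => //; apply: cont_opp. Qed.

Lemma cont_sumop X Y I (r : seq I) (P : pred I) (A : I -> prof K X -> prof K Y) :
  (forall i, cont (A i)) -> cont (fun f => \sum_(i <- r | P i) A i f).
Proof.
move=> cA; elim: r => [|i r IHr].
  by under eq_fun do rewrite big_nil; exact: cont_zero.
under eq_fun do rewrite big_cons; case: (P i) => //.
exact: (cont_add (cA i)).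
Qed.

Lemma cont_comp X Y Z (A : prof K X -> prof K Y) (B : prof K Y -> prof K Z) :
  cont A -> cont B -> cont (fun f => B (A f)).
Proof.
move=> cA cB; split=> [a u v|z]; first by rewrite (cont_linear cA) (cont_linear cB).
have [F BF] := cont_coord cB z.
have /choice [G AG] : forall y, exists F : seq X,
  forall f, (forall x, x \in F -> f x = 0) -> A f y = 0 by exact: cont_coord.
exists (flatten [seq G y | y <- F]) => f f0; apply: BF => y yF.
by apply: AG => x xG; apply: f0; apply/flattenP; exists (G y); rewrite ?map_f.
Qed.

Lemma cont_finite X Y (A : prof K X -> prof K Y) (F : Y -> seq X) :
  linear A ->
  (forall f y, (forall x, x \in F y -> f x = 0) -> A f y = 0) -> cont A.
Proof. by move=> lA fA; split=> // y; exists (F y) => f; apply: fA. Qed.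

(** The convergence to 0 which makes the sums in [cont_ext] finite. *)
Definition locfin X Y (phi : X -> prof K Y) :=
  forall y, exists s : seq X, forall x, phi x y != 0 -> x \in s.

Lemma fsum_seq X (r : seq X) (F : X -> K) : uniq r ->
  (forall x, F x != 0 -> x \in r) ->
  \sum_(x \in [set: X]) F x = \sum_(x <- r) F x.
Proof.
move=> ur Fr; rewrite (fsbigE r _ ur) //=.
  by apply: eq_bigl => x; rewrite in_setT.
by move=> x _ xr; apply/eqP; apply: contraNT xr => /Fr.
Qed.

Lemma cont_ext_sum X Y (phi : X -> prof K Y) f y (s : seq X) :
  (forall x, phi x y != 0 -> x \in s) ->
  cont_ext phi f y = \sum_(x <- undup s) f x * phi x y.
Proof.
move=> sP; apply: fsum_seq; first exact: undup_uniq.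
move=> x; rewrite mem_undup => nz; apply: sP.
by apply: contra_neq nz => ->; rewrite mulr0.
Qed.

Lemma cont_cont_ext X Y (phi : X -> prof K Y) : locfin phi -> cont (cont_ext phi).
Proof.
move=> lphi; split=> [a u v|y].
  apply/funext => y; have [s sP] := lphi y.
  rewrite profD profZ !(cont_ext_sum _ sP) mulr_sumr -big_split /=.
  by apply: eq_bigr => x _; rewrite profD profZ mulrDl mulrA.
have [s sP] := lphi y; exists s => f f0; rewrite (cont_ext_sum _ sP).
by rewrite big1_seq // => x /andP[_]; rewrite mem_undup => /f0 ->; rewrite mul0r.
Qed.

Lemma cont_ext_basis X Y (phi : X -> prof K Y) x :
  cont_ext phi (basis_elt K x) = phi x.
Proof.
apply/funext => y; rewrite /cont_ext (fsum_seq (r := [:: x])) //=.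
  by rewrite big_seq1 /basis_elt eqxx mul1r.
move=> z; rewrite inE; apply: contraNT => zx.
by rewrite basis_eltN ?mul0r // eq_sym.
Qed.

Lemma cont_extE X Y (A : prof K X -> prof K Y) : cont A ->
  A =1 cont_ext (fun x => A (basis_elt K x)).
Proof.
move=> cA; suff lA : locfin (fun x => A (basis_elt K x)).
  by apply: (cont_eq cA (cont_cont_ext lA)) => x; rewrite cont_ext_basis.
move=> y; have [F FA] := cont_coord cA y; exists F => x nz.
apply/negPn/negP => xF; case/eqP: nz; apply: FA => z zF.
by apply: basis_eltN; apply: contraNneq xF => ->.
Qed.

(** Testing a closed condition on the elements of [S] suffices: in a given
    coordinate only finitely many terms of a convergent sum matter. *)
Lemma cont_conv_span X Y (A B : prof K X -> prof K Y) (S : set (prof K X)) :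
  cont A -> cont B -> (forall x, S x -> A x = B x) ->
  forall x, conv_span S x -> A x = B x.
Proof.
move=> cA cB AB x [T [c [a [Sa xE]]]]; apply/eqP; rewrite -subr_eq0; apply/eqP.
apply/funext => y; rewrite prof0.
have [F FA] := cont_coord (cont_sub cA cB) y.
have /choice [U UE] : forall z, exists r : seq T,
  forall s, c s * a s z != 0 -> s \in r.
  move=> z; have [/finite_seqP [r rE] _] := xE z; exists r => s nz.
  by have : [set` r] s by rewrite -rE.
pose L : seq T := undup (flatten [seq U z | z <- F]).
rewrite -[x](subrK (\sum_(s <- L) c s *: a s)).
pose D f := A f - B f; have cD : cont D by exact: cont_sub.
rewrite -/(D _) (contD cD) profD [D (_ - _) y]FA ?add0r => [|z zF].
  rewrite (cont_sum cD) prof_sum big1 // => s _.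
  by rewrite (contZ cD) /D AB // subrr scaler0.
have [_ xz] := xE z; rewrite profB xz prof_sum; apply/eqP; rewrite subr_eq0; apply/eqP.
apply: fsum_seq; first exact: undup_uniq.
move=> s nz; rewrite mem_undup; apply/flattenP; exists (U z); last exact: UE.
exact: map_f.
Qed.

Lemma locfin_comp X Y Z (phi : X -> prof K Y) (A : prof K Y -> prof K Z) :
  locfin phi -> cont A -> locfin (fun x => A (phi x)).
Proof.
move=> /choice [r rP] cA y; have [s _ sE] := cont_coordE cA y.
exists (flatten [seq r u | u <- s]) => x; rewrite sE => nz.
have [u us xu] : exists2 u, u \in s & phi x u != 0.
  apply/hasP; apply: contraNT nz => /hasPn x0.
  by rewrite big1_seq // => u /andP[_ /x0 /negPn /eqP ->]; rewrite mul0r.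
by apply/flattenP; exists (r u); [exact: map_f | exact: rP].
Qed.

Lemma conv_span_sub X (S : set (prof K X)) x : S x -> conv_span S x.
Proof.
move=> Sx; exists unit, (fun=> 1), (fun=> x); split=> // y.
split; first exact: finite_finset.
by rewrite (fsum_seq (r := [:: tt])) ?big_seq1 ?mul1r // => -[].
Qed.

End Continuity.

(** * Signs *)

Section Parity.

Definition parz (n : int) : bool := odd `|n|%N.

Lemma parzD m n : parz (m + n) = parz m (+) parz n.
Proof.
rewrite /parz; case: m n => m [] n; rewrite ?NegzE -?opprD ?abszN ?addrA //.
- by rewrite -PoszD /= oddD.
- rewrite /= addbN; case: (leqP n.+1 m) => [nm|mn].
    by rewrite subzn // absz_nat oddB //= addbN.
  by rewrite distnC subzn ?(ltnW mn) // absz_nat oddB ?(ltnW mn) //= addNb addbC.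
- rewrite addrC /= addNb; case: (leqP m.+1 n) => [nm|mn].
    by rewrite subzn // absz_nat oddB //= addbN addbC.
  by rewrite distnC subzn ?(ltnW mn) // absz_nat oddB ?(ltnW mn) //= addNb.
by rewrite -PoszD !absz_nat oddD.
Qed.

Lemma parzN n : parz (- n) = parz n. Proof. by rewrite /parz abszN. Qed.
Lemma parzB m n : parz (m - n) = parz m (+) parz n.
Proof. by rewrite parzD parzN. Qed.
Lemma parzM m n : parz (m * n) = parz m && parz n.
Proof. by rewrite /parz abszM oddM. Qed.
Lemma parz1 : parz 1 = true. Proof. by []. Qed.

Lemma ksgnE (K : comNzRingType) n : ksgn K n = (-1) ^+ parz n.
Proof. by rewrite /ksgn signr_odd. Qed.

End Parity.

(** * The completed tensor algebra *)

Section TensorAlgebra.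
Variables (K : comNzRingType) (J : choiceType) (deg : J -> int).
Local Notation T := (tens K J).
Local Notation T2 := (tens2 K J).
Local Notation mono := (tmono K).
Local Notation one := (tmono K [::]).
Local Notation sg b := ((-1) ^+ nat_of_bool b : K).
Implicit Types (u v w : seq J) (f g h : T).

Definition dpar j := parz (deg j).
Definition par w := parz (wdeg deg w).

Lemma wdeg_nil : wdeg deg [::] = 0. Proof. exact: big_nil. Qed.
Lemma wdeg_cons j v : wdeg deg (j :: v) = deg j + wdeg deg v.
Proof. exact: big_cons. Qed.
Lemma wdeg_cat u v : wdeg deg (u ++ v) = wdeg deg u + wdeg deg v.
Proof. exact: big_cat. Qed.

Lemma par_nil : par [::] = false. Proof. by rewrite /par wdeg_nil. Qed.
Lemma par_cons j v : par (j :: v) = dpar j (+) par v.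
Proof. by rewrite /par wdeg_cons parzD. Qed.
Lemma par_cat u v : par (u ++ v) = par u (+) par v.
Proof. by rewrite /par wdeg_cat parzD. Qed.
Lemma par_rcons v j : par (rcons v j) = par v (+) dpar j.
Proof. by rewrite -cats1 par_cat par_cons par_nil addbF. Qed.

Lemma cont_eqT (Y : choiceType) (A B : T -> prof K Y) : cont A -> cont B ->
  (forall w, A (mono w) = B (mono w)) -> A =1 B.
Proof. exact: cont_eq. Qed.

Lemma tmono_id w : mono w w = 1. Proof. exact: basis_elt_id. Qed.
Lemma tmonoN u w : u != w -> mono u w = 0. Proof. exact: basis_eltN. Qed.

Lemma tmul_tmono u v : tmul (mono u) (mono v) = mono (u ++ v).
Proof.
apply/funext => w; rewrite /tmul.
have off (k : 'I_(size w).+1) : (k : nat) != size u ->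
    mono u (take k w) * mono v (drop k w) = 0.
  move=> ku; rewrite tmonoN ?mul0r //; apply: contra_neq ku => ->.
  by rewrite size_take_min (minn_idPl _) // -ltnS.
case: (leqP (size u) (size w)) => uw.
  rewrite (bigD1 (inord (size u))) //= big1 => [|k]; last first.
    by rewrite -val_eqE /= inordK // => /off.
  rewrite addr0 inordK //; case: (eqVneq (u ++ v) w) => [<-|uvw].
    by rewrite take_size_cat // drop_size_cat // !tmono_id mulr1.
  rewrite (tmonoN uvw); case: (eqVneq u (take (size u) w)) => [uE|ne]; last first.
    by rewrite (tmonoN ne) mul0r.
  rewrite [X in _ * X]tmonoN ?mulr0 //; apply: contra_neq uvw => ->.
  by rewrite uE size_take_min (minn_idPl _) // cat_take_drop.
rewrite big1 => [|k _]; last first.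
  by apply: off; rewrite neq_ltn (leq_trans (ltn_ord k)).
by rewrite tmonoN //; apply: contraTneq uw => <-; rewrite size_cat -leqNgt leq_addr.
Qed.

Lemma linear_tmull g : linear (fun f => tmul f g).
Proof.
move=> a f f'; apply/funext => w; rewrite profD profZ /tmul mulr_sumr -big_split.
by apply: eq_bigr => k _; rewrite profD profZ mulrDl mulrA.
Qed.

Lemma linear_tmulr f : linear (tmul f).
Proof.
move=> a g g'; apply/funext => w; rewrite profD profZ /tmul mulr_sumr -big_split.
by apply: eq_bigr => k _; rewrite profD profZ mulrDr mulrCA.
Qed.

Lemma cont_tmull_id g : cont (fun f => tmul f g).
Proof.
apply: (cont_finite (F := fun w => [seq take k w | k <- iota 0 (size w).+1])).
  exact: linear_tmull.
move=> f w f0; rewrite /tmul big1 // => k _; rewrite f0 ?mul0r //.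
by apply: (map_f (fun i => take i w)); rewrite mem_iota /= add0n.
Qed.

Lemma cont_tmulr_id f : cont (tmul f).
Proof.
apply: (cont_finite (F := fun w => [seq drop k w | k <- iota 0 (size w).+1])).
  exact: linear_tmulr.
move=> g w g0; rewrite /tmul big1 // => k _; rewrite g0 ?mulr0 //.
by apply: (map_f (fun i => drop i w)); rewrite mem_iota /= add0n.
Qed.

Lemma cont_tmull (X : choiceType) (A : prof K X -> T) g : cont A -> cont (fun x => tmul (A x) g).
Proof. by move=> cA; apply: (cont_comp cA (cont_tmull_id g)). Qed.
Lemma cont_tmulr (X : choiceType) (A : prof K X -> T) f : cont A -> cont (fun x => tmul f (A x)).
Proof. by move=> cA; apply: (cont_comp cA (cont_tmulr_id f)). Qed.

Lemma tmulDl f g h : tmul (f + g) h = tmul f h + tmul g h.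
Proof. exact: (contD (cont_tmull_id h)). Qed.
Lemma tmulBl f g h : tmul (f - g) h = tmul f h - tmul g h.
Proof. exact: (contB (cont_tmull_id h)). Qed.
Lemma tmulZl c f h : tmul (c *: f) h = c *: tmul f h.
Proof. exact: (contZ (cont_tmull_id h)). Qed.
Lemma tmul0l h : tmul 0 h = 0. Proof. exact: (cont0 (cont_tmull_id h)). Qed.
Lemma tmulDr h f g : tmul h (f + g) = tmul h f + tmul h g.
Proof. exact: (contD (cont_tmulr_id h)). Qed.
Lemma tmulBr h f g : tmul h (f - g) = tmul h f - tmul h g.
Proof. exact: (contB (cont_tmulr_id h)). Qed.
Lemma tmulZr h c f : tmul h (c *: f) = c *: tmul h f.
Proof. exact: (contZ (cont_tmulr_id h)). Qed.
Lemma tmul0r h : tmul h 0 = 0. Proof. exact: (cont0 (cont_tmulr_id h)). Qed.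

Lemma tmul1l f : tmul one f = f.
Proof.
move: f; apply: cont_eqT => [||w]; [exact: cont_tmulr_id | exact: cont_id |].
exact: tmul_tmono.
Qed.
Lemma tmul1r f : tmul f one = f.
Proof.
move: f; apply: cont_eqT => [||w]; [exact: cont_tmull_id | exact: cont_id |].
by rewrite tmul_tmono cats0.
Qed.

Lemma tmulA f g h : tmul f (tmul g h) = tmul (tmul f g) h.
Proof.
move: f; apply: cont_eqT => [||u].
- exact: cont_tmull_id.
- exact/cont_tmull/cont_tmull_id.
move: g; apply: cont_eqT => [||v].
- exact/cont_tmulr/cont_tmull_id.
- exact/cont_tmull/cont_tmulr_id.
move: h; apply: cont_eqT => [||w].
- exact/cont_tmulr/cont_tmulr_id.
- exact: cont_tmulr_id.
by rewrite !tmul_tmono catA.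
Qed.

(** [f] is a combination of words of parity [b].  As [K] is evenly graded,
    this is all that the Koszul signs see of the degree. *)
Definition has_par (b : bool) f := forall w, f w != 0 -> par w = b.

Lemma has_par0 b : has_par b 0. Proof. by move=> w; rewrite prof0 eqxx. Qed.
Lemma has_parZ b c f : has_par b f -> has_par b (c *: f).
Proof.
by move=> bf w nz; apply: bf; apply: contra_neq nz => fw; rewrite profZ fw mulr0.
Qed.
Lemma has_parD b f g : has_par b f -> has_par b g -> has_par b (f + g).
Proof.
move=> bf bg w; rewrite profD; have [->|/bf //] := eqVneq (f w) 0.
by rewrite add0r => /bg.
Qed.
Lemma has_parB b f g : has_par b f -> has_par b g -> has_par b (f - g).
Proof.
by move=> bf bg; rewrite -scaleN1r; apply: has_parD => //; apply: has_parZ.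
Qed.
Lemma has_par_tmono w : has_par (par w) (mono w).
Proof. by move=> u; have [->//|/tmonoN ->] := eqVneq w u; rewrite eqxx. Qed.
Lemma has_par_tgen j : has_par (dpar j) (tgen K j).
Proof. by have := @has_par_tmono [:: j]; rewrite par_cons par_nil addbF. Qed.

Lemma sum_neq0 (n : nat) (F : 'I_n -> K) :
  \sum_i F i != 0 -> exists i, F i != 0.
Proof.
move=> nz; apply/existsP; apply: contra_neqT nz; rewrite negb_exists => /forallP F0.
by rewrite big1 // => i _; apply/eqP/negPn/F0.
Qed.

Lemma has_par_tmul b c f g : has_par b f -> has_par c g -> has_par (b (+) c) (tmul f g).
Proof.
move=> bf cg w /sum_neq0 [k nz].
rewrite -(cat_take_drop k w) par_cat (bf (take k w)) ?(cg (drop k w)) //.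
  by apply: contra_neq nz => ->; rewrite mulr0.
by apply: contra_neq nz => ->; rewrite mul0r.
Qed.

(** * The tensor square *)

Lemma tprod_basis u v : basis_elt K (u, v) = tprod (mono u) (mono v).
Proof.
apply/funext => -[x y].
by rewrite /tprod /tmono /basis_elt xpair_eqE -mulnb natrM.
Qed.

Lemma cont_eqT2 (Y : choiceType) (A B : T2 -> prof K Y) : cont A -> cont B ->
  (forall u v, A (tprod (mono u) (mono v)) = B (tprod (mono u) (mono v))) ->
  A =1 B.
Proof. by move=> cA cB AB; apply: cont_eq => // -[u v]; rewrite tprod_basis. Qed.

Lemma cont_tprodl_id g : cont (fun f => tprod f g).
Proof.
apply: (cont_finite (F := fun uv => [:: uv.1])) => [a f f'|f uv f0].
  by apply/funext => uv; rewrite profD profZ /tprod profD profZ mulrDl mulrA.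
by rewrite /tprod f0 ?mem_head ?mul0r.
Qed.
Lemma cont_tprodr_id f : cont (tprod f).
Proof.
apply: (cont_finite (F := fun uv => [:: uv.2])) => [a g g'|g uv g0].
  by apply/funext => uv; rewrite profD profZ /tprod profD profZ mulrDr mulrCA.
by rewrite /tprod g0 ?mem_head ?mulr0.
Qed.
Lemma tprodDl f g h : tprod (f + g) h = tprod f h + tprod g h.
Proof. exact: (contD (cont_tprodl_id h)). Qed.
Lemma tprodBl f g h : tprod (f - g) h = tprod f h - tprod g h.
Proof. exact: (contB (cont_tprodl_id h)). Qed.
Lemma tprodZl c f h : tprod (c *: f) h = c *: tprod f h.
Proof. exact: (contZ (cont_tprodl_id h)). Qed.
Lemma tprodDr h f g : tprod h (f + g) = tprod h f + tprod h g.
Proof. exact: (contD (cont_tprodr_id h)). Qed.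
Lemma tprodBr h f g : tprod h (f - g) = tprod h f - tprod h g.
Proof. exact: (contB (cont_tprodr_id h)). Qed.
Lemma tprodZr h c f : tprod h (c *: f) = c *: tprod h f.
Proof. exact: (contZ (cont_tprodr_id h)). Qed.

Local Notation mul2 F G := (@tmul2 K J deg F G : T2).

Lemma cont_tmul2l_id G : cont (fun F : T2 => mul2 F G : T2).
Proof.
apply: (cont_finite (F := fun uv : seq J * seq J =>
  [seq (take a uv.1, take b uv.2) | a <- iota 0 (size uv.1).+1,
                                    b <- iota 0 (size uv.2).+1])).
  move=> c F F'; apply/funext => -[u v]; rewrite profD profZ /tmul2 mulr_sumr.
  rewrite -big_split; apply: eq_bigr => a _ /=; rewrite mulr_sumr -big_split.
  apply: eq_bigr => b _ /=; rewrite profD profZ mulrDl mulrDr; congr (_ + _).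
  by rewrite -!mulrA mulrCA.
move=> F [u v] F0; rewrite /tmul2 big1 // => a _; rewrite big1 // => b _.
rewrite F0 ?mul0r ?mulr0 //.
by apply: (allpairs_f (fun a b => (take a u, take b v)));
  rewrite mem_iota /= add0n.
Qed.

Lemma cont_tmul2r_id F : cont (fun G : T2 => mul2 F G).
Proof.
apply: (cont_finite (F := fun uv : seq J * seq J =>
  [seq (drop a uv.1, drop b uv.2) | a <- iota 0 (size uv.1).+1,
                                    b <- iota 0 (size uv.2).+1])).
  move=> c G G'; apply/funext => -[u v]; rewrite profD profZ /tmul2 mulr_sumr.
  rewrite -big_split; apply: eq_bigr => a _ /=; rewrite mulr_sumr -big_split.
  apply: eq_bigr => b _ /=; rewrite profD profZ !mulrDr; congr (_ + _).
  by rewrite [RHS]mulrCA; congr (_ * _); rewrite mulrCA.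
move=> G [u v] G0; rewrite /tmul2 big1 // => a _; rewrite big1 // => b _.
rewrite G0 ?mulr0 //.
by apply: (allpairs_f (fun a b => (drop a u, drop b v)));
  rewrite mem_iota /= add0n.
Qed.

Lemma cont_tmul2l (X : choiceType) (A : prof K X -> T2) G : cont A -> cont (fun x => mul2 (A x) G).
Proof. by move=> cA; apply: (cont_comp cA (cont_tmul2l_id G)). Qed.
Lemma cont_tmul2r (X : choiceType) (A : prof K X -> T2) F : cont A -> cont (fun x => mul2 F (A x)).
Proof. by move=> cA; apply: (cont_comp cA (cont_tmul2r_id F)). Qed.

Lemma tmul2Dl F G H : mul2 (F + G) H = mul2 F H + mul2 G H.
Proof. exact: (contD (cont_tmul2l_id H)). Qed.
(** Only the inner factors are exchanged, so only they need a parity. *)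
Lemma tmul2_tprod p q f g h l : has_par p g -> has_par q h ->
  mul2 (tprod f g) (tprod h l) = sg (p && q) *: tprod (tmul f h) (tmul g l).
Proof.
move=> pg qh; apply/funext => -[u v]; rewrite profZ /tprod /tmul2 /tmul /=.
rewrite mulr_suml mulr_sumr; apply: eq_bigr => a _.
rewrite !mulr_sumr; apply: eq_bigr => b _; rewrite ksgnE parzM -/(par (take b v)) -/(par (drop a u)).
have [g0|/pg ->] := eqVneq (g (take b v)) 0; first by rewrite g0 !(mulr0, mul0r).
have [h0|/qh ->] := eqVneq (h (drop a u)) 0; first by rewrite h0 !(mulr0, mul0r).
by congr (_ * _); rewrite -!mulrA; congr (_ * _); rewrite mulrCA.
Qed.

Lemma cont_tmult_id : cont (@tmult K J).
Proof.
apply: (cont_finite (F := fun w => [seq (take k w, drop k w) | k <- iota 0 (size w).+1])).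
  move=> a F G; apply/funext => w; rewrite profD profZ /tmult mulr_sumr -big_split.
  by apply: eq_bigr.
move=> F w F0; rewrite /tmult big1 // => k _; apply: F0.
by apply: (map_f (fun k => (take k w, drop k w))); rewrite mem_iota /= add0n.
Qed.
Lemma cont_tmult (X : choiceType) (A : prof K X -> T2) : cont A -> cont (fun x => tmult (A x)).
Proof. by move=> cA; apply: (cont_comp cA cont_tmult_id). Qed.

Lemma tmult_tprod f g : tmult (tprod f g) = tmul f g. Proof. by []. Qed.

End TensorAlgebra.

Arguments has_par_tmono {K J} deg w.
Arguments has_par_tgen {K J} deg j.
Arguments has_par_tmul {K J deg b c f g}.
Arguments has_parB {K J deg b f g}.
Arguments has_parD {K J deg b f g}.
Arguments has_parZ {K J deg b} c {f}.

(** * The coproduct and the shuffle operator *)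

Section Coproduct.
Variables (K : comNzRingType) (J : choiceType) (deg : J -> int).
Local Notation T := (tens K J).
Local Notation T2 := (tens2 K J).
Local Notation mono := (tmono K).
Local Notation one := (tmono K [::]).
Local Notation sg b := ((-1) ^+ nat_of_bool b : K).
Local Notation mul2 F G := (@tmul2 K J deg F G : T2).
Local Notation par := (par deg).
Local Notation dpar := (dpar deg).
Local Notation has_par := (@has_par K J deg).
Implicit Types (u v w : seq J) (f g h : T).

(** Sum of [phi a b] over all ways of splitting [w] into two complementary
    subwords, with the Koszul sign of moving [a] in front of [b]: the terms of
    the coproduct of [w]. *)
Fixpoint dsum (M : lmodType K) w (phi : seq J -> seq J -> M) : M :=
  if w is j :: v
  then dsum v (fun a b => phi (j :: a) b + sg (dpar j && par a) *: phi a (j :: b))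
  else phi [::] [::].

Lemma eq_dsum (M : lmodType K) w (phi psi : seq J -> seq J -> M) :
  (forall a b, perm_eq (a ++ b) w -> phi a b = psi a b) ->
  dsum w phi = dsum w psi.
Proof.
elim: w phi psi => [|j w IHw] phi psi E /=; first exact: E.
apply: IHw => a b abw; rewrite !E //= ?perm_cons //.
by rewrite -cat_rcons -cats1 -catA perm_catCA /= perm_cons.
Qed.

Lemma dsumD (M : lmodType K) w (phi psi : seq J -> seq J -> M) :
  dsum w (fun a b => phi a b + psi a b) = dsum w phi + dsum w psi.
Proof.
elim: w phi psi => [|j w IHw] phi psi //=; rewrite -IHw.
by apply: eq_dsum => a b _; rewrite scalerDr addrACA.
Qed.

Lemma dsum_linear (M M' : lmodType K) (A : M -> M') w phi : linear A ->
  A (dsum w phi) = dsum w (fun a b => A (phi a b)).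
Proof.
move=> lA; have AD x y : A (x + y) = A x + A y.
  by have := lA 1 x y; rewrite !scale1r.
have A0 : A 0 = 0 by apply: (addrI (A 0)); rewrite -AD !addr0.
have AZ c x : A (c *: x) = c *: A x by have := lA c x 0; rewrite A0 !addr0.
elim: w phi => [|j w IHw] phi //=; rewrite IHw.
by apply: eq_dsum => a b _; rewrite AD AZ.
Qed.

Lemma dsumZ (M : lmodType K) w c (phi : seq J -> seq J -> M) :
  c *: dsum w phi = dsum w (fun a b => c *: phi a b).
Proof.
by apply: dsum_linear => a x y; rewrite scalerDr !scalerA mulrC.
Qed.

Lemma perm_par u v : perm_eq u v -> par u = par v.
Proof. by move=> uv; congr parz; apply: perm_big. Qed.

Lemma perm_catr a b w : perm_eq (a ++ b) w -> par w = par a (+) par b.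
Proof. by move=> /perm_par <-; rewrite par_cat. Qed.

(** Both sides run over the same splittings, with the two parts exchanged: this
    is graded cocommutativity. *)
Lemma dsum_cocomm (M : lmodType K) w (phi : seq J -> seq J -> M) :
  dsum w phi = dsum w (fun a b => sg (par a && par b) *: phi b a).
Proof.
elim: w phi => [|j w IHw] phi /=; first by rewrite par_nil scale1r.
rewrite IHw; apply: eq_dsum => a b _; rewrite scalerDr addrC !par_cons !scalerA.
rewrite -!signr_addb; congr (_ ^+ nat_of_bool _ *: _ + _ ^+ nat_of_bool _ *: _);
  by case: (par a); case: (par b); case: (dpar j).
Qed.

Lemma dsum_rcons (M : lmodType K) w j (phi : seq J -> seq J -> M) :
  dsum (rcons w j) phi =
  dsum w (fun a b => sg (dpar j && par b) *: phi (rcons a j) b + phi a (rcons b j)).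
Proof.
elim: w phi => [|i w IHw] phi /=; first by rewrite !par_nil !andbF !scale1r.
rewrite IHw; apply: eq_dsum => a b _; rewrite !scalerDr !addrA -!addrA.
congr (_ + _); rewrite addrCA; congr (_ + (_ + _)).
rewrite !scalerA -!signr_addb par_rcons par_cons; congr (_ ^+ nat_of_bool _ *: _).
by case: (par a); case: (par b); case: (dpar j); case: (dpar i).
Qed.

Definition pmul (x : T) (F : T2) : T2 := mul2 (tprod x one + tprod one x) F.

Lemma cont_pmul x : cont (pmul x).
Proof. exact/cont_tmul2r/cont_id. Qed.

Lemma pmul_tprod p q x f g : has_par p x -> has_par q f ->
  pmul x (tprod f g) = tprod (tmul x f) g + sg (p && q) *: tprod f (tmul x g).
Proof.
move=> px qf; rewrite /pmul tmul2Dl (tmul2_tprod _ _ (has_par_tmono _ [::]) qf).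
by rewrite (tmul2_tprod _ _ px qf) par_nil /= scale1r !tmul1l.
Qed.

Definition coprod_word w : T2 :=
  dsum w (fun a b => tprod (mono a) (mono b) : T2).

Lemma coprod_word_cons j w : coprod_word (j :: w) = pmul (tgen K j) (coprod_word w).
Proof.
rewrite [RHS](dsum_linear _ _ (cont_linear (cont_pmul _))) /coprod_word /=.
apply: eq_dsum => a b _; rewrite (pmul_tprod _ (has_par_tgen _ j) (has_par_tmono _ a)).
by rewrite !tmul_tmono.
Qed.

Lemma coprod_coprod_word w :
  foldr (fun j F => mul2 (tprod (tgen K j) one + tprod one (tgen K j)) F)
    (tprod one one) w = coprod_word w.
Proof. by elim: w => [//|j w IHw]; rewrite coprod_word_cons /= IHw. Qed.

Lemma dsum_support (Y : Type) w (phi : seq J -> seq J -> prof K Y) y :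
  dsum w phi y != 0 -> exists a b, perm_eq (a ++ b) w /\ phi a b y != 0.
Proof.
elim: w phi => [|j w IHw] phi /=; first by exists [::], [::].
move=> /IHw [a [b [abw nz]]].
have [z|nz'] := eqVneq (phi (j :: a) b y) 0; last first.
  by exists (j :: a), b; rewrite /= perm_cons.
exists a, (j :: b); split.
  by rewrite -cat_rcons -cats1 -catA perm_catCA /= perm_cons.
by apply: contra_neq nz => z'; rewrite profD profZ z z' mulr0 addr0.
Qed.

Lemma locfin_coprod_word : locfin coprod_word.
Proof.
move=> [u v]; exists (permutations (u ++ v)) => w.
rewrite /coprod_word => nz; have [a [b [abw nz']]] := dsum_support nz.
rewrite mem_permutations perm_sym.
have [[<- <-] //|ne] := eqVneq (a, b) (u, v).
by move: nz'; rewrite -tprod_basis basis_eltN ?eqxx.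
Qed.

Lemma coprodE : @coprod K J deg = cont_ext coprod_word.
Proof.
by apply/funext => f; rewrite /coprod (funext coprod_coprod_word).
Qed.

Lemma cont_coprod (X : choiceType) (A : prof K X -> T) :
  cont A -> cont (fun x => coprod deg (A x) : T2).
Proof.
by move=> cA; rewrite coprodE; apply/(cont_comp cA)/cont_cont_ext/locfin_coprod_word.
Qed.

Lemma coprod_tmono w :
  coprod deg (mono w) = dsum w (fun a b => tprod (mono a) (mono b) : T2).
Proof. by rewrite coprodE cont_ext_basis. Qed.

Lemma coprod_cons j f : coprod deg (tmul (tgen K j) f) = pmul (tgen K j) (coprod deg f).
Proof.
move: f; apply: cont_eqT => [||w].
- exact/cont_coprod/cont_tmulr_id.
- exact: (cont_comp (cont_coprod (@cont_id _ _)) (cont_pmul _)).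
by rewrite tmul_tmono !coprod_tmono; exact: coprod_word_cons.
Qed.

Lemma cont_shuffle (X : choiceType) (A : prof K X -> T) :
  cont A -> cont (fun x => shuffle deg (A x)).
Proof. by move=> cA; apply/cont_tmult/cont_coprod. Qed.

Lemma shuffle_tmono w : shuffle deg (mono w) = dsum w (fun a b => mono (a ++ b)).
Proof.
rewrite /shuffle coprod_tmono.
rewrite (dsum_linear _ _ (cont_linear (cont_tmult (@cont_id K _)))).
by apply: eq_dsum => a b _; rewrite tmult_tprod tmul_tmono.
Qed.

(** * Lie series are primitive *)

(** Primitivity of [x], expressed through left multiplications: in this form it is
    visibly stable under brackets and under limits. *)
Definition primitive (x : T) :=
  forall f, coprod deg (tmul x f) = pmul x (coprod deg f).

Lemma has_par_tcomm p q f g : has_par (parz p) f -> has_par (parz q) g ->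
  has_par (parz p (+) parz q) (tcomm p q f g).
Proof.
move=> pf qg; apply: has_parB; first exact: has_par_tmul.
by apply: has_parZ; rewrite addbC; exact: has_par_tmul.
Qed.

Lemma has_par_lie p (x : T) : lie_monomial deg p x -> has_par (parz p) x.
Proof.
elim=> [j|{}p q {}x y _ px _ qy]; first exact: has_par_tgen.
by rewrite parzD; apply: has_par_tcomm.
Qed.

Lemma pmul_tcomm p q (x y : T) F : has_par (parz p) x -> has_par (parz q) y ->
  pmul (tcomm p q x y) F = pmul x (pmul y F) - ksgn K (p * q) *: pmul y (pmul x F).
Proof.
move=> px qy; move: F; apply: cont_eqT2 => [||u v].
- exact: cont_pmul.
- apply: cont_sub; first exact: (cont_comp (cont_pmul _) (cont_pmul _)).
  exact: (cont_scale _ (cont_comp (cont_pmul _) (cont_pmul _))).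
have pu := has_par_tmono (K := K) deg u.
rewrite (pmul_tprod _ (has_par_tcomm px qy) pu) (pmul_tprod _ px pu).
rewrite (pmul_tprod _ qy pu).
rewrite !(contD (cont_pmul _)) !(contZ (cont_pmul _)).
rewrite (pmul_tprod _ px (has_par_tmul qy pu)) (pmul_tprod _ qy (has_par_tmul px pu)).
rewrite (pmul_tprod _ px pu) (pmul_tprod _ qy pu) /tcomm.
rewrite !tmulBl !tmulZl !tprodBl !tprodBr !tprodZl !tprodZr !tmulA ksgnE parzM.
apply/funext => y'; rewrite !profE.
by case: (parz p); case: (parz q); case: (par u) => /=; ring.
Qed.

Lemma primitive_lie p (x : T) : lie_monomial deg p x -> primitive x.
Proof.
elim=> [j|{}p q {}x y lx px ly py] f; first exact: coprod_cons.
rewrite (pmul_tcomm _ (has_par_lie lx) (has_par_lie ly)) /tcomm tmulBl tmulZl.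
have cc := cont_coprod (@cont_id K _).
by rewrite (contB cc) (contZ cc) -!tmulA !(px, py).
Qed.

Lemma primitive_Lhat (x : T) : Lhat deg x -> primitive x.
Proof.
move=> Lx f; move: x Lx; apply: cont_conv_span => [||x [p lx]].
- exact/cont_coprod/cont_tmull/cont_id.
- apply: cont_tmul2l; apply: cont_add; first exact: cont_tprodl_id.
  exact: cont_tprodr_id.
exact: primitive_lie lx _.
Qed.

End Coproduct.

Arguments eq_dsum {K J deg M w phi psi}.
Arguments dsum_linear {K J deg M M' A} w phi.
Arguments has_par_tcomm {K J deg p q f g}.

(** * Derivations with primitive values commute with the shuffle operator *)

Section Derivation.
Variables (K : comNzRingType) (J : choiceType) (deg : J -> int).
Local Notation T := (tens K J).
Local Notation T2 := (tens2 K J).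
Local Notation mono := (tmono K).
Local Notation one := (tmono K [::]).
Local Notation sg b := ((-1) ^+ nat_of_bool b : K).
Local Notation par := (par deg).
Local Notation dpar := (dpar deg).
Local Notation has_par := (@has_par K J deg).
Implicit Types (u v w : seq J) (f g h : T).

(** The values on the generators have to tend to 0 for the derivation to be
    defined on series, and to have a parity for the signs of the Leibniz rule. *)
Record der_data (p : int) (X : J -> T) : Prop := DerData {
  der_locfin : locfin X;
  der_par : forall j, has_par (parz p (+) dpar j) (X j) }.

Arguments der_locfin {p X}.
Arguments der_par {p X}.

Variables (p : int) (X : J -> T).
Hypothesis dX : der_data p X.
Local Notation D := (@cont_der K J deg p X).

Lemma leibniz_cons j v : leibniz deg p X (j :: v) =
  tmul (X j) (mono v) + sg (parz p && dpar j) *: tmul (tgen K j) (leibniz deg p X v).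
Proof. by rewrite /= ksgnE parzM. Qed.

Lemma tmul_neq0 f v y : tmul f (mono v) y != 0 ->
  exists2 u, f u != 0 & y = u ++ v.
Proof.
move=> /sum_neq0 [k nz]; exists (take k y).
  by apply: contra_neq nz => ->; rewrite mul0r.
rewrite -{1}(cat_take_drop k y); congr (_ ++ _); apply/eqP.
by apply: contra_neqT nz => ne; rewrite [X in _ * X]tmonoN ?mulr0 // eq_sym.
Qed.

Lemma tmul_tgen_nil j f : tmul (tgen K j) f [::] = 0.
Proof. by rewrite /tmul big_ord1 /= /tgen tmonoN ?mul0r. Qed.

Lemma tmul_tgen_cons j f i v : tmul (tgen K j) f (i :: v) = (j == i)%:R * f v.
Proof.
rewrite /tmul big_ord_recl /= /tgen tmonoN // mul0r add0r big_ord_recl /=.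
rewrite take0 drop0 big1 ?addr0 => [|k _].
  by rewrite /tmono /basis_elt eqseq_cons eqxx andbT eq_sym.
case: v k => [[]//|i' v k].
by rewrite tmonoN ?mul0r //= eqseq_cons andbF.
Qed.

Lemma locfin_leibniz : locfin (leibniz deg p X).
Proof.
elim=> [|i y [s sP]].
  have [s sP] := der_locfin dX [::]; exists [seq [:: j] | j <- s].
  move=> [|j v]; first by rewrite eqxx.
  rewrite leibniz_cons profD profZ tmul_tgen_nil mulr0 addr0 => /tmul_neq0 [u nz].
  by case: u nz => // nz; case: v => // _; apply/map_f/sP.
have /choice [r rP] := der_locfin dX.
exists ([seq i :: v | v <- s] ++
  [seq j :: drop k (i :: y) | k <- iota 0 (size y).+2, j <- r (take k (i :: y))]).
move=> [|j v]; first by rewrite eqxx.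
rewrite leibniz_cons profD profZ tmul_tgen_cons mem_cat.
have [ji|] := eqVneq j i; last first.
  move=> _; rewrite mul0r mulr0 addr0 => /tmul_neq0 [u nz yE].
  apply/orP; right; apply/allpairsPdep; exists (size u), j.
  rewrite yE take_size_cat // drop_size_cat // rP //; split=> //.
  by rewrite mem_iota add0n ltnS -[(size y).+1]/(size (i :: y)) yE size_cat leq_addr.
have [->|nz _] := eqVneq (leibniz deg p X v y) 0; last first.
  by rewrite ji map_f ?sP.
rewrite !mulr0 addr0 => /tmul_neq0 [u nz yE].
apply/orP; right; apply/allpairsPdep; exists (size u), j.
rewrite yE take_size_cat // drop_size_cat // rP //; split=> //.
by rewrite mem_iota add0n ltnS -[(size y).+1]/(size (i :: y)) yE size_cat leq_addr.
Qed.

Lemma cont_der_id : cont D.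
Proof. exact/cont_cont_ext/locfin_leibniz. Qed.
Lemma cont_cont_der (Y : choiceType) (A : prof K Y -> T) :
  cont A -> cont (fun x => D (A x)).
Proof. by move=> cA; apply: (cont_comp cA cont_der_id). Qed.

Lemma der_tmono w : D (mono w) = leibniz deg p X w.
Proof. exact: cont_ext_basis. Qed.

Lemma has_par_der w : has_par (parz p (+) par w) (D (mono w)).
Proof.
rewrite der_tmono; elim: w => [|j v IHv]; first exact: has_par0.
rewrite leibniz_cons par_cons; apply: has_parD.
  by rewrite addbA; exact: (has_par_tmul (der_par dX j) (has_par_tmono _ v)).
by apply: has_parZ; rewrite addbCA; exact: (has_par_tmul (has_par_tgen _ j) IHv).
Qed.

Lemma der_tgenM j f : D (tmul (tgen K j) f) =
  tmul (X j) f + sg (parz p && dpar j) *: tmul (tgen K j) (D f).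
Proof.
move: f; apply: cont_eqT => [||v].
- exact/cont_cont_der/cont_tmulr_id.
- apply: cont_add; first exact: cont_tmulr_id.
  exact/cont_scale/cont_tmulr/cont_der_id.
by rewrite tmul_tmono !der_tmono leibniz_cons.
Qed.

Lemma der_tgen j : D (tgen K j) = X j.
Proof.
by rewrite -[tgen K j]tmul1r der_tgenM tmul1r der_tmono tmul0r scaler0 addr0.
Qed.

Lemma der_tmonoM u f : D (tmul (mono u) f) =
  tmul (D (mono u)) f + sg (parz p && par u) *: tmul (mono u) (D f).
Proof.
elim: u => [|j u IHu].
  by rewrite der_tmono tmul0l add0r !tmul1l par_nil andbF scale1r.
rewrite -[j :: u]/([:: j] ++ u) -tmul_tmono -tmulA -/(tgen K j) der_tgenM IHu.
rewrite der_tgenM tmulDr tmulDl !tmulZr tmulZl scalerDr scalerA !tmulA addrA.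
congr (_ + _ *: _); rewrite -signr_addb par_cons; congr (_ ^+ nat_of_bool _).
by case: (parz p).
Qed.

(** The operator [D (x) 1 + 1 (x) D] on the tensor square. *)
Definition der2 (F : T2) : T2 := fun uv =>
  D (fun u => F (u, uv.2)) uv.1 +
  sg (parz p && par uv.1) * D (fun v => F (uv.1, v)) uv.2.

Lemma cont_der2 : cont der2.
Proof.
split=> [a F G|[u v]].
  apply/funext => -[u v]; rewrite profD profZ /der2 /=.
  rewrite -[D (fun x => (a *: F + G) (x, v))]/(D (a *: ((fun x => F (x, v)) : T) + ((fun x => G (x, v)) : T))).
  rewrite -[D (fun x => (a *: F + G) (u, x))]/(D (a *: ((fun x => F (u, x)) : T) + ((fun x => G (u, x)) : T))).
  by rewrite !(cont_linear cont_der_id) !profE; ring.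
have [[s sP] [r rP]] := (cont_coord cont_der_id u, cont_coord cont_der_id v).
exists ([seq (x, v) | x <- s] ++ [seq (u, y) | y <- r]) => F F0.
rewrite /der2 /= sP => [|x xs]; last by apply: F0; rewrite mem_cat map_f.
by rewrite rP ?mulr0 ?addr0 // => y yr; apply: F0; rewrite mem_cat map_f ?orbT.
Qed.

Lemma der2_tprod q f g : has_par q f ->
  der2 (tprod f g) = tprod (D f) g + sg (parz p && q) *: tprod f (D g).
Proof.
move=> qf; apply/funext => -[u v]; rewrite !profE /der2 /tprod /=.
rewrite -[D (fun v0 => f u * g v0)]/(D (f u *: g)) (contZ cont_der_id) profZ.
have -> : (fun u0 => f u0 * g v) = g v *: f by apply/funext => x; rewrite mulrC.
rewrite (contZ cont_der_id) profZ mulrC; congr (_ + _).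
by have [->|/qf ->//] := eqVneq (f u) 0; rewrite !mul0r !mulr0.
Qed.

Lemma tmult_der2 F : tmult (der2 F) = D (tmult F).
Proof.
move: F; apply: cont_eqT2 => [||u v].
- exact/cont_tmult/cont_der2.
- exact/cont_cont_der/cont_tmult_id.
rewrite (der2_tprod _ (has_par_tmono _ u)) (contD (@cont_tmult_id K J)).
by rewrite (contZ (@cont_tmult_id K J)) !tmult_tprod der_tmonoM.
Qed.

Lemma der2_pmul j F : der2 (pmul deg (tgen K j) F) =
  pmul deg (X j) F + sg (parz p && dpar j) *: pmul deg (tgen K j) (der2 F).
Proof.
have cp (x : T) := cont_pmul deg x.
move: F; apply: cont_eqT2 => [||u v].
- exact: (cont_comp (cp _) cont_der2).
- by apply: cont_add => //; exact: (cont_scale _ (cont_comp cont_der2 (cp _))).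
have [pu pj] := (has_par_tmono deg u : has_par _ _, has_par_tgen deg j : has_par _ _).
rewrite (pmul_tprod _ pj pu) (pmul_tprod _ (der_par dX j) pu).
rewrite (contD cont_der2) (contZ cont_der2) (der2_tprod _ (has_par_tmul pj pu)).
rewrite !(der2_tprod _ pu) (contD (cp _)) (contZ (cp _)) (pmul_tprod _ pj pu).
rewrite (pmul_tprod _ pj (@has_par_der u)) !der_tgenM.
rewrite !tprodDl !tprodDr !tprodZl !tprodZr.
apply/funext => y'; rewrite !profE.
by case: (parz p); case: (dpar j); case: (par u) => /=; ring.
Qed.

Section Primitive.
Hypothesis primX : forall j, primitive deg (X j).

Lemma coprod_der f : coprod deg (D f) = der2 (coprod deg f).
Proof.
have cc := cont_coprod deg (@cont_id K _).
move: f; apply: cont_eqT => [||w].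
- exact/cont_coprod/cont_der_id.
- exact: (cont_comp cc cont_der2).
elim: w => [|j w IHw].
  rewrite der_tmono (cont0 cc) coprod_tmono /= (der2_tprod _ (has_par_tmono _ _)).
  rewrite der_tmono (cont0 (cont_tprodl_id _)) (cont0 (cont_tprodr_id _)).
  by rewrite scaler0 addr0.
rewrite -[j :: w]/([:: j] ++ w) -tmul_tmono -/(tgen K j) der_tgenM.
by rewrite (contD cc) (contZ cc) primX !coprod_cons IHw der2_pmul.
Qed.

(** [D] is a derivation and, as its values are primitive, a coderivation; so it
    commutes with both factors of [mu Delta]. *)
Lemma shuffle_der f : shuffle deg (D f) = D (shuffle deg f).
Proof. by rewrite /shuffle coprod_der tmult_der2. Qed.

End Primitive.

End Derivation.

Arguments der_locfin {K J deg p X}.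
Arguments der_par {K J deg p X}.

(** * Eigenvectors of the shuffle operator *)

Section LinearSpan.
Variables (K : comNzRingType) (M : lmodType K).

Inductive lin_span (A : set M) : M -> Prop :=
| lin_span0 : lin_span A 0
| lin_span_cons a x y : A x -> lin_span A y -> lin_span A (a *: x + y).

Lemma lin_span_sub (A : set M) x : A x -> lin_span A x.
Proof.
by move=> Ax; rewrite -[x]addr0 -[x]scale1r; apply: lin_span_cons => //; left.
Qed.

Lemma lin_spanP (A : set M) a x y :
  lin_span A x -> lin_span A y -> lin_span A (a *: x + y).
Proof.
elim=> [|b {}x z Ax _ IHz] Ay; first by rewrite scaler0 add0r.
by rewrite scalerDr scalerA -addrA; apply: lin_span_cons => //; apply: IHz.
Qed.

Lemma lin_spanD (A : set M) x y : lin_span A x -> lin_span A y -> lin_span A (x + y).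
Proof. by move=> Ax; rewrite -[x]scale1r; apply: lin_spanP. Qed.
Lemma lin_spanZ (A : set M) c x : lin_span A x -> lin_span A (c *: x).
Proof. by move=> Ax; rewrite -[_ *: x]addr0; apply: lin_spanP => //; left. Qed.

End LinearSpan.

Lemma lin_span_map (K : comNzRingType) (M M' : lmodType K) (A : set M) (B : set M')
  (phi : M -> M') : linear phi -> (forall x, A x -> lin_span B (phi x)) ->
  forall x, lin_span A x -> lin_span B (phi x).
Proof.
move=> lphi AB x; elim=> [|a {}x y Ax _ By]; last first.
  by rewrite lphi; apply: lin_spanP => //; apply: AB.
have -> : phi 0 = 0; last by left.
by have := lphi (-1) 0 0; rewrite scaler0 addr0 scaleN1r addNr.
Qed.

Section Filtration.
Variables (K : comNzRingType) (J : choiceType) (deg : J -> int).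
Local Notation T := (tens K J).
Local Notation T2 := (tens2 K J).
Local Notation mono := (tmono K).
Local Notation one := (tmono K [::]).
Local Notation sg b := ((-1) ^+ nat_of_bool b : K).
Local Notation par := (par deg).
Local Notation dpar := (dpar deg).
Local Notation has_par := (@has_par K J deg).
Local Notation s := (@shuffle K J deg).
Implicit Types (u v w : seq J) (f g h : T).

Inductive lie_product : nat -> bool -> T -> Prop :=
| lie_product_nil : lie_product 0 false one
| lie_product_cons r b p x f : lie_monomial deg p x -> lie_product r b f ->
    lie_product r.+1 (parz p (+) b) (tmul x f).

Lemma has_par_product r b f : lie_product r b f -> has_par b f.
Proof.
elim=> [|{}r {}b p x {}f lx _ bf].
  by have := has_par_tmono (K := K) deg [::]; rewrite par_nil.
exact: (has_par_tmul (has_par_lie lx) bf).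
Qed.

Lemma lie_productM r b f q c g : lie_product r b f -> lie_product q c g ->
  lie_product (r + q) (b (+) c) (tmul f g).
Proof.
move=> rf qg; elim: rf => [|{}r {}b p x {}f lx _ IH]; first by rewrite tmul1l.
by rewrite -tmulA -addbA; apply: lie_product_cons.
Qed.

Lemma lie_product_word w : lie_product (size w) (par w) (mono w).
Proof.
elim: w => [|j w IHw]; first by rewrite par_nil; left.
rewrite par_cons -[j :: w]/([:: j] ++ w) -tmul_tmono.
by apply: lie_product_cons IHw; left.
Qed.

Definition products r : set T := [set f | exists b, lie_product r b f].
Definition products_le r : set T := [set f | exists2 q, (q <= r)%N & products q f].
Definition products2 r : set T2 := [set F | exists q q' b b' f g,
  [/\ lie_product q b f, lie_product q' b' g, (q + q')%N = r & F = tprod f g]].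

Lemma lie_tmul_products p x r f : lie_monomial deg p x ->
  lin_span (products r) f -> lin_span (products r.+1) (tmul x f).
Proof.
move=> lx Pf; apply: (lin_span_map (cont_linear (cont_tmulr_id x)) _ Pf).
move=> {Pf}f [b rf].
by apply: lin_span_sub; exists (parz p (+) b); exact: lie_product_cons lx rf.
Qed.

Lemma coprod_product r b f :
  lie_product r b f -> lin_span (products2 r) (coprod deg f).
Proof.
elim=> [|{}r {}b p x {}f lx _ IH].
  apply: lin_span_sub; exists 0%N, 0%N, false, false, one, one.
  by split=> //; [left | left | rewrite coprod_tmono].
rewrite (primitive_lie lx).
apply: (lin_span_map (cont_linear (cont_pmul deg x)) _ IH).
move=> _ [q [q' [c [c' [g [h [qg qh <- ->]]]]]]].
rewrite (pmul_tprod _ (has_par_lie lx) (has_par_product qg)).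
apply: lin_spanD; [|apply: lin_spanZ]; apply: lin_span_sub.
  exists q.+1, q', (parz p (+) c), c', (tmul x g), h.
  by split=> //; apply: lie_product_cons.
exists q, q'.+1, c, (parz p (+) c'), g, (tmul x h).
by split; [| apply: lie_product_cons | rewrite addnS |].
Qed.

(** Moving a Lie element across a product of [r] Lie elements costs brackets,
    each of which merges two factors. *)
Lemma lie_product_comm p x r b f : lie_monomial deg p x -> lie_product r b f ->
  lin_span (products r) (tmul x f - sg (parz p && b) *: tmul f x).
Proof.
move=> lx; elim=> [|{}r {}b q y {}f ly rf IH].
  by rewrite andbF scale1r tmul1l tmul1r subrr; left.
have -> : tmul x (tmul y f) - sg (parz p && (parz q (+) b)) *: tmul (tmul y f) x =
    tmul (tcomm p q x y) f +
    sg (parz p && parz q) *: tmul y (tmul x f - sg (parz p && b) *: tmul f x).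
  rewrite /tcomm ksgnE parzM tmulBl tmulBr tmulZl tmulZr !tmulA.
  apply/funext => w; rewrite !profE {rf IH}.
  by case: (parz p); case: (parz q); case: b => /=; ring.
apply: lin_spanD; last exact: (lin_spanZ _ (lie_tmul_products ly IH)).
apply: lin_span_sub; exists (parz (p + q) (+) b); apply: lie_product_cons => //.
exact: lie_bracket.
Qed.

(** In the left part of the coproduct [x] stands in front; in the right part it
    has to be moved back to the front, across the left part. *)
Lemma tmult_pmul p x r F : lie_monomial deg p x -> lin_span (products2 r) F ->
  lin_span (products r) (tmult (pmul deg x F) - 2 *: tmul x (tmult F)).
Proof.
move=> lx PF.
have cA : cont (fun F : T2 => tmult (pmul deg x F) - 2 *: tmul x (tmult F)).
  apply: cont_sub; first exact/cont_tmult/cont_pmul.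
  exact/cont_scale/cont_tmulr/cont_tmult_id.
apply: (lin_span_map (cont_linear cA) _ PF) => {PF F}.
move=> _ [q [q' [b [b' [f [g [qf qg <- ->]]]]]]].
rewrite (pmul_tprod _ (has_par_lie lx) (has_par_product qf)).
rewrite (contD (@cont_tmult_id K J)) (contZ (@cont_tmult_id K J)) !tmult_tprod.
have -> : tmul (tmul x f) g + sg (parz p && b) *: tmul f (tmul x g) -
    2 *: tmul x (tmul f g) =
    (-1) *: tmul (tmul x f - sg (parz p && b) *: tmul f x) g.
  rewrite tmulBl tmulZl !tmulA; apply/funext => w; rewrite !profE.
  by case: (parz p && b) => /=; ring.
apply: lin_spanZ.
apply: (lin_span_map (cont_linear (cont_tmull_id g)) _ (lie_product_comm lx qf)).
move=> h [c qh].
by apply: lin_span_sub; exists (c (+) b'); apply: lie_productM.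
Qed.

(** The Poincare-Birkhoff-Witt filtration: modulo shorter products of Lie
    elements, a product of [r] Lie elements has eigenvalue [2 ^ r], each
    factor going to the left or to the right part of the coproduct. *)
Lemma shuffle_product r b f : lie_product r b f ->
  if r is q.+1 then lin_span (products_le q) (s f - 2 ^+ r *: f) else s f = f.
Proof.
elim=> [|{}r {}b p x {}f lx rf IH]; first by rewrite shuffle_tmono.
have -> : s (tmul x f) - 2 ^+ r.+1 *: tmul x f =
    (tmult (pmul deg x (coprod deg f)) - 2 *: tmul x (s f)) +
    2 *: tmul x (s f - 2 ^+ r *: f).
  rewrite {1}/shuffle (primitive_lie lx) tmulBr tmulZr scalerBr scalerA -exprS.
  by rewrite addrA subrK.
apply: lin_spanD.
  have Pf := tmult_pmul lx (coprod_product rf).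
  apply: (lin_span_map (cont_linear (@cont_id K _)) _ Pf) => g rg.
  by apply: lin_span_sub; exists r.
apply: lin_spanZ; case: r rf IH => [|r] rf IH.
  by rewrite IH scale1r subrr tmul0r; left.
apply: (lin_span_map (cont_linear (cont_tmulr_id x)) _ IH) => g [q qr [c qg]].
apply: lin_span_sub; exists q.+1 => //; exists (parz p (+) c).
exact: lie_product_cons.
Qed.

(** The eigenvalue [2 ^ 0] is reserved to the constants: this will make [e(0)]
    vanish on words of positive length. *)
Definition eigen_sum n f := exists c : nat -> T,
  [/\ forall i, s (c i) = 2 ^+ i *: c i, f = \sum_(i < n.+1) c i &
      exists a, c 0%N = a *: one].

Hypothesis pow2_inv : forall i j, i != j ->
  exists a : K, a * (2 ^+ i - 2 ^+ j) = 1.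

Let cs : cont s. Proof. exact/cont_shuffle/cont_id. Qed.

Lemma eigen_sum0 n : eigen_sum n 0.
Proof.
exists (fun=> 0); split=> [i||]; first by rewrite (cont0 cs) scaler0.
  by rewrite big1.
by exists 0; rewrite scale0r.
Qed.

Lemma eigen_sumP n a f g : eigen_sum n f -> eigen_sum n g -> eigen_sum n (a *: f + g).
Proof.
move=> [c [sc -> [b c0]]] [d [sd -> [b' d0]]].
exists (fun i => a *: c i + d i); split=> [i||].
- by rewrite (cont_linear cs) sc sd scalerDr !scalerA mulrC.
- by rewrite scaler_sumr -big_split.
- by exists (a * b + b'); rewrite c0 d0 scalerA scalerDl.
Qed.

Lemma eigen_sumS n f : eigen_sum n f -> eigen_sum n.+1 f.
Proof.
move=> [c [sc -> [a c0]]]; exists (fun i => if (i <= n)%N then c i else 0).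
split=> [i||]; last by exists a.
  by case: ifP => // _; rewrite (cont0 cs) scaler0.
rewrite [RHS]big_ord_recr /= ltnn addr0.
by apply: eq_bigr => i _; rewrite -ltnS ltn_ord.
Qed.

Lemma eigen_sum_span n (A : set T) f :
  (forall g, A g -> eigen_sum n g) -> lin_span A f -> eigen_sum n f.
Proof.
move=> An; elim=> [|a x y Ax _ IH]; first exact: eigen_sum0.
by apply: eigen_sumP => //; apply: An.
Qed.

Lemma eigen_sum_products r f : lin_span (products_le r) f -> eigen_sum r f.
Proof.
elim: r f => [|r IHr] f.
  apply: eigen_sum_span => g [q]; rewrite leqn0 => /eqP -> [b qg].
  inversion_clear qg.
  exists (fun i => (i == 0%N)%:R *: one); split=> [i||].
  - rewrite (contZ cs) shuffle_tmono /=.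
    by case: eqP => [->|_]; rewrite ?scale0r ?scaler0 // expr0 scale1r.
  - by rewrite big_ord1 scale1r.
  - by exists 1.
apply: eigen_sum_span => g [q]; rewrite leq_eqVlt => /orP[/eqP -> [b rg]|qr qg].
  have [c [sc gE [a c0]]] := IHr _ (shuffle_product rg).
  have /choice [mu muE] : forall i, exists m : K,
      (i != r.+1) -> m * (2 ^+ i - 2 ^+ r.+1) = 1.
    move=> i; have [->|/pow2_inv [m mE]] := eqVneq i r.+1; first by exists 0.
    by exists m.
  (* The factor 1 / (2^i - 2^(r+1)) is what makes the rest an eigenvector. *)
  pose h := \sum_(i < r.+1) mu i *: c i.
  exists (fun i => if (i <= r)%N then mu i *: c i else
                   if i == r.+1 then g - h else 0); split=> [i||].
  - case: ifP => _; first by rewrite (contZ cs) sc !scalerA mulrC.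
    case: eqP => [->|_]; last by rewrite (cont0 cs) scaler0.
    rewrite (contB cs) -[s g](subrK (2 ^+ r.+1 *: g)) gE.
    rewrite (cont_sum cs) scalerBr addrAC -sumrB addrC; congr (_ + _).
    rewrite scaler_sumr -sumrN; apply: eq_bigr => i0 _.
    rewrite (contZ cs) sc !scalerA -[X in X - _]scale1r -scalerBl.
    have E : 1 = mu i0 * 2 ^+ i0 - mu i0 * 2 ^+ r.+1.
      by rewrite -mulrBr muE // neq_ltn ltn_ord.
    by rewrite -scaleNr {1}E; congr (_ *: _); ring.
  - rewrite big_ord_recr /= ltnn eqxx [X in X + _](_ : _ = h) ?subrKC //.
    by apply: eq_bigr => i _; rewrite -ltnS ltn_ord.
  - by exists (mu 0%N * a); rewrite c0 scalerA.
by apply/eigen_sumS/IHr/lin_span_sub; exists q.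
Qed.

Lemma eigen_sum_word w : eigen_sum (size w) (mono w).
Proof.
apply/eigen_sum_products/lin_span_sub; exists (size w) => //.
by exists (par w); apply: lie_product_word.
Qed.

End Filtration.

(** * The Eulerian projections *)

Section Truncation.
Variables (K : comNzRingType) (J : choiceType) (deg : J -> int).
Local Notation T := (tens K J).
Local Notation mono := (tmono K).
Implicit Types (u v w : seq J) (f g h : T).

Lemma cont_trunc n : cont (@trunc K J n).
Proof.
split=> [a f g|w].
  apply/funext => w; rewrite !profE /trunc.
  by case: ifP; rewrite ?profE // mulr0 addr0.
by exists [:: w] => f f0; rewrite /trunc f0 ?mem_head // if_same.
Qed.

Lemma trunc_tmono n w : trunc n (mono w) = if size w == n then mono w else 0.
Proof.
apply/funext => u; rewrite /trunc; case: ifP => un; case: ifP => wn //.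
  by apply: tmonoN; apply: contraFneq wn => ->.
by rewrite tmonoN //; apply: contraFneq un => <-.
Qed.

Lemma trunc_comp l n f : trunc l (trunc n f) = if l == n then trunc n f else 0.
Proof.
apply/funext => w; rewrite /trunc.
by case: (eqVneq l n) => [->|ln]; case: eqP => //= ->; rewrite (negPf ln).
Qed.

Lemma eq_trunc f g : (forall l, trunc l f = trunc l g) -> f = g.
Proof.
move=> fg; apply/funext => w; move/(congr1 (fun h : T => h w)): (fg (size w)).
by rewrite /trunc eqxx.
Qed.

Definition preserves_length (A : T -> T) := forall n f, trunc n (A f) = A (trunc n f).

Lemma preserves_lengthP (A : T -> T) : cont A ->
  (forall w u, A (mono w) u != 0 -> size w = size u) -> preserves_length A.
Proof.
move=> cA Aw n f; move: f; apply: cont_eqT => [||w].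
- exact: (cont_comp cA (cont_trunc n)).
- exact: (cont_comp (cont_trunc n) cA).
rewrite trunc_tmono; apply/funext => u; rewrite /trunc.
case: ifP => un; case: ifP => wn //; rewrite ?(cont0 cA) ?prof0 //.
  by apply/eqP; apply: contraFT wn => /Aw ->.
by apply/esym/eqP; apply: contraFT un => /Aw <-.
Qed.

Lemma preserves_length_shuffle : preserves_length (@shuffle K J deg).
Proof.
apply: preserves_lengthP; first exact/cont_shuffle/cont_id.
move=> w u; rewrite shuffle_tmono => wu.
have [a [b [/perm_size <- nz]]] := dsum_support wu.
by congr size; apply/eqP; apply: contraNT nz => ne; rewrite tmonoN.
Qed.

End Truncation.

Section Lift.
Variables (K : comNzRingType) (J : choiceType).
Local Notation T := (tens K J).
Local Notation mono := (tmono K).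
Implicit Types (u v w : seq J) (f g h : T) (A : T -> T).

(** The operator [1 (x) A] on the series without constant term. *)
Definition lift A f : T :=
  fun w => if w is i :: v then A (fun u => f (i :: u)) v else 0.

Lemma cont_lift A : cont A -> cont (lift A).
Proof.
move=> cA; split=> [a f g|[|i v]]; last 2 first.
- by exists [::].
- have [s sP] := cont_coord cA v; exists [seq i :: u | u <- s] => f f0.
  by apply: sP => u us; apply/f0/map_f.
apply/funext => -[|i v]; first by rewrite !profE mulr0 addr0.
rewrite profD profZ /=.
rewrite -[A _ v]/(A (a *: ((fun u => f (i :: u)) : T) + ((fun u => g (i :: u)) : T)) v).
by rewrite (cont_linear cA).
Qed.

Lemma tgenM_slice j f i : (fun v => tmul (tgen K j) f (i :: v)) = (j == i)%:R *: f.
Proof. by apply/funext => v; rewrite tmul_tgen_cons. Qed.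

Lemma lift_tgenM A j f : cont A -> lift A (tmul (tgen K j) f) = tmul (tgen K j) (A f).
Proof.
move=> cA; apply/funext => -[|i v]; first by rewrite tmul_tgen_nil.
by rewrite tmul_tgen_cons /= tgenM_slice (contZ cA).
Qed.

Lemma lift_one A : cont A -> lift A (mono [::]) = 0.
Proof.
move=> cA; apply/funext => -[|i v] //=.
have -> : (fun u => mono [::] (i :: u)) = 0 by apply/funext => u; rewrite tmonoN.
by rewrite (cont0 cA).
Qed.

Lemma lift_cons A i v : cont A -> lift A (mono (i :: v)) = tmul (tgen K i) (A (mono v)).
Proof. by move=> cA; rewrite -(tmul_tmono _ [:: i]) lift_tgenM. Qed.

Lemma cont_eq_tgenM (Y : choiceType) (A B : T -> prof K Y) : cont A -> cont B ->
  A (mono [::]) = B (mono [::]) ->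
  (forall i v, A (tmul (tgen K i) (mono v)) = B (tmul (tgen K i) (mono v))) ->
  A =1 B.
Proof.
move=> cA cB AB0 AB; apply: cont_eqT => // -[|i v] //.
by rewrite -(tmul_tmono _ [:: i]) AB.
Qed.

End Lift.

Section Eulerian.
Variables (k : fieldType) (K : comNzRingType) (iota : {rmorphism k -> K}).
Variables (J : choiceType) (deg : J -> int).
Hypothesis char0 : [pchar k] =i pred0.
Local Notation T := (tens K J).
Local Notation mono := (tmono K).
Local Notation one := (tmono K [::]).
Local Notation s := (@shuffle K J deg).
Local Notation e := (eulerian iota deg).
Local Notation e' := (eulerian' iota deg).
Implicit Types (u v w : seq J) (f g h : T).

Lemma natr_neq0 n : n.+1%:R != 0 :> k.
Proof. by rewrite (pcharf0P k).1. Qed.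

Lemma iota_unit (x : k) : x != 0 -> exists a, a * iota x = 1.
Proof. by move=> x0; exists (iota x^-1); rewrite -rmorphM mulVf // rmorph1. Qed.

Lemma pow2_neq i j : i != j -> 2 ^+ i - 2 ^+ j != 0 :> k.
Proof.
wlog ij : i j / (i < j)%N => [IH|_].
  rewrite neq_ltn => /orP[] ij; first by rewrite IH // neq_ltn ij.
  by rewrite -oppr_eq0 opprB IH // neq_ltn ij.
rewrite -oppr_eq0 opprB -!natrX -natrB ?leq_exp2l ?(ltnW ij) //.
have: (0 < 2 ^ j - 2 ^ i)%N by rewrite subn_gt0 ltn_exp2l.
by case: (_ - _)%N => // n _; apply: natr_neq0.
Qed.

Lemma iota_pow2 i : iota (2 ^+ i) = 2 ^+ i.
Proof. by rewrite rmorphXn rmorph_nat. Qed.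

Lemma pow2_inv i j : i != j -> exists a : K, a * (2 ^+ i - 2 ^+ j) = 1.
Proof.
by move=> /pow2_neq /iota_unit [a]; rewrite rmorphB !iota_pow2; exists a.
Qed.

Let cs : cont s. Proof. exact/cont_shuffle/cont_id. Qed.

Lemma cont_big_comp (I : Type) (r : seq I) (P : pred I) (A : I -> T -> T) :
  (forall i, cont (A i)) -> cont (\big[@comp _ _ _/id]_(i <- r | P i) A i).
Proof.
move=> cA; elim: r => [|i r IHr]; first by rewrite big_nil; exact: cont_id.
by rewrite big_cons; case: (P i) => //; apply: cont_comp IHr (cA i).
Qed.

Lemma cont_eulerian_n n j : cont (eulerian_n iota deg n j).
Proof.
apply/cont_scale/cont_big_comp => r; apply: cont_sub => //.
exact/cont_scale/cont_id.
Qed.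

Lemma cont_eulerian j : cont (e j).
Proof.
split=> [a f g|w].
  apply/funext => w; rewrite profD profZ /eulerian; case: ifP => _.
    by rewrite (cont_linear (cont_eulerian_n _ _)).
  by rewrite mulr0 addr0.
have [F FA] := cont_coord (cont_eulerian_n (size w) j) w; exists F => f f0.
by rewrite /eulerian FA // if_same.
Qed.

Lemma cont_eulerian' j : cont (e' j).
Proof. exact: (cont_lift (cont_eulerian j)). Qed.

Lemma preserves_length_eulerian_n n j : preserves_length (eulerian_n iota deg n j).
Proof.
move=> l f; rewrite /eulerian_n (contZ (@cont_trunc K J l)); congr (_ *: _).
elim: (index_iota 0 n.+1) f => [|r rs IHr] f; first by rewrite !big_nil.
rewrite !big_cons; case: (r != j) => //=.
by rewrite (contB (@cont_trunc K J l)) (contZ (@cont_trunc K J l))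
  preserves_length_shuffle IHr.
Qed.

Lemma preserves_length_eulerian j : preserves_length (e j).
Proof.
move=> l f; apply/funext => w; rewrite /trunc /eulerian.
have := congr1 (fun h : T => h w) (preserves_length_eulerian_n (size w) j l f).
rewrite {1}/trunc /= => wE; rewrite -wE.
by case: (size w == l); case: (j <= size w)%N.
Qed.

Lemma eulerian_n_eigen n j i f : (i <= n)%N -> (j <= n)%N -> s f = 2 ^+ i *: f ->
  eulerian_n iota deg n j f = (i == j)%:R *: f.
Proof.
move=> ijn jn sf; rewrite /eulerian_n.
have -> (rs : seq nat) : (\big[@comp _ _ _/id]_(r <- rs | r != j)
    (fun g : T => s g - iota (2%:R ^+ r) *: g)) f =
    iota (\prod_(r <- rs | r != j) (2 ^+ i - 2 ^+ r)) *: f.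
  elim: rs => [|r rs IHr]; first by rewrite !big_nil rmorph1 scale1r.
  rewrite !big_cons; case: (r != j) => //=; rewrite IHr (contZ cs) sf.
  by rewrite !scalerA -scalerBl rmorphM rmorphB !iota_pow2; congr (_ *: _); ring.
rewrite scalerA -rmorphM; case: eqP => [->|/eqP ij].
  rewrite mulVf ?rmorph1 // prodf_seq_neq0; apply/allP => r _.
  by apply/implyP => rj; rewrite pow2_neq // eq_sym.
rewrite [X in _^-1 * X](_ : _ = 0) ?mulr0 ?rmorph0 //; apply/eqP.
rewrite prodf_seq_eq0; apply/hasP; exists i; first by rewrite mem_index_iota.
by rewrite ij subrr eqxx.
Qed.

Lemma eulerian_eigen_length n j i f : (i <= n)%N -> trunc n f = f ->
  s f = 2 ^+ i *: f -> e j f = (i == j)%:R *: f.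
Proof.
move=> ijn fn sf; apply/funext => w.
have [wn|wn] := eqVneq (size w) n; last first.
  rewrite -fn -preserves_length_eulerian profZ /trunc (negPf wn).
  by rewrite mulr0.
rewrite /eulerian wn; case: leqP => jn; first by rewrite (eulerian_n_eigen ijn jn).
by rewrite (ltn_eqF (leq_ltn_trans ijn jn)) scale0r.
Qed.

(** The components of a word are eigenvectors, on which the products defining
    the projections are computed by evaluating scalars. *)
Lemma word_eigen w : [/\ forall j, s (e j (mono w)) = 2 ^+ j *: e j (mono w),
  forall j, e j (s (mono w)) = 2 ^+ j *: e j (mono w),
  mono w = \sum_(j < (size w).+1) e j (mono w) &
  w != [::] -> e 0%N (mono w) = 0].
Proof.
have [c' [sc' wE' [a c0']]] := eigen_sum_word deg pow2_inv w.
set n := size w in wE' *.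
pose c i := trunc n (c' i); pose ct := @cont_trunc K J n.
have sc i : s (c i) = 2 ^+ i *: c i.
  by rewrite /c -preserves_length_shuffle sc' (contZ ct).
have tc i : trunc n (c i) = c i by rewrite trunc_comp eqxx.
have wE : mono w = \sum_(i < n.+1) c i.
  by rewrite -(cont_sum ct) -wE' trunc_tmono eqxx.
have ec j (i : 'I_n.+1) : e j (c i) = (i == j :> nat)%:R *: c i.
  by apply: (eulerian_eigen_length (n := n)) => //; rewrite -ltnS.
have ew j : e j (mono w) = if (j <= n)%N then c j else 0.
  rewrite wE (cont_sum (cont_eulerian j)) (eq_bigr _ (fun i _ => ec j i)).
  case: leqP => jn; last first.
    by rewrite big1 // => i _; rewrite ltn_eqF ?scale0r // (leq_trans (ltn_ord i)).
  rewrite (bigD1 (Ordinal (jn : j < n.+1)%N)) //= eqxx scale1r big1 ?addr0 // => i.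
  by rewrite -val_eqE /= => /negPf ->; rewrite scale0r.
split.
- by move=> j; rewrite ew; case: ifP; rewrite ?(cont0 cs) ?scaler0.
- move=> j; rewrite wE (cont_sum cs) !(cont_sum (cont_eulerian j)) scaler_sumr.
  apply: eq_bigr => i _; rewrite sc (contZ (cont_eulerian j)) ec.
  by case: eqP => [->|_]; rewrite ?scale0r ?scaler0.
- by rewrite {1}wE; apply: eq_bigr => i _; rewrite ew -ltnS ltn_ord.
move=> w0; rewrite ew /= /c c0' (contZ ct) trunc_tmono /n eq_sym size_eq0.
by rewrite (negPf w0) scaler0.
Qed.

Lemma shuffle_eulerian j f : s (e j f) = 2 ^+ j *: e j f.
Proof.
move: f; apply: cont_eqT => [||w].
- exact/cont_shuffle/cont_eulerian.
- exact/cont_scale/cont_eulerian.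
by have [->] := word_eigen w.
Qed.

Lemma eulerian_shuffle j f : e j (s f) = 2 ^+ j *: e j f.
Proof.
move: f; apply: cont_eqT => [||w].
- exact: (cont_comp cs (cont_eulerian j)).
- exact/cont_scale/cont_eulerian.
by have [_ ->] := word_eigen w.
Qed.

Lemma eulerian_high j f w : (size w < j)%N -> e j f w = 0.
Proof. by rewrite /eulerian ltnNge => /negPf ->. Qed.

Lemma trunc_eulerian_high l j f : (l < j)%N -> trunc l (e j f) = 0.
Proof.
by move=> lj; apply/funext => w; rewrite /trunc; case: eqP => // wl;
  rewrite eulerian_high // wl.
Qed.

Lemma trunc_sum_eulerian l n f : (l <= n)%N ->
  trunc l (\sum_(j < n.+1) e j f) = trunc l f.
Proof.
move=> ln; pose ct := @cont_trunc K J l; rewrite (cont_sum ct).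
move: f; apply: cont_eqT => [|//|w].
  by apply: cont_sumop => j; apply: cont_comp (cont_eulerian j) ct.
rewrite trunc_tmono; case: eqP => [wl|/eqP/negPf wl]; last first.
  rewrite big1 // => j _; rewrite preserves_length_eulerian trunc_tmono wl.
  exact: (cont0 (cont_eulerian j)).
have [_ _ wE _] := word_eigen w; rewrite [RHS]wE wl.
rewrite (big_ord_widen n.+1 (fun j => e j (mono w))) ?ltnS // [RHS]big_mkcond /=.
apply: eq_bigr => j _; rewrite ltnS; case: leqP => jl; last exact: trunc_eulerian_high.
by rewrite preserves_length_eulerian trunc_tmono wl eqxx.
Qed.

Lemma sum_eulerian w f n : (size w <= n)%N -> \sum_(j < n.+1) e j f w = f w.
Proof.
move=> wn; have := congr1 (fun h : T => h w) (trunc_sum_eulerian f wn).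
by rewrite /trunc eqxx prof_sum.
Qed.

Lemma eulerian0 f w : w != [::] -> e 0%N f w = 0.
Proof.
move=> w0; have [F _ ->] := cont_coordE (cont_eulerian 0) w.
apply: big1 => u _; have [->|u0] := eqVneq u [::].
  have := congr1 (fun h : T => h w) (preserves_length_eulerian 0 0 (mono [::])).
  have := congr1 (fun h : T => h w) (preserves_length_eulerian 0 (size w) (mono [::])).
  rewrite !trunc_tmono /trunc /= eqxx eq_sym size_eq0 (negPf w0).
  by rewrite (cont0 (cont_eulerian _)) prof0 => ->; rewrite mulr0.
by have [_ _ _ ->] := word_eigen u; rewrite // prof0 mulr0.
Qed.

(** The projections [e l] with [l != i] commute with the shuffle operator but have
    their values in another eigenspace, so they kill [f]. *)
Lemma eulerian_eigen i j f : s f = 2 ^+ i *: f -> e j f = (i == j)%:R *: f.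
Proof.
move=> sf; have e0 l : l != i -> e l f = 0.
  move=> /pow2_inv [a aE]; rewrite -[LHS]scale1r -aE -scalerA scalerBl.
  by rewrite -eulerian_shuffle sf (contZ (cont_eulerian l)) subrr scaler0.
case: eqP => [<-|/eqP ij]; last by rewrite scale0r e0 // eq_sym.
rewrite scale1r; apply/funext => w.
rewrite -(sum_eulerian f (leq_addr i (size w))).
rewrite (bigD1 (inord i)) //= inordK ?ltnS ?leq_addl // big1 ?addr0 // => l.
by rewrite -val_eqE /= inordK ?ltnS ?leq_addl // => /e0 ->; rewrite prof0.
Qed.

Lemma eulerian_comp i j f : e i (e j f) = (j == i)%:R *: e j f.
Proof. exact/eulerian_eigen/shuffle_eulerian. Qed.

Lemma eulerian'_eigen i j f : f [::] = 0 -> lift s f = 2 ^+ i *: f ->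
  e' j f = (i == j)%:R *: f.
Proof.
move=> f0 sf; apply/funext => -[|x v]; first by rewrite profZ f0 mulr0.
rewrite /= (eulerian_eigen (i := i)) //; apply/funext => u.
exact: (congr1 (fun h : T => h (x :: u)) sf).
Qed.

Lemma lift_shuffle_eulerian' j f : lift s (e' j f) = 2 ^+ j *: e' j f.
Proof.
apply/funext => -[|x v]; first by rewrite profZ mulr0.
by rewrite /= shuffle_eulerian.
Qed.

Lemma eulerian'_comp i j f : e' i (e' j f) = (j == i)%:R *: e' j f.
Proof. exact/eulerian'_eigen/lift_shuffle_eulerian'. Qed.

Lemma sum_eulerian' w f n : f [::] = 0 -> (size w <= n)%N ->
  \sum_(j < n.+1) e' j f w = f w.
Proof.
move=> f0; case: w => [|x v] vn; first by rewrite f0 big1.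
by rewrite /= (sum_eulerian (fun u => f (x :: u))) // ltnW.
Qed.

End Eulerian.

(** By continuity this is a statement on words.  A word is the sum of finitely
    many of its components [E i], or is killed by everything, and [A] carries the
    image of [E i] into that of [E' i]. *)
Lemma intertwine_projections (K : comNzRingType) (J : choiceType)
  (A : tens K J -> tens K J) (E E' : nat -> tens K J -> tens K J) :
  cont A -> (forall i, cont (E i)) -> (forall i, cont (E' i)) ->
  (forall i j f, E i (E j f) = (j == i)%:R *: E j f) ->
  (forall i j f, E' j (A (E i f)) = (i == j)%:R *: A (E i f)) ->
  (forall w, (A (tmono K w) = 0 /\ forall j, E j (tmono K w) = 0) \/
     exists n, tmono K w = \sum_(i < n) E i (tmono K w)) ->
  forall j f, E' j (A f) = A (E j f).
Proof.
move=> cA cE cE' EE E'E wE j; apply: cont_eqT => [||w].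
- exact: (cont_comp cA (cE' j)).
- exact: (cont_comp (cE j) cA).
have [[Aw Ew]|[n ->]] := wE w; first by rewrite Aw Ew (cont0 cA) (cont0 (cE' j)).
rewrite (cont_sum cA) (cont_sum (cE' j)) (cont_sum (cE j)) (cont_sum cA).
by apply: eq_bigr => i _; rewrite E'E EE (contZ cA).
Qed.

(** * Inner derivations and the cyclic operator *)

Section Inner.
Variables (K : comNzRingType) (J : choiceType) (deg : J -> int).
Local Notation T := (tens K J).
Local Notation mono := (tmono K).
Local Notation one := (tmono K [::]).
Local Notation sg b := ((-1) ^+ nat_of_bool b : K).
Local Notation par := (par deg).
Local Notation dpar := (dpar deg).
Local Notation has_par := (@has_par K J deg).
Local Notation s := (@shuffle K J deg).
Local Notation z := (@cyc K J deg).
Implicit Types (u v w t : seq J) (f g h : T).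

(** The derivation [x, -], for [x] of degree [q]. *)
Definition ad (q : int) (x : T) : T -> T :=
  cont_der deg q (fun j => tcomm q (deg j) x (tgen K j)).

Section Ad.
Variables (q : int) (x : T).
Hypothesis qx : has_par (parz q) x.

Lemma der_data_ad : der_data deg q (fun j => tcomm q (deg j) x (tgen K j)).
Proof.
split=> [w|j]; last exact: has_par_tcomm qx (has_par_tgen deg j).
exists w => j; rewrite /tcomm profB profZ.
have [->|/tmul_neq0 [u _ ->] _] := eqVneq (tmul x (tgen K j) w) 0; last first.
  by rewrite mem_cat mem_head orbT.
rewrite sub0r; case: w => [|i v]; first by rewrite tmul_tgen_nil mulr0 oppr0 eqxx.
rewrite tmul_tgen_cons; have [->|_] := eqVneq j i; first by rewrite mem_head.
by rewrite mul0r mulr0 oppr0 eqxx.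
Qed.

Lemma cont_ad : cont (ad q x).
Proof. exact: cont_der_id der_data_ad. Qed.

Lemma ad_tmono v : ad q x (mono v) =
  tmul x (mono v) - sg (parz q && par v) *: tmul (mono v) x.
Proof.
elim: v => [|j v IHv].
  by rewrite /ad der_tmono par_nil andbF scale1r tmul1l tmul1r subrr.
rewrite -[j :: v]/([:: j] ++ v) -tmul_tmono -/(tgen K j) /ad (der_tgenM der_data_ad).
rewrite -/(ad q x) IHv /tcomm ksgnE parzM par_cons -/(dpar j).
rewrite tmulBl tmulBr tmulZl tmulZr !tmulA; apply/funext => w; rewrite !profE.
by case: (parz q); case: (dpar j); case: (par v) => /=; ring.
Qed.

End Ad.

Lemma shuffle_ad q x f : lie_monomial deg q x -> s (ad q x f) = ad q x (s f).
Proof.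
move=> lx; apply: (shuffle_der (der_data_ad (has_par_lie lx))) => j.
by apply: (@primitive_lie _ _ _ (q + deg j)); apply: lie_bracket => //; left.
Qed.

Lemma cont_cyc : cont z.
Proof.
split=> [a f g|w]; first exact: cyc_linear.
by exists [:: rotr 1 w] => f f0; rewrite /cyc f0 ?mulr0 // mem_head.
Qed.

Lemma cont_iter_cyc i : cont (iter i z).
Proof.
elim: i => [|i IHi]; first exact: cont_id.
by apply: cont_comp IHi cont_cyc.
Qed.

Lemma cyc_tmono_cons j v :
  z (mono (j :: v)) = sg (dpar j && par v) *: mono (rcons v j).
Proof.
apply/funext => w; rewrite profZ /cyc.
have [->|] := eqVneq w (rcons v j).
  by rewrite rotr1_rcons !tmono_id /cyc_sign ksgnE parzM.
move=> ne; rewrite [X in _ * X]tmonoN 1?[X in _ = _ * X]tmonoN ?mulr0 //.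
  by rewrite eq_sym.
apply: contraNneq ne => vw; rewrite -[w](rotrK 1) -vw.
by rewrite -cats1 -[j :: v]/([:: j] ++ v) (rot_size_cat [:: j]).
Qed.

Lemma cyc_one : z one = one.
Proof.
apply/funext => -[|i w]; first by rewrite /cyc /= mul1r.
rewrite /cyc tmonoN ?tmonoN ?mulr0 //; apply/eqP => /(congr1 size).
by rewrite size_rotr.
Qed.

(** The operator [1 - z] is [x (x) f -> [x, f]], and hence commutes with the
    shuffle operator up to the shift of the first tensor factor. *)
Lemma sub_cyc_tgenM j f :
  tmul (tgen K j) f - z (tmul (tgen K j) f) = ad (deg j) (tgen K j) f.
Proof.
have pj := has_par_tgen (K := K) deg j.
move: f; apply: cont_eqT => [||v].
- apply: cont_sub; first exact: cont_tmulr_id.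
  exact: (cont_comp (cont_tmulr_id _) cont_cyc).
- exact: cont_ad.
by rewrite (ad_tmono pj) /tgen !tmul_tmono cyc_tmono_cons cats1.
Qed.

Lemma cont_sub_cyc : cont (fun f => f - z f).
Proof. exact: (cont_sub (@cont_id _ _) cont_cyc). Qed.

Lemma shuffle_sub_cyc f : s (f - z f) = lift s f - z (lift s f).
Proof.
have cs : cont s by exact/cont_shuffle/cont_id.
move: f; apply: cont_eq_tgenM => [|||j v].
- exact: (cont_comp cont_sub_cyc cs).
- exact: (cont_comp (cont_lift cs) cont_sub_cyc).
- by rewrite cyc_one subrr (cont0 cs) lift_one // (cont0 cont_cyc) subrr.
rewrite sub_cyc_tgenM lift_tgenM // sub_cyc_tgenM shuffle_ad //; exact: lie_gen.
Qed.

(** * The cyclic derivative *)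

(** [cyc_der u t] is the sum over the letters of [u] of the rotations of
    [u ++ t] which begin with that letter.  For empty [t] this is the norm of
    [u]; in terms of forms, it represents [du . t] modulo commutators. *)
Fixpoint cyc_der u t : T :=
  if u is j :: v
  then mono (j :: v ++ t) + sg (dpar j && (par v (+) par t)) *: cyc_der v (rcons t j)
  else 0.

Lemma cyc_der_cat u v t : cyc_der (u ++ v) t =
  cyc_der u (v ++ t) + sg (par u && (par v (+) par t)) *: cyc_der v (t ++ u).
Proof.
elim: u t => [|j u IHu] t; first by rewrite par_nil cats0 add0r scale1r.
rewrite /= IHu -catA scalerDr -!addrA rcons_cat cat_rcons; congr (_ + _).
rewrite !par_cat !scalerA -!signr_addb par_rcons par_cons.
congr (_ ^+ nat_of_bool _ *: _ + _ ^+ nat_of_bool _ *: _);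
  by case: (dpar j); case: (par u); case: (par v); case: (par t).
Qed.

Lemma cyc_der_iter u t : cyc_der u t = \sum_(i < size u) iter i z (mono (u ++ t)).
Proof.
elim: u t => [|j u IHu] t; first by rewrite big_ord0.
rewrite /= big_ord_recl /= IHu scaler_sumr; congr (_ + _).
apply: eq_bigr => i _; rewrite -iterS iterSr cyc_tmono_cons par_cat.
by rewrite (contZ (cont_iter_cyc i)) rcons_cat.
Qed.

Lemma cyc_der_support u t y : cyc_der u t y != 0 -> perm_eq (u ++ t) y.
Proof.
elim: u t => [|j u IHu] t /=; first by rewrite prof0 eqxx.
have [<-//|ne] := eqVneq (j :: u ++ t) y.
rewrite profD profZ tmonoN // add0r => nz.
apply: (perm_trans _ (IHu (rcons t j) _)).
  by rewrite -rcons_cat perm_sym perm_rcons.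
by apply: contra_neq nz => ->; rewrite mulr0.
Qed.

Lemma cont_cyc_norm : cont (@cyc_norm K J deg).
Proof.
split=> [a f g|w].
  apply/funext => w; rewrite profD profZ /cyc_norm mulr_sumr -big_split.
  by apply: eq_bigr => i _; rewrite (cont_linear (cont_iter_cyc i)).
have cN : cont (fun f => \sum_(i < size w) iter i z f).
  by apply: cont_sumop => i; apply: cont_iter_cyc.
have [F FA] := cont_coord cN w; exists F => f f0.
by rewrite -(FA f f0) prof_sum.
Qed.

Lemma cyc_norm_tmono w : cyc_norm deg (mono w) = cyc_der w [::].
Proof.
apply/funext => y; have [wy|wy] := eqVneq (size w) (size y).
  by rewrite cyc_der_iter cats0 prof_sum wy.
rewrite [RHS](_ : _ = 0); last first.
  by apply/eqP; apply: contraNT wy => /cyc_der_support; rewrite cats0 => /perm_size ->.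
rewrite /cyc_norm big1 // => -[n _] _ /=; elim: n y wy => [|n IHn] y wy /=.
  by rewrite tmonoN //; apply: contraNneq wy => ->.
by rewrite /cyc IHn ?mulr0 // size_rotr.
Qed.

Lemma dsum_cat (M : lmodType K) w t (phi : seq J -> seq J -> M) :
  dsum deg (w ++ t) phi =
  dsum deg w (fun a b => dsum deg t (fun c d =>
    sg (par b && par c) *: phi (a ++ c) (b ++ d))).
Proof.
elim: w phi => [|j w IHw] phi /=.
  by apply: eq_dsum => c d _; rewrite par_nil scale1r.
rewrite IHw; apply: eq_dsum => a b _; rewrite dsumZ -dsumD.
apply: eq_dsum => c d _; rewrite scalerDr !scalerA -!signr_addb; congr (_ + _ *: _).
rewrite par_cat par_cons; congr (_ ^+ nat_of_bool _).
by case: (dpar j); case: (par a); case: (par b); case: (par c).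
Qed.

(** Each side distributes the letters of [w ++ t] to the left or to the right of
    a chosen letter of [w]; the pieces are matched up to an exchange of the two
    parts of the letters preceding it. *)
Lemma lift_shuffle_cyc_der w t : lift s (cyc_der w t) =
  dsum deg w (fun a b => dsum deg t (fun c d =>
    sg (par b && par c) *: cyc_der a (c ++ b ++ d))).
Proof.
have cs : cont s by exact/cont_shuffle/cont_id.
have cl := cont_lift cs.
elim: w t => [|j w IHw] t.
  rewrite (cont0 cl) /= -[LHS](scale0r (dsum deg t (fun _ _ => 0 : T))) dsumZ.
  by apply: eq_dsum => c d _; rewrite !scaler0.
rewrite [cyc_der _ _]/= (contD cl) (contZ cl) IHw lift_cons // shuffle_tmono dsum_cat.
rewrite (dsum_linear _ _ (cont_linear (cont_tmulr_id _))) dsumZ -dsumD [RHS]/=.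
apply: eq_dsum => a b /perm_catr wE.
rewrite dsum_rcons (dsum_linear _ _ (cont_linear (cont_tmulr_id _))) !dsumZ -!dsumD.
apply: eq_dsum => c d /perm_catr tE.
rewrite (contZ (cont_tmulr_id _)) tmul_tmono /= !scalerDr !scalerA -!signr_addb.
rewrite -!addrA -!catA !cat_rcons !rcons_cat; congr (_ + _); rewrite addrC.
rewrite !par_cat par_rcons par_cons wE tE.
congr (_ ^+ nat_of_bool _ *: _ + _ ^+ nat_of_bool _ *: _);
  by case: (dpar j); case: (par a); case: (par b); case: (par c); case: (par d).
Qed.

(** By cocommutativity, the letter chosen by the norm may be supposed to lie in
    the left part of the coproduct, at the cost of a factor 2. *)
Lemma cyc_norm_shuffle f : cyc_norm deg (s f) = 2 *: lift s (cyc_norm deg f).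
Proof.
have cs : cont s by exact/cont_shuffle/cont_id.
have cN := cont_cyc_norm.
move: f; apply: cont_eqT => [||w].
- exact: (cont_comp cs cN).
- exact/cont_scale/(cont_comp cN)/cont_lift.
rewrite shuffle_tmono (dsum_linear _ _ (cont_linear cN)) cyc_norm_tmono.
rewrite lift_shuffle_cyc_der /=.
have cE a b : cyc_norm deg (mono (a ++ b)) =
    cyc_der a b + sg (par a && par b) *: cyc_der b a.
  by rewrite cyc_norm_tmono cyc_der_cat cats0 par_nil addbF.
rewrite (eq_dsum (fun a b _ => cE a b)) dsumD -dsum_cocomm.
rewrite -[X in X + X = _]scale1r -scalerDl; congr (_ *: _); apply: eq_dsum => a b _.
by rewrite par_nil andbF scale1r cats0.
Qed.

End Inner.

(** * The Hochschild differential of a derivation *)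

Section HochschildDifferential.
Variables (K : comNzRingType) (J : choiceType) (deg : J -> int).
Local Notation T := (tens K J).
Local Notation mono := (tmono K).
Local Notation one := (tmono K [::]).
Local Notation sg b := ((-1) ^+ nat_of_bool b : K).
Local Notation par := (par deg).
Local Notation dpar := (dpar deg).
Local Notation has_par := (@has_par K J deg).
Local Notation s := (@shuffle K J deg).
Local Notation z := (@cyc K J deg).
Implicit Types (u v w t y : seq J) (f g h : T).

(** An identity whose signs involve the parity of [f] makes sense for series of
    that parity only; it is checked on the words of that parity. *)
Lemma cont_eq_par (Y : choiceType) (A B : T -> prof K Y) b : cont A -> cont B ->
  (forall w, par w = b -> A (mono w) = B (mono w)) ->
  forall f, has_par b f -> A f = B f.
Proof.
move=> cA cB AB f bf; apply/eqP; rewrite -subr_eq0; apply/eqP/funext => y.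
have [F _ FE] := cont_coordE (cont_sub cA cB) y; rewrite prof0 -[LHS]/((A f - B f) y) FE.
rewrite big1 // => u _; have [->|/bf ub] := eqVneq (f u) 0; first by rewrite mul0r.
by rewrite -[basis_elt K u]/(mono u) AB // subrr mulr0.
Qed.

(** The words [u] and [t] for which [cyc_der u t] can have a coefficient at [y]. *)
Definition parts y : seq (seq J) :=
  undup (flatten [seq [seq take i w | i <- iota 0 (size w).+1] ++
                      [seq drop i w | i <- iota 0 (size w).+1] | w <- permutations y]).

Lemma mem_parts u t y : perm_eq (u ++ t) y -> (u \in parts y) && (t \in parts y).
Proof.
move=> uty; have us : (size u < (size (u ++ t)).+1)%N by rewrite ltnS size_cat leq_addr.
by apply/andP; split; rewrite mem_undup; apply/flattenP;
  (exists ([seq take i (u ++ t) | i <- iota 0 (size (u ++ t)).+1] ++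
           [seq drop i (u ++ t) | i <- iota 0 (size (u ++ t)).+1]);
   first by apply: (map_f (fun w => [seq take i w | i <- iota 0 (size w).+1] ++
                      [seq drop i w | i <- iota 0 (size w).+1]));
            rewrite mem_permutations);
  rewrite mem_cat; apply/orP; [left|right]; apply/mapP; exists (size u);
  rewrite ?mem_iota ?take_size_cat ?drop_size_cat.
Qed.

(** The continuous bilinear extension of [cyc_der], with its sums restricted to
    the finitely many terms which can contribute. *)
Definition cyc_der2 f g : T := fun y =>
  \sum_(u <- parts y) \sum_(t <- parts y) f u * g t * cyc_der K deg u t y.

Lemma cont_cyc_der2l_id g : cont (fun f => cyc_der2 f g).
Proof.
apply: (cont_finite (F := parts)) => [a f f'|f y f0].
  apply/funext => y; rewrite profD profZ /cyc_der2 mulr_sumr -big_split.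
  apply: eq_bigr => u _; rewrite mulr_sumr -big_split /=; apply: eq_bigr => t _.
  by rewrite !profE; ring.
rewrite /cyc_der2 big1_seq // => u /andP[_ uy]; rewrite big1 // => t _.
by rewrite f0 // !mul0r.
Qed.

Lemma cont_cyc_der2r_id f : cont (cyc_der2 f).
Proof.
apply: (cont_finite (F := parts)) => [a g g'|g y g0].
  apply/funext => y; rewrite profD profZ /cyc_der2 mulr_sumr -big_split.
  apply: eq_bigr => u _; rewrite mulr_sumr -big_split /=; apply: eq_bigr => t _.
  by rewrite !profE; ring.
rewrite /cyc_der2 big1 // => u _; rewrite big1_seq // => t /andP[_ ty].
by rewrite g0 // mulr0 mul0r.
Qed.

Lemma cont_cyc_der2l (X : choiceType) (A : prof K X -> T) g :
  cont A -> cont (fun x => cyc_der2 (A x) g).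
Proof. by move=> cA; apply: (cont_comp cA (cont_cyc_der2l_id g)). Qed.
Lemma cont_cyc_der2r (X : choiceType) (A : prof K X -> T) f :
  cont A -> cont (fun x => cyc_der2 f (A x)).
Proof. by move=> cA; apply: (cont_comp cA (cont_cyc_der2r_id f)). Qed.

Lemma cyc_der2_tmono u t : cyc_der2 (mono u) (mono t) = cyc_der K deg u t.
Proof.
apply/funext => y; rewrite /cyc_der2.
have [uty|uty] := boolP (perm_eq (u ++ t) y); last first.
  have c0 : cyc_der K deg u t y = 0 by apply/eqP; apply: contraNT uty; apply: cyc_der_support.
  rewrite c0 big1 // => u' _; rewrite big1 // => t' _.
  have [<-|/tmonoN ->] := eqVneq u u'; last by rewrite !mul0r.
  have [<-|/tmonoN ->] := eqVneq t t'; last by rewrite mulr0 mul0r.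
  by rewrite c0 mulr0.
have /andP[up tp] := mem_parts uty.
rewrite (bigD1_seq u) ?undup_uniq //= [X in _ + X]big1 => [|u' uu']; last first.
  by apply: big1 => t' _; rewrite tmonoN 1?eq_sym // !mul0r.
rewrite addr0 (bigD1_seq t) ?undup_uniq //= [X in _ + X]big1 => [|t' tt']; last first.
  by rewrite [mono t _]tmonoN 1?eq_sym // mulr0 mul0r.
by rewrite addr0 !tmono_id !mul1r.
Qed.

Lemma cyc_der2_neq0 f v y : cyc_der2 f (mono v) y != 0 ->
  exists2 u, f u != 0 & perm_eq (u ++ v) y.
Proof.
move=> nz; have [u _ nzu] : exists2 u, u \in parts y &
    \sum_(t <- parts y) f u * mono v t * cyc_der K deg u t y != 0.
  apply/hasP; apply: contraNT nz => /hasPn x0.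
  by rewrite /cyc_der2 big1_seq // => u /andP[_ /x0 /negPn /eqP].
exists u; first by apply: contra_neq nzu => fu; rewrite big1 // => t _; rewrite fu !mul0r.
apply: contraNT nzu => uvy; rewrite big1 // => t _.
have [<-|/tmonoN ->] := eqVneq v t; last by rewrite mulr0 mul0r.
rewrite [cyc_der _ _ _ _ _](_ : _ = 0) ?mulr0 //.
by apply/eqP; apply: contraNT uvy; apply: cyc_der_support.
Qed.

Lemma cyc_der2_tgen j g : cyc_der2 (tgen K j) g = tmul (tgen K j) g.
Proof.
move: g; apply: cont_eqT => [||t].
- exact: cont_cyc_der2r_id.
- exact: cont_tmulr_id.
by rewrite cyc_der2_tmono /= scaler0 addr0 tmul_tmono.
Qed.

Lemma cyc_der2M b c f g t : has_par b f -> has_par c g ->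
  cyc_der2 (tmul f g) (mono t) = cyc_der2 f (tmul g (mono t)) +
    sg (b && (c (+) par t)) *: cyc_der2 g (tmul (mono t) f).
Proof.
move=> bf cg; move: f bf; apply: cont_eq_par => [||u ub].
- exact/cont_cyc_der2l/cont_tmull_id.
- apply: cont_add; first exact: cont_cyc_der2l_id.
  exact/cont_scale/cont_cyc_der2r/cont_tmulr_id.
move: g cg; apply: cont_eq_par => [||v vc].
- exact/cont_cyc_der2l/cont_tmulr_id.
- apply: cont_add; first exact/cont_cyc_der2r/cont_tmull_id.
  exact/cont_scale/cont_cyc_der2l_id.
by rewrite !tmul_tmono !cyc_der2_tmono cyc_der_cat ub vc.
Qed.

(** By the product rule, [d[f, g]] is expressed by [df] and [dg], and modulo
    commutators the other factors can be collected behind them. *)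
Lemma cyc_der2_tcomm p q f g h : has_par (parz p) f -> has_par (parz q) g ->
  cyc_der2 (tcomm p q f g) h =
  cyc_der2 f (ad deg q g h) - ksgn K (p * q) *: cyc_der2 g (ad deg p f h).
Proof.
move=> pf qg; move: h; apply: cont_eqT => [||t].
- exact: cont_cyc_der2r_id.
- apply: cont_sub; first exact/cont_cyc_der2r/cont_ad.
  exact/cont_scale/cont_cyc_der2r/cont_ad.
rewrite !ad_tmono // /tcomm !(contB (cont_cyc_der2r_id _)) !(contZ (cont_cyc_der2r_id _)).
rewrite (contB (cont_cyc_der2l_id _)) (contZ (cont_cyc_der2l_id _)) ksgnE parzM.
rewrite (cyc_der2M _ pf qg) (cyc_der2M _ qg pf); apply/funext => y; rewrite !profE.
by case: (parz p); case: (parz q); case: (par t) => /=; ring.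
Qed.

(** For a Lie element [x] the operator [cyc_der2 x] is built from inner
    derivations, with which the shuffle operator commutes. *)
Lemma lift_shuffle_cyc_der2 x g : Lhat deg x -> lift s (cyc_der2 x g) = cyc_der2 x (s g).
Proof.
have cs : cont s by exact/cont_shuffle/cont_id.
have cl := cont_lift cs.
move=> Lx; move: x Lx; apply: cont_conv_span => [||x [p lx]].
- exact: (cont_comp (cont_cyc_der2l_id g) cl).
- exact: cont_cyc_der2l_id.
elim: lx g => [j|{}p q {}x y lx IHx ly IHy] g; first by rewrite !cyc_der2_tgen lift_tgenM.
rewrite !(cyc_der2_tcomm _ (has_par_lie lx) (has_par_lie ly)).
by rewrite (contB cl) (contZ cl) IHx IHy !shuffle_ad.
Qed.

Lemma sub_cyc_der u t : cyc_der K deg u t - z (cyc_der K deg u t) =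
  mono (u ++ t) - sg (par u && par t) *: mono (t ++ u).
Proof.
elim: u t => [|j u IHu] t.
  by rewrite (cont0 (cont_cyc K deg)) par_nil cats0 scale1r !subrr.
rewrite /= (contD (cont_cyc K deg)) (contZ (cont_cyc K deg)) cyc_tmono_cons.
rewrite opprD addrACA -scalerBr IHu rcons_cat par_cat scalerBr addrA subrK.
rewrite scalerA -signr_addb cat_rcons par_rcons par_cons.
congr (_ - _ ^+ nat_of_bool _ *: _).
by case: (dpar j); case: (par u); case: (par t).
Qed.

Lemma sub_cyc_der2 b f v : has_par b f ->
  cyc_der2 f (mono v) - z (cyc_der2 f (mono v)) =
  tmul f (mono v) - sg (b && par v) *: tmul (mono v) f.
Proof.
move: f; apply: cont_eq_par => [||u <-].
- exact: (cont_comp (cont_cyc_der2l_id _) (cont_sub_cyc K deg)).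
- by apply: cont_sub; [exact: cont_tmull_id | exact/cont_scale/cont_tmulr_id].
by rewrite !tmul_tmono cyc_der2_tmono sub_cyc_der.
Qed.

Lemma cyc_tgenM j b f : has_par b f ->
  z (tmul (tgen K j) f) = sg (dpar j && b) *: tmul f (tgen K j).
Proof.
move: f; apply: cont_eq_par => [||v <-].
- exact: (cont_comp (cont_tmulr_id _) (cont_cyc K deg)).
- exact/cont_scale/cont_tmull_id.
by rewrite !tmul_tmono cyc_tmono_cons cats1.
Qed.

Variables (p : int) (X : J -> T).
Hypothesis dX : der_data deg p X.
Local Notation D := (@cont_der K J deg p X).

(** Up to sign, the Lie derivative of the one-form [dx . v], rewritten as a
    combination of one-forms of the same shape. *)
Definition hoch_word w : T :=
  if w is j :: v
  then cyc_der2 (X j) (mono v) + sg (parz p && dpar j) *: tmul (tgen K j) (D (mono v))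
  else 0.
Definition hoch : T -> T := cont_ext hoch_word.

Lemma locfin_hoch : locfin hoch_word.
Proof.
move=> y; have /choice [r rP] := der_locfin dX.
have [q qP] : exists q : seq (seq J), forall j v,
    tmul (tgen K j) (D (mono v)) y != 0 -> j :: v \in q.
  case: y => [|i y]; first by exists [::] => j v; rewrite tmul_tgen_nil eqxx.
  have [q qP] := locfin_leibniz dX y; exists [seq i :: v | v <- q] => j v.
  rewrite tmul_tgen_cons; have [->|_] := eqVneq j i; last by rewrite mul0r eqxx.
  by rewrite mul1r der_tmono => /qP; apply: map_f.
exists (q ++ [seq j :: v | j <- flatten [seq r u | u <- parts y], v <- parts y]).
move=> [|j v] /=; first by rewrite eqxx.
rewrite profD profZ mem_cat.
have [->|/qP -> //] := eqVneq (tmul (tgen K j) (D (mono v)) y) 0.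
rewrite mulr0 addr0 => /cyc_der2_neq0 [u nz /mem_parts /andP[uy vy]].
apply/orP; right; apply: allpairs_f => //; apply/flattenP.
by exists (r u); [exact: map_f | exact: rP].
Qed.

Lemma cont_hoch : cont hoch.
Proof. exact/cont_cont_ext/locfin_hoch. Qed.

Lemma hoch_one : hoch one = 0.
Proof. exact: cont_ext_basis. Qed.

Lemma hoch_tgenM j f : hoch (tmul (tgen K j) f) =
  cyc_der2 (X j) f + sg (parz p && dpar j) *: tmul (tgen K j) (D f).
Proof.
move: f; apply: cont_eqT => [||v].
- exact: (cont_comp (cont_tmulr_id _) cont_hoch).
- apply: cont_add; first exact: cont_cyc_der2r_id.
  exact/cont_scale/cont_tmulr/cont_der_id.
by rewrite tmul_tmono [LHS]cont_ext_basis.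
Qed.

Section Length.
Hypothesis X0 : forall j, X j [::] = 0.

Lemma size_gt0_X j u : X j u != 0 -> (0 < size u)%N.
Proof. by case: u => //; rewrite X0 eqxx. Qed.

Lemma der_size w y : D (mono w) y != 0 -> (size w <= size y)%N.
Proof.
rewrite der_tmono; elim: w y => [//|j w IHw] y; rewrite leibniz_cons profD profZ.
have [->|nz] := eqVneq (tmul (tgen K j) (leibniz deg p X w) y) 0; last first.
  move=> _; case: y nz => [|i y]; first by rewrite tmul_tgen_nil eqxx.
  by rewrite tmul_tgen_cons => nz; apply: IHw; apply: contra_neq nz => ->; rewrite mulr0.
rewrite mulr0 addr0 => /tmul_neq0 [u /size_gt0_X nz ->].
by rewrite size_cat /= -add1n leq_add2r.
Qed.

Lemma hoch_size w y : hoch (mono w) y != 0 -> (size w <= size y)%N.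
Proof.
rewrite [hoch _]cont_ext_basis; case: w => [//|j w] /=; rewrite profD profZ.
have [->|nz] := eqVneq (tmul (tgen K j) (D (mono w)) y) 0; last first.
  move=> _; case: y nz => [|i y]; first by rewrite tmul_tgen_nil eqxx.
  rewrite tmul_tgen_cons => nz; rewrite ltnS; apply: der_size.
  by apply: contra_neq nz => ->; rewrite mulr0.
rewrite mulr0 addr0 => /cyc_der2_neq0 [u /size_gt0_X nz /perm_size <-].
by rewrite size_cat -add1n leq_add2r.
Qed.

Lemma hoch_nil f : hoch f [::] = 0.
Proof.
have [q _ ->] := cont_coordE cont_hoch [::]; rewrite big1 // => -[|i u] _.
  by rewrite -[basis_elt K _]/one hoch_one mulr0.
rewrite [X in _ * X](_ : _ = 0) ?mulr0 //; apply/eqP.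
by apply/negPn/negP => /hoch_size.
Qed.

Lemma der_nil f : D f [::] = 0.
Proof.
have [q _ ->] := cont_coordE (cont_der_id dX) [::]; rewrite big1 // => -[|i u] _.
  by rewrite [cont_der _ _ _ _]der_tmono mulr0.
rewrite [X in _ * X](_ : _ = 0) ?mulr0 //; apply/eqP.
by apply/negPn/negP => /der_size.
Qed.

End Length.

(** The derivation [D] maps [[j, v]] to [[X j, v]] plus or minus [[j, D v]], and
    both brackets are images of [1 - z], the first one by [sub_cyc_der2].  So [D]
    preserves the image of [1 - z]. *)
Lemma der_sub_cyc f : D (f - z f) = hoch f - z (hoch f).
Proof.
have cD := cont_der_id dX.
move: f; apply: cont_eq_tgenM => [|||j v].
- exact: (cont_comp (cont_sub_cyc K deg) cD).
- exact: (cont_comp cont_hoch (cont_sub_cyc K deg)).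
- by rewrite cyc_one subrr (cont0 cD) hoch_one (cont0 (cont_cyc K deg)) subrr.
rewrite (cyc_tgenM _ (has_par_tmono deg v)) (contB cD) (contZ cD).
rewrite (der_tmonoM dX) (der_tgenM dX) (der_tgen dX) hoch_tgenM.
rewrite [RHS](_ : _ = cyc_der2 (X j) (mono v) - z (cyc_der2 (X j) (mono v)) +
    sg (parz p && dpar j) *: (tmul (tgen K j) (D (mono v)) -
                              z (tmul (tgen K j) (D (mono v))))); last first.
  rewrite (contD (cont_cyc K deg)) (contZ (cont_cyc K deg)).
  by rewrite scalerBr opprD addrACA.
rewrite (sub_cyc_der2 _ (der_par dX j)) (cyc_tgenM _ (@has_par_der _ _ _ _ _ dX v)).
apply/funext => y; rewrite !profE.
by case: (parz p); case: (dpar j); case: (par v) => /=; ring.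
Qed.

(** The first term of [hoch] is dealt with by [lift_shuffle_cyc_der2] and the second
    one by the fact that [D] commutes with [s]. *)
Lemma hoch_lift_shuffle f : (forall j, Lhat deg (X j)) ->
  hoch (lift s f) = lift s (hoch f).
Proof.
move=> LX; have cs : cont s by exact/cont_shuffle/cont_id.
have cl := cont_lift cs.
move: f; apply: cont_eq_tgenM => [|||j v].
- exact: (cont_comp cl cont_hoch).
- exact: (cont_comp cont_hoch cl).
- by rewrite hoch_one lift_one // (cont0 cont_hoch) (cont0 cl).
rewrite lift_tgenM // !hoch_tgenM (contD cl) (contZ cl) lift_shuffle_cyc_der2 //.
by rewrite lift_tgenM // (shuffle_der dX) // => i; apply/primitive_Lhat/LX.
Qed.

End HochschildDifferential.

(** * Graded commutators are the image of 1 - z *)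

Section Commutators.
Variables (K : comNzRingType) (gr : int -> set K) (J : choiceType) (deg : J -> int).
Hypothesis grK : even_grading gr.
Hypothesis natr_inv : forall n, exists a : K, a * n.+1%:R = 1.
Local Notation T := (tens K J).
Local Notation mono := (tmono K).
Local Notation one := (tmono K [::]).
Local Notation sg b := ((-1) ^+ nat_of_bool b : K).
Local Notation par := (par deg).
Local Notation dpar := (dpar deg).
Local Notation has_par := (@has_par K J deg).
Local Notation z := (@cyc K J deg).
Local Notation N := (@cyc_norm K J deg).
Implicit Types (u v w t : seq J) (f g h : T).

Lemma gr_0 n : gr n 0. Proof. by have [[]] := grK. Qed.
Lemma gr_1 : gr 0 1. Proof. by have [_ []] := grK. Qed.
Lemma gr_B n x y : gr n x -> gr n y -> gr n (x - y).
Proof. by have [[_ H] _ _ _ _] := grK; apply: H. Qed.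
Lemma gr_D n x y : gr n x -> gr n y -> gr n (x + y).
Proof. by move=> nx ny; rewrite -[y]opprK -[- y]sub0r; apply/gr_B/gr_B/ny/gr_0. Qed.
Lemma gr_M p q x y : gr p x -> gr q y -> gr (p + q) (x * y).
Proof. by have [_ [_ H] _ _ _] := grK; apply: H. Qed.
Lemma gr_odd n x : parz n -> gr n x -> x = 0.
Proof. by have [_ _ H _ _] := grK; apply: H. Qed.
Lemma gr_sum n (I : Type) (r : seq I) (P : pred I) (F : I -> K) :
  (forall i, gr n (F i)) -> gr n (\sum_(i <- r | P i) F i).
Proof.
by move=> nF; elim/big_ind: _ => // [|x y]; [exact: gr_0 | exact: gr_D].
Qed.

Lemma homog_par n f : homog gr deg n f -> has_par (parz n) f.
Proof.
move=> nf w nz; apply/eqP; apply: contra_neqT nz => pw.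
by apply: gr_odd (nf w); rewrite parzB -/(par w) addbC -negb_eqb pw.
Qed.

Lemma homog_tmono w : homog gr deg (wdeg deg w) (mono w).
Proof.
move=> u; have [->|uw] := eqVneq w u; first by rewrite tmono_id subrr; exact: gr_1.
by rewrite tmonoN //; exact: gr_0.
Qed.

Lemma homog0 n : homog gr deg n 0. Proof. by move=> w; exact: gr_0. Qed.

Lemma cyc_norm_comm b c f g : has_par b f -> has_par c g ->
  N (tmul f g) = sg (b && c) *: N (tmul g f).
Proof.
have cN := cont_cyc_norm K deg.
move=> bf cg; move: f bf; apply: cont_eq_par => [||u <-].
- exact: (cont_comp (cont_tmull_id _) cN).
- exact/cont_scale/(cont_comp (cont_tmulr_id _) cN).
move: g cg; apply: cont_eq_par => [||v <-].
- exact: (cont_comp (cont_tmulr_id _) cN).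
- exact/cont_scale/(cont_comp (cont_tmull_id _) cN).
rewrite !tmul_tmono !cyc_norm_tmono !cyc_der_cat !cats0 par_nil !addbF.
rewrite scalerDr scalerA -signr_addb [X in _ = _ + _ ^+ nat_of_bool X *: _](_ : _ = false).
  by rewrite scale1r addrC.
by case: (par u); case: (par v).
Qed.

Lemma cyc_norm_cyc f : N (z f) = N f.
Proof.
have [cN cz] := (cont_cyc_norm K deg, cont_cyc K deg).
move: f; apply: cont_eq_tgenM => [||| j v]; [exact: (cont_comp cz cN) | exact: cN | |].
  by rewrite cyc_one.
rewrite (cyc_tgenM _ (has_par_tmono deg v)) (contZ cN).
by rewrite (cyc_norm_comm (has_par_tgen deg j) (has_par_tmono deg v)).
Qed.

(** In length [n], [n h - N h] is the sum of the [h - z ^ i h], each of which is in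
    the image of [1 - z], and [n] is invertible. *)
Lemma cyc_norm_eq0 h : h [::] = 0 -> N h = 0 -> cyc_image deg h.
Proof.
move=> h0 Nh; have /choice [a aE] := natr_inv.
pose g w := a (size w).-1 * \sum_(i < size w) \sum_(l < i) iter l z h w.
exists g; apply/funext => w; rewrite profB /cyc /g size_rotr.
have [->|w0] := eqVneq w [::]; first by rewrite h0 !big_ord0 !mulr0 subrr.
rewrite mulrCA -mulrBr mulr_sumr -sumrB.
have E (i : nat) : \sum_(l < i) iter l z h w -
    cyc_sign K deg (rotr 1 w) * \sum_(l < i) iter l z h (rotr 1 w) =
    h w - iter i z h w.
  elim: i => [|i IHi]; first by rewrite !big_ord0 mulr0 !subrr.
  rewrite !big_ord_recr /= mulrDr opprD addrACA IHi addrA subrK.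
  by rewrite -[in RHS]/(cyc_sign K deg (rotr 1 w) * iter i z h (rotr 1 w)).
under eq_bigr do rewrite E.
rewrite sumrB -[X in _ - X]/(N h w) Nh subr0.
rewrite sumr_const card_ord -mulr_natl mulrA.
by rewrite -[in _%:R](prednK (n := size w)) ?lt0n ?size_eq0 // aE mul1r.
Qed.

(** A series [g - z g] is a convergent combination of the commutators of a letter
    and a word; conversely the norm kills all graded commutators. *)
Lemma commutators_cyc h : sub_set (commutators gr deg) h <-> cyc_image deg h.
Proof.
split=> [|[g ->]].
  move=> Ch; apply: cyc_norm_eq0.
    have ct := cont_trunc K J 0; suff : trunc 0 h = 0 by move/(congr1 (fun f : T => f [::])).
    move: h Ch; apply: (@cont_conv_span _ _ _ (trunc 0) (fun=> 0)) => //.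
      exact: cont_zero.
    move=> _ [p [q [f [g [pf qg ->]]]]]; apply/funext => -[|//].
    rewrite /trunc /= /tcomm profB profZ /tmul !big_ord1 /= ksgnE parzM.
    case: (boolP (parz p && parz q)) => [/andP[op _]|_].
      have -> : f [::] = 0; last by rewrite mul0r !mulr0 subrr.
      by apply: (gr_odd op); have := pf [::]; rewrite wdeg_nil subr0.
    by rewrite mul1r mulrC subrr.
  have cN := cont_cyc_norm K deg.
  move: h Ch; apply: (@cont_conv_span _ _ _ N (fun=> 0)) => //; first exact: cont_zero.
  move=> _ [p [q [f [g [pf qg ->]]]]].
  rewrite /tcomm (contB cN) (contZ cN) (cyc_norm_comm (homog_par pf) (homog_par qg)).
  by rewrite ksgnE parzM subrr.
have cA := cont_sub_cyc K deg.
exists (seq J), g, (fun w => mono w - z (mono w)); split=> [[|j v]|y].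
- exists 0, 0, 0, 0; rewrite cyc_one subrr /tcomm tmul0l scaler0 subrr.
  by split=> //; exact: homog0.
- exists (wdeg deg [:: j]), (wdeg deg v), (mono [:: j]), (mono v).
  split; [exact: homog_tmono | exact: homog_tmono |].
  rewrite /tcomm !tmul_tmono cyc_tmono_cons ksgnE parzM -/(par v).
  by rewrite -/(par [:: j]) par_cons par_nil addbF cats1.
split; last exact: (congr1 (fun f : T => f y) (cont_extE cA g)).
have [F _ FE] := cont_coordE cA y.
apply: (@sub_finite_set _ _ [set` F]) => [w /= nz|]; last exact: finite_seq.
apply: contraNT nz => wF; have [F' FA] := cont_coord cA y.
suff -> : (mono w - z (mono w)) y = 0 by rewrite mulr0.
rewrite FE big1_seq // => u /andP[_ uF].
by rewrite [mono w u]tmonoN ?mul0r //; apply: contraNneq wF => ->.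
Qed.

End Commutators.

(** * The operator b on one-forms *)

Section OneForms.
Variables (K : comNzRingType) (gr : int -> set K) (I : choiceType) (deg : I -> int).
Hypothesis grK : even_grading gr.
Hypothesis natr_inv : forall n, exists a : K, a * n.+1%:R = 1.
Local Notation T := (tens K I).
Local Notation F := (tens K (I + I)%type).
Local Notation mono := (tmono K).
Local Notation sg b := ((-1) ^+ nat_of_bool b : K).
Local Notation fdeg := (form_deg deg).
Local Notation inj := (@form_inj K I).
Local Notation d := (@form_d K I deg).
Local Notation N := (@cyc_norm K (I + I)%type fdeg).
Local Notation inls := (map (@inl I I)).
Implicit Types (u v w t : seq I) (f g h : T).

Definition form_left (x : I + I) := if x is inl i then Some i else None.
Definition form_right (x : I + I) := if x is inr i then Some i else None.

Lemma pmap_inls w : pmap form_left (inls w) = w.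
Proof. by elim: w => //= i w ->. Qed.

Lemma locfin_form_inj : locfin (fun w => mono (inls w) : F).
Proof.
move=> y; exists [:: pmap form_left y] => w.
have [<-|/tmonoN ->] := eqVneq (inls w) y; last by rewrite eqxx.
by rewrite pmap_inls mem_head.
Qed.

Lemma cont_form_inj : cont inj.
Proof. exact/cont_cont_ext/locfin_form_inj. Qed.

Lemma form_inj_tmono w : inj (mono w) = mono (inls w).
Proof. exact: cont_ext_basis. Qed.

Lemma form_injM f g : inj (tmul f g) = tmul (inj f) (inj g).
Proof.
have ci := cont_form_inj.
move: f; apply: cont_eqT => [||u].
- exact: (cont_comp (cont_tmull_id _) ci).
- exact: cont_tmull.
move: g; apply: cont_eqT => [||v].
- exact: (cont_comp (cont_tmulr_id _) ci).
- exact: cont_tmulr.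
by rewrite tmul_tmono !form_inj_tmono tmul_tmono map_cat.
Qed.

Lemma par_inls w : par fdeg (inls w) = par deg w.
Proof. by elim: w => [|i w IHw]; rewrite ?par_nil //= !par_cons IHw. Qed.

Lemma has_par_form_inj b f : has_par deg b f -> has_par fdeg b (inj f).
Proof.
move=> bf y; rewrite /form_inj (cont_ext_sum _ (s := [:: pmap form_left y])).
  rewrite /= big_seq1; have [yE|/tmonoN ->] := eqVneq (inls (pmap form_left y)) y.
    by rewrite yE tmono_id mulr1 => /bf <-; rewrite -{1}yE par_inls.
  by rewrite mulr0 eqxx.
move=> w; have [<-|/tmonoN ->] := eqVneq (inls w) y; last by rewrite eqxx.
by rewrite pmap_inls mem_head.
Qed.

Lemma dpar_inr i : dpar fdeg (inr i) = ~~ dpar deg i.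
Proof. by rewrite /dpar /= parzD parz1 addbT. Qed.

Lemma der_data_d : der_data fdeg 1
  (fun x => match x with inl i => tgen K (inr i) : F | inr _ => 0 end).
Proof.
split=> [y|[i|i]]; last 2 first.
- by have := has_par_tgen (K := K) fdeg (inr i); rewrite dpar_inr.
- exact: has_par0.
exists [seq inl i | i <- pmap form_right y] => -[i|i]; last by rewrite prof0 eqxx.
have [<-|/tmonoN ne] := eqVneq [:: inr i] y; last by rewrite /tgen ne eqxx.
by rewrite /= mem_head.
Qed.

Lemma cont_d : cont d.
Proof. exact: cont_der_id der_data_d. Qed.

(** The form [dx . y] attached to [x (x) y]. *)
Definition oneform : T -> F :=
  cont_ext (fun w => if w is i :: v then mono (inr i :: inls v) else 0).

Lemma cont_oneform : cont oneform.
Proof.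
apply: cont_cont_ext => y.
exists (if y is inr i :: y' then [:: i :: pmap form_left y'] else [::]) => -[|i v].
  by rewrite prof0 eqxx.
have [<-|/tmonoN ->] := eqVneq (inr i :: inls v) y; last by rewrite eqxx.
by rewrite pmap_inls mem_head.
Qed.

Lemma oneform_tgenM i f : oneform (tmul (tgen K i) f) = tmul (tgen K (inr i)) (inj f).
Proof.
move: f; apply: cont_eqT => [||v].
- exact: (cont_comp (cont_tmulr_id _) cont_oneform).
- exact/cont_tmulr/cont_form_inj.
by rewrite tmul_tmono [LHS]cont_ext_basis form_inj_tmono tmul_tmono.
Qed.

Lemma oneform_one : oneform (mono [::]) = 0.
Proof. exact: cont_ext_basis. Qed.

(** Modulo commutators, [du . v] is [oneform (cyc_der u v)]: each letter of [u] on
    which [d] acts is rotated to the front. *)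
Lemma cyc_norm_d f v : N (tmul (d (inj f)) (mono (inls v))) =
  N (oneform (cyc_der2 deg f (mono v))).
Proof.
have [cN co] := (cont_cyc_norm K fdeg, cont_oneform).
move: f; apply: cont_eqT => [||u].
- exact: (cont_comp (cont_tmull _ (cont_comp cont_form_inj cont_d)) cN).
- exact: (cont_comp (cont_comp (cont_cyc_der2l_id _ _) co) cN).
rewrite form_inj_tmono cyc_der2_tmono; elim: u v => [|j u IHu] v.
  by rewrite /d /form_d der_tmono tmul0l (cont0 co).
rewrite [inls _]/= -[_ :: _]/([:: inl j] ++ inls u) -tmul_tmono -/(tgen K (inl j)).
rewrite /form_d (der_tgenM der_data_d) -/(form_d deg) tmulDl tmulZl -!tmulA.
rewrite [cyc_der _ _ _ _]/= (contD co) (contZ co) !(contD cN) !(contZ cN); congr (_ + _).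
  rewrite -[in RHS](tmul_tmono _ [:: j]) oneform_tgenM form_inj_tmono.
  by rewrite map_cat tmul_tmono.
rewrite -IHu (cyc_norm_comm (has_par_tgen fdeg (inl j)) (b := _) (c := ~~ par deg u (+) par deg v)).
  rewrite scalerA -signr_addb -tmulA tmul_tmono map_rcons -cats1.
  congr (_ ^+ nat_of_bool _ *: _); rewrite parz1 /=.
  by rewrite -[dpar fdeg _]/(dpar deg j); case: (dpar deg j); case: (par deg u); case: (par deg v).
rewrite -(par_inls v); apply: has_par_tmul (has_par_tmono _ _).
by have := has_par_der der_data_d (w := inls u); rewrite par_inls.
Qed.

Variables (p : int) (X : I -> T).
Hypothesis dX : der_data deg p X.
Local Notation D := (@cont_der K I deg p X).
Local Notation L := (@lie_der K I deg p D).

Lemma der_data_lie : der_data fdeg p (fun x : I + I => match x with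
    | inl i => inj (D (tgen K i))
    | inr i => ksgn K p *: d (inj (D (tgen K i))) end).
Proof.
have lX : locfin (fun i => D (tgen K i)).
  move=> y; have [s sP] := der_locfin dX y.
  by exists s => i; rewrite (der_tgen dX); apply: sP.
split=> [y|[i|i]].
- have [s1 s1P] := locfin_comp lX cont_form_inj y.
  have [s2 s2P] := locfin_comp lX (cont_comp cont_form_inj cont_d) y.
  exists ([seq inl i | i <- s1] ++ [seq inr i | i <- s2]) => -[i /s1P|i] /=.
    by rewrite mem_cat => /(map_f inl) ->.
  rewrite profZ mem_cat => nz; rewrite [X in _ || X]map_f ?orbT // s2P //.
  by apply: contra_neq nz => ->; rewrite mulr0.
- by rewrite (der_tgen dX); apply: has_par_form_inj (der_par dX i).
apply: has_parZ; rewrite (der_tgen dX) dpar_inr.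
have bX := has_par_form_inj (der_par dX i).
move: (inj (X i)) bX => f bf y nz.
have [s _ sE] := cont_coordE cont_d y.
have [u _ fu] : exists2 u : seq (I + I), u \in s & f u * d (basis_elt K u) y != 0.
  apply/hasP; apply: contraNT nz => /hasPn x0.
  by rewrite sE big1_seq // => u /andP[_ /x0 /negPn /eqP ->].
rewrite (has_par_der der_data_d (w := u)).
  rewrite (bf u) //; last by apply: contra_neq fu => ->; rewrite mul0r.
  by rewrite parz1 addTb -addbN.
by apply: contra_neq fu; rewrite /form_d /tmono => ->; rewrite mulr0.
Qed.

Lemma cont_lie_der : cont L.
Proof. exact: cont_der_id der_data_lie. Qed.

Lemma lie_der_inj f : L (inj f) = inj (D f).
Proof.
have [ci cD cL] := And3 cont_form_inj (cont_der_id dX) cont_lie_der.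
move: f; apply: cont_eqT => [||w]; [exact: (cont_comp ci cL)| exact: (cont_comp cD ci)|].
rewrite form_inj_tmono; elim: w => [|j w IHw].
  by rewrite /lie_der !der_tmono (cont0 ci).
rewrite [inls _]/= -[inl j :: _]/([:: inl j] ++ inls w) -[j :: w]/([:: j] ++ w).
rewrite -!tmul_tmono -/(tgen K (inl j)) -/(tgen K j).
rewrite /lie_der (der_tgenM der_data_lie) (der_tgenM dX) -/(lie_der deg p D) IHw.
rewrite (contD ci) (contZ ci) !form_injM form_inj_tmono (der_tgen dX).
by rewrite /tgen form_inj_tmono.
Qed.

Lemma cyc_norm_lie_der f : N (L (oneform f)) = ksgn K p *: N (oneform (hoch deg p X f)).
Proof.
have [cN co cL] := And3 (cont_cyc_norm K fdeg) cont_oneform cont_lie_der.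
have ch := cont_hoch dX.
move: f; apply: cont_eq_tgenM => [|||j v].
- exact: (cont_comp (cont_comp co cL) cN).
- exact/cont_scale/(cont_comp (cont_comp ch co) cN).
- by rewrite oneform_one hoch_one !(cont0 co) (cont0 cL) (cont0 cN) scaler0.
rewrite oneform_tgenM /lie_der (der_tgenM der_data_lie) -/(lie_der deg p D).
rewrite lie_der_inj (hoch_tgenM dX) (contD co) (contZ co) oneform_tgenM.
rewrite form_inj_tmono tmulZl !(contD cN) !(contZ cN) (der_tgen dX) cyc_norm_d.
rewrite scalerDr scalerA; congr (_ + _ *: _).
by rewrite ksgnE -signr_addb dpar_inr; case: (parz p); case: (dpar deg j).
Qed.

(** The coefficients of the forms [dx . y] in a one-form.  A rotation of [dx . y]
    which begins with a [d] is trivial, so they can be read off the norm. *)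
Definition oneform_coef (h : F) : T :=
  fun w => if w is i :: v then h (inr i :: inls v) else 0.

Lemma oneform_coefK f : f [::] = 0 -> oneform_coef (N (oneform f)) = f.
Proof.
have [cN co] := (cont_cyc_norm K fdeg, cont_oneform).
have cc : cont oneform_coef.
  split=> [a g h|[|i v]].
  - by apply/funext => -[|i v]; rewrite !profE ?mulr0 ?addr0.
  - by exists [::].
  by exists [:: inr i :: inls v] => g g0; rewrite /= g0 ?mem_head.
have E : (fun g => oneform_coef (N (oneform g))) =1 lift (fun g : T => g).
  apply: cont_eqT => [||[|j v]].
  - exact: (cont_comp (cont_comp co cN) cc).
  - exact/cont_lift/cont_id.
  - by rewrite oneform_one (cont0 cN) (cont0 cc) lift_one //; exact: cont_id.
  rewrite lift_cons ?tmul_tmono; last exact: cont_id.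
  rewrite [oneform _]cont_ext_basis cyc_norm_tmono /= (contD cc) (contZ cc) cats0.
  have c0 u (t : seq (I + I)) : oneform_coef (cyc_der K fdeg (inls u) t) = 0.
    elim: u t => [|i u IHu] t; first by rewrite (cont0 cc).
    rewrite /= (contD cc) (contZ cc) IHu scaler0 addr0.
    by apply/funext => -[|i' w] //=; rewrite tmonoN.
  rewrite c0 scaler0 addr0; apply/funext => -[|i w] /=; first by rewrite tmonoN.
  rewrite /tmono /basis_elt !eqseq_cons (inj_eq (@inr_inj _ _)).
  by rewrite (inj_eq (inj_map (@inl_inj _ _))).
by move=> f0; rewrite [LHS]E; apply/funext => -[|i v].
Qed.

Lemma oneform_nil f : oneform f [::] = 0.
Proof.
have [s _ ->] := cont_coordE cont_oneform [::]; rewrite big1 // => u _.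
by rewrite [oneform _]cont_ext_basis; case: u => [|i v]; rewrite ?prof0 ?tmonoN // mulr0.
Qed.

Lemma commutators_cyc_norm (h : F) : sub_set (commutators gr fdeg) h -> N h = 0.
Proof.
move/(commutators_cyc _ grK natr_inv) => [g ->]; have cN := cont_cyc_norm K fdeg.
by rewrite (contB cN) cyc_norm_cyc subrr.
Qed.

(** The norm kills the difference, and the coefficients of a one-form are read off
    its norm. *)
Lemma Theta_inj f g : f [::] = 0 -> g [::] = 0 ->
  Theta gr deg f = Theta gr deg g -> f = g.
Proof.
move=> f0 g0 /clsP /commutators_cyc_norm; rewrite (contB (cont_cyc_norm K fdeg)) => /eqP.
by rewrite subr_eq0 => /eqP fg; rewrite -(oneform_coefK f0) -(oneform_coefK g0) /oneform fg.
Qed.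

(** The Lie derivative preserves the commutators, as they form the image of
    [1 - z]. *)
Lemma induced_lie_der (h : F) :
  induced L (cls (commutators gr fdeg) h) = cls (commutators gr fdeg) (L h).
Proof.
have cL := cont_lie_der.
apply/clsP; rewrite -(contB cL); apply/commutators_cyc => //.
have /commutators_cyc [//|//|g ->] : sub_set (commutators gr fdeg)
    (repr (cls (commutators gr fdeg) h) - h) by apply/clsP; rewrite cls_repr.
by eexists; exact: (der_sub_cyc der_data_lie g).
Qed.

(** The sign is the one by which the Lie derivative passes [d]. *)
Lemma Theta_inv_lie_der f : (forall i, X i [::] = 0) -> f [::] = 0 ->
  Theta_inv (induced L (Theta gr deg f)) = ksgn K p *: hoch deg p X f.
Proof.
move=> X0 f0; set g := ksgn K p *: hoch deg p X f.
have [cN co] := (cont_cyc_norm K fdeg, cont_oneform).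
have g0 : g [::] = 0 by rewrite /g profZ (hoch_nil dX X0) mulr0.
have gE : Theta gr deg g = induced L (Theta gr deg f).
  rewrite /Theta induced_lie_der; apply/esym/clsP/commutators_cyc => //.
  apply: cyc_norm_eq0 => //; last first.
    by rewrite (contB cN) cyc_norm_lie_der -(contZ cN) -(contZ co) subrr.
  rewrite profB -[cont_ext _ g]/(oneform g) oneform_nil subr0.
  apply: (der_nil der_data_lie) => -[i|i].
    rewrite (der_tgen dX) /form_inj (cont_ext_sum _ (s := [:: [::]])) /= ?big_seq1 ?X0 ?mul0r //.
    by move=> [|j w]; rewrite ?mem_head // tmonoN ?eqxx.
  rewrite profZ; suff -> : d (inj (D (tgen K i))) [::] = 0 by rewrite mulr0.
  by apply: (der_nil der_data_d) => -[j|j] //; rewrite /tgen tmonoN.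
have [xn xE] : [set h | h [::] = 0 /\ Theta gr deg h = induced L (Theta gr deg f)]
    (Theta_inv (induced L (Theta gr deg f))).
  by apply: (xgetPex 0); exists g.
by apply: Theta_inj; rewrite ?xE.
Qed.

End OneForms.

(** * Degrees *)

Section Degree.
Variables (K : comNzRingType) (gr : int -> set K) (J : choiceType) (deg : J -> int).
Hypothesis grK : even_grading gr.
Local Notation T := (tens K J).
Local Notation mono := (tmono K).
Local Notation sg b := ((-1) ^+ nat_of_bool b : K).
Local Notation homog := (homog gr deg).
Implicit Types (u v w t : seq J) (f g h : T) (n p q : int).

Lemma homogD n f g : homog n f -> homog n g -> homog n (f + g).
Proof. by move=> nf ng w; apply: gr_D. Qed.

Lemma homogZ p n c f : gr p c -> homog n f -> homog (p + n) (c *: f).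
Proof. by move=> pc nf w; rewrite -addrA; apply: gr_M. Qed.

Lemma homogZ0 n c f : gr 0 c -> homog n f -> homog n (c *: f).
Proof. by move=> c0 nf; rewrite -[n]add0r; apply: homogZ. Qed.

Lemma gr_sg b : gr 0 (sg b).
Proof.
case: b; last exact: gr_1.
by rewrite expr1 -sub0r; apply: gr_B => //; [exact: gr_0 | exact: gr_1].
Qed.

Lemma homogB n f g : homog n f -> homog n g -> homog n (f - g).
Proof.
move=> nf ng; rewrite -scaleN1r; apply: homogD => //.
by apply: homogZ0 => //; exact: (gr_sg true).
Qed.

Lemma homog_tmul p q f g : homog p f -> homog q g -> homog (p + q) (tmul f g).
Proof.
move=> pf qg w; apply: gr_sum => // k.
by rewrite -{1}(cat_take_drop k w) wdeg_cat opprD addrACA; apply: gr_M.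
Qed.

Lemma homog_cont (J' : choiceType) (deg' : J' -> int) (A : T -> tens K J') p :
  cont A -> (forall w, Defs.homog gr deg' (wdeg deg w + p) (A (mono w))) ->
  forall n f, homog n f -> Defs.homog gr deg' (n + p) (A f).
Proof.
move=> cA Ap n f nf y; have [F _ ->] := cont_coordE cA y.
apply: gr_sum => // u.
have -> : n + p - wdeg deg' y = (n - wdeg deg u) + (wdeg deg u + p - wdeg deg' y).
  by rewrite addrA addrA subrK.
by apply: gr_M => //; apply: Ap.
Qed.

Lemma homog_dsum n w (phi : seq J -> seq J -> T) :
  (forall a b, perm_eq (a ++ b) w -> homog n (phi a b)) -> homog n (dsum deg w phi).
Proof.
elim: w phi => [|j w IHw] phi nphi /=; first exact: nphi.
apply: IHw => a b abw; apply: homogD; first by apply: nphi; rewrite /= perm_cons.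
apply/homogZ0/nphi; first exact: gr_sg.
by rewrite -cat_rcons -cats1 -catA perm_catCA /= perm_cons.
Qed.

Lemma homog_shuffle n f : homog n f -> homog n (shuffle deg f).
Proof.
have cs : cont (@shuffle K J deg) by exact/cont_shuffle/cont_id.
rewrite -{2}[n]addr0; move: n f; apply: homog_cont => // w.
rewrite shuffle_tmono addr0; apply: homog_dsum => a b abw.
suff -> : wdeg deg w = wdeg deg (a ++ b) by exact: homog_tmono.
by apply: perm_big; rewrite perm_sym.
Qed.

Lemma homog_cyc n f : homog n f -> homog n (cyc deg f).
Proof.
move=> nf w; rewrite -[n - _]add0r; apply: gr_M => //.
  by case: (rotr 1 w) => [|j v]; [exact: gr_1 | rewrite /= ksgnE; exact: gr_sg].
suff -> : wdeg deg w = wdeg deg (rotr 1 w) by exact: nf.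
by apply: perm_big; rewrite perm_sym perm_rotr.
Qed.

Lemma homog_cyc_norm n f : homog n f -> homog n (cyc_norm deg f).
Proof.
move=> nf w; apply: gr_sum => // i.
suff : homog n (iter i (cyc deg) f) by apply.
by elim: (nat_of_ord i) => [//|l IHl] /=; apply: homog_cyc.
Qed.

Lemma homog_cyc_der u t : homog (wdeg deg u + wdeg deg t) (cyc_der K deg u t).
Proof.
elim: u t => [|j u IHu] t; first exact: homog0.
rewrite /= -wdeg_cat; apply: homogD; first exact: homog_tmono.
apply: homogZ0; first exact: gr_sg.
suff -> : wdeg deg ((j :: u) ++ t) = wdeg deg u + wdeg deg (rcons t j) by exact: IHu.
by rewrite -wdeg_cat; apply: perm_big; rewrite -rcons_cat perm_sym perm_rcons.
Qed.

Lemma homog_cyc_der2 n f v :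
  homog n f -> homog (n + wdeg deg v) (cyc_der2 deg f (mono v)).
Proof.
move: n f; apply: (homog_cont (A := fun f => cyc_der2 deg f (mono v))) => [|w].
  exact: cont_cyc_der2l_id.
by rewrite cyc_der2_tmono; apply: homog_cyc_der.
Qed.

Section Derivation.
Variables (p : int) (X : J -> T).
Hypothesis dX : der_data deg p X.
Hypothesis pX : forall j, homog (deg j + p) (X j).

Lemma homog_der_word w : homog (wdeg deg w + p) (cont_der deg p X (mono w)).
Proof.
rewrite der_tmono; elim: w => [|j w IHw]; first exact: homog0.
rewrite leibniz_cons wdeg_cons; apply: homogD.
  by rewrite addrAC; apply: homog_tmul => //; exact: homog_tmono.
apply: homogZ0; first exact: gr_sg.
rewrite -addrA; apply: homog_tmul IHw.
by have := homog_tmono deg grK [:: j]; rewrite wdeg_cons wdeg_nil addr0.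
Qed.

Lemma homog_der n f : homog n f -> homog (n + p) (cont_der deg p X f).
Proof. by apply: homog_cont homog_der_word n f; exact: cont_der_id. Qed.

Lemma homog_hoch n f : homog n f -> homog (n + p) (hoch deg p X f).
Proof.
move: n f; apply: homog_cont => [|[|j v]]; first exact: cont_hoch.
  by rewrite hoch_one; exact: homog0.
rewrite [hoch _ _ _ _]cont_ext_basis /= wdeg_cons; apply: homogD.
  by rewrite addrAC; apply: homog_cyc_der2.
apply: homogZ0; first exact: gr_sg.
rewrite -addrA; apply: homog_tmul (homog_der_word v).
by have := homog_tmono deg grK [:: j]; rewrite wdeg_cons wdeg_nil addr0.
Qed.

End Derivation.

Section Eulerian.
Variables (k : fieldType) (iota : {rmorphism k -> K}).
Hypothesis k_deg0 : forall a, gr 0 (iota a).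

Lemma homog_eulerian j n f : homog n f -> homog n (eulerian iota deg j f).
Proof.
move=> nf w; rewrite /eulerian; case: ifP => _; last exact: gr_0.
suff : homog n (eulerian_n iota deg (size w) j f) by apply.
apply: homogZ0 => //.
elim: (index_iota 0 (size w).+1) f nf => [|r rs IHr] f nf; first by rewrite big_nil.
rewrite big_cons; case: ifP => _ /=; last exact: IHr.
apply: homogB; first exact/homog_shuffle/IHr.
by apply: homogZ0 => //; apply: IHr.
Qed.

Lemma homog_eulerian' j n f : homog n f -> homog n (eulerian' iota deg j f).
Proof.
move=> nf [|i v]; first exact: gr_0.
rewrite /= wdeg_cons opprD addrA.
suff : homog (n - deg i) (eulerian iota deg j (fun u => f (i :: u))) by apply.
apply: homog_eulerian => u; have := nf (i :: u).
by rewrite wdeg_cons opprD addrA.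
Qed.

End Eulerian.

End Degree.

(** * Direct products from projections *)

Section DirectProduct.
Variables (K : comNzRingType) (M : lmodType K) (comp : nat -> M -> M).
Hypothesis compD : forall l, {morph comp l : x y / x + y}.

Lemma comp_sum l (I : Type) (r : seq I) (P : pred I) (F : I -> M) :
  comp l (\sum_(i <- r | P i) F i) = \sum_(i <- r | P i) comp l (F i).
Proof.
have comp0 : comp l 0 = 0 by apply: (addrI (comp l 0)); rewrite -compD !addr0.
exact: (big_morph _ (compD l) comp0).
Qed.

(** In length [l] the map [d] only sees the components of length at most [l], and
    there a sufficiently long partial sum agrees with [x]. *)
Lemma sums_to_map (d : M -> M) y x : {morph d : x y / x - y} ->
  (forall l x, (forall i, (i <= l)%N -> comp i x = 0) -> comp l (d x) = 0) ->
  sums_to comp y x -> sums_to comp (fun j => d (y j)) (d x).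
Proof.
move=> dB dl yx l; have [m0 m0P] : exists m0, forall i, (i <= l)%N ->
    forall m, (m0 <= m)%N -> comp i (\sum_(j < m) y j) = comp i x.
  elim: l => [|l [m0 m0P]].
    have [m0 m0P] := yx 0%N; exists m0 => i; rewrite leqn0 => /eqP ->; exact: m0P.
  have [m1 m1P] := yx l.+1; exists (maxn m0 m1) => i; rewrite leq_eqVlt ltnS.
  by case/orP=> [/eqP ->|il] m; rewrite geq_max => /andP[mm0 mm1]; [exact: m1P | exact: m0P].
have d0 : d 0 = 0 by have := dB 0 0; rewrite !subrr.
have dD : {morph d : x y / x + y}.
  by move=> a b; have := dB (a + b) b; rewrite addrK => ->; rewrite subrK.
have compB i : {morph comp i : x y / x - y}.
  by move=> a b; have := compD i (a - b) b; rewrite subrK => ->; rewrite addrK.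
exists m0 => m mm; rewrite -(big_morph d dD d0).
apply/eqP; rewrite -subr_eq0 -compB -dB; apply/eqP/dl => i il.
by rewrite compB m0P // subrr.
Qed.

(** The terms of a decomposition are recovered from its sum by the projections,
    and the decomposition of [x] consists of the [E j x]. *)
Lemma direct_product_projections (A : set M) (E : nat -> M -> M) :
  (forall x x', (forall l, comp l x = comp l x') -> x = x') ->
  (forall j, {morph E j : x y / x + y}) ->
  (forall j l x, comp l (E j x) = E j (comp l x)) ->
  (forall i j x, E i (E j x) = if i == j then E j x else 0) ->
  (forall x, A x -> sums_to comp (fun j => E j x) x) ->
  (forall y, (forall j, (E j @` A) (y j)) -> exists2 x, A x & sums_to comp y x) ->
  direct_product comp A (fun j => E j @` A).
Proof.
move=> sep ED Ecomp EE Esum compl; split=> [y yE|x Ax].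
  have [x Ax yx] := compl y yE; exists x; split=> // x' [_ yx']; apply: sep => l.
  have [[m mP] [m' m'P]] := (yx l, yx' l).
  by rewrite -(mP (maxn m m')) ?leq_maxl // -(m'P (maxn m m')) ?leq_maxr.
exists (fun j => E j x); split=> [|y [yE yx]].
  by split; [move=> j; exists x | exact: Esum].
apply/funext => i; apply: sep => l; have [m mP] := yx l.
rewrite Ecomp -(mP (maxn m i.+1)) ?leq_maxl // comp_sum.
have E0 : E i 0 = 0 by apply: (addrI (E i 0)); rewrite -ED !addr0.
rewrite (big_morph _ (ED i) E0).
have im : (i < maxn m i.+1)%N by rewrite leq_max ltnSn orbT.
have Ey (j : nat) : E i (comp l (y j)) = if i == j then comp l (y j) else 0.
  have [x' _ <-] := yE j; rewrite -!Ecomp EE; case: ifP => // _.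
  by apply: (addrI (comp l 0)); rewrite -compD !addr0.
rewrite (bigD1 (Ordinal im)) //= Ey eqxx big1 ?addr0 // => j ji.
by rewrite Ey; case: eqP => // ij; case/eqP: ji; apply: val_inj.
Qed.

End DirectProduct.

Section TensorProducts.
Variables (K : comNzRingType) (J : choiceType).
Local Notation T := (tens K J).
Implicit Types (w : seq J) (f : T).

Lemma truncD n : {morph @trunc K J n : f g / f + g}.
Proof. exact: (contD (cont_trunc K J n)). Qed.

Lemma sums_toP (y : nat -> T) f :
  (forall w, exists m0, forall m, (m0 <= m)%N -> \sum_(j < m) y j w = f w) ->
  (exists c, forall j w, (size w + c < j)%N -> y j w = 0) ->
  sums_to (@trunc K J) y f.
Proof.
move=> yf [c y0] l; exists (l + c).+1 => m lm; apply/funext => w; rewrite /trunc.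
case: eqP => // wl; rewrite prof_sum; have [m0 m0P] := yf w.
rewrite -(m0P (maxn m m0)) ?leq_maxr // (big_ord_widen _ (fun j => y j w) (leq_maxl m m0)).
rewrite big_mkcond; apply: eq_bigr => j _; case: ltnP => // mj.
by rewrite y0 // wl (leq_trans lm).
Qed.

Lemma tens_sum (y : nat -> T) (c : nat) :
  (forall j w, (size w + c < j)%N -> y j w = 0) ->
  sums_to (@trunc K J) y (fun w => \sum_(j < (size w + c).+1) y j w).
Proof.
move=> y0; apply: sums_toP; last by exists c.
move=> w; exists (size w + c).+1 => m lm.
rewrite [RHS](big_ord_widen _ (fun j => y j w) lm) [RHS]big_mkcond.
by apply: eq_bigr => j _; case: ltnP => // /y0.
Qed.

(** A family of projections on the series without constant term, indexed so
    that the [j]-th one vanishes in lengths less than [j]. *)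
Record projections (P : set T) (E : nat -> T -> T) : Prop := Projections {
  proj_cont : forall j, cont (E j);
  proj_length : forall j, preserves_length (E j);
  proj_comp : forall i j f, E i (E j f) = if i == j then E j f else 0;
  proj_high : forall j f w, (size w < j)%N -> E j f w = 0;
  proj_sum : forall f w n, P f -> (size w <= n)%N -> \sum_(j < n.+1) E j f w = f w }.

Definition shift c (E : nat -> T -> T) j : T -> T :=
  if (c <= j)%N then E (j - c)%N else fun=> 0.

Lemma shift_product (P : set T) (E : nat -> T -> T) c : projections P E ->
  (forall (n : seq J -> nat) (y : nat -> T), (forall j, P (y j)) ->
     P (fun w => \sum_(j < n w) y j w)) ->
  P 0 -> (forall j f, P f -> P (E j f)) ->
  direct_product (@trunc K J) P (fun j => shift c E j @` P).
Proof.
move=> [cE lE EE E0 ES] Psum P0 PE.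
have csE j : cont (shift c E j).
  by rewrite /shift; case: ifP => _ //; exact: cont_zero.
have sE0 j f w : (size w + c < j)%N -> shift c E j f w = 0.
  by rewrite /shift; case: (leqP c j) => //= cj wj; rewrite E0 // ltn_subRL addnC.
apply: direct_product_projections.
- exact: truncD.
- exact: eq_trunc.
- by move=> j; exact: (contD (csE j)).
- move=> j l x; rewrite /shift; case: ifP => _; first exact: lE.
  exact: (cont0 (cont_trunc K J l)).
- move=> i j x; rewrite /shift; case: (leqP c i) => ci; case: (leqP c j) => cj /=; last 2 first.
  + by rewrite ltn_eqF // (leq_trans ci).
  + by rewrite if_same.
  + by rewrite EE eqn_sub2rE.
  + by rewrite (cont0 (cE _)) gtn_eqF // (leq_trans cj).
- move=> x Px; apply: sums_toP; last by exists c => j w; exact: sE0.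
  move=> w; exists (c + (size w).+1)%N => m cm.
  rewrite -(subnKC (leq_trans (leq_addr _ _) cm)) big_split_ord /= big1 ?add0r.
    under eq_bigr do rewrite /shift leq_addr addKn.
    case: (m - c)%N (leq_sub2r c cm) => [|n]; rewrite addKn // ltnS; exact: ES.
  by move=> j _; rewrite /shift leqNgt ltn_ord.
move=> y yE; exists (fun w => \sum_(j < (size w + c).+1) y j w).
  apply: (Psum (fun w => (size w + c).+1)) => j; have [f Pf <-] := yE j.
  by rewrite /shift; case: ifP => // _; exact: PE.
by apply: tens_sum => j w wj; have [f _ <-] := yE j; exact: sE0.
Qed.

End TensorProducts.

(** * Splittings of the two complexes *)

Section Splitting.
Variables (k : fieldType) (K : comNzRingType) (iota : {rmorphism k -> K}).
Variables (gr : int -> set K) (J : choiceType) (deg : J -> int).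
Hypothesis char0 : [pchar k] =i pred0.
Hypothesis grK : even_grading gr.
Hypothesis k_deg0 : forall a, gr 0 (iota a).
Local Notation T := (tens K J).
Local Notation mono := (tmono K).
Local Notation one := (tmono K [::]).
Local Notation s := (@shuffle K J deg).
Local Notation z := (@cyc K J deg).
Local Notation N := (@cyc_norm K J deg).
Local Notation e := (eulerian iota deg).
Local Notation e' := (eulerian' iota deg).
Local Notation P := (fun n => [set f : T | f [::] = 0 /\ homog gr deg n f]).
Implicit Types (u v w : seq J) (f g h : T).

Lemma natr_inv n : exists a : K, a * n.+1%:R = 1.
Proof.
have [a aE] := iota_unit iota (natr_neq0 char0 n).
by exists a; move: aE; rewrite rmorph_nat.
Qed.

Let cs : cont s. Proof. exact/cont_shuffle/cont_id. Qed.
Let ce j : cont (e j) := cont_eulerian iota deg j.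
Let ce' j : cont (e' j) := cont_eulerian' iota deg j.

Lemma sum_eulerian_word w : exists n, mono w = \sum_(j < n) e j (mono w).
Proof. by have [_ _ wE _] := word_eigen iota deg char0 w; exists (size w).+1. Qed.

Lemma eulerian'_one j : e' j one = 0.
Proof. exact: lift_one (ce j). Qed.

Lemma sum_eulerian'_word w : one = mono w \/ exists n, mono w = \sum_(j < n) e' j (mono w).
Proof.
case: w => [|x v]; [by left | right]; have [n vE] := sum_eulerian_word v.
exists n; rewrite -(tmul_tmono _ [:: x]) {1}vE (cont_sum (cont_tmulr_id _)).
by apply: eq_bigr => i _; rewrite [e' _ _](lift_tgenM _ _ (ce i)).
Qed.

Let eulerian_compC i j f : e i (e j f) = (j == i)%:R *: e j f.
Proof. exact: eulerian_comp. Qed.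
Let eulerian'_compC i j f : e' i (e' j f) = (j == i)%:R *: e' j f.
Proof. exact: eulerian'_comp. Qed.

(** By [shuffle_sub_cyc], [1 - z] carries the eigenspaces of [1 (x) s] to those of
    [s]. *)
Lemma eulerian_sub_cyc j f : e j (f - z f) = e' j f - z (e' j f).
Proof.
move: j f; apply: (intertwine_projections (cont_sub_cyc K deg)) => // [i j f|w].
  apply: eulerian_eigen => //; rewrite shuffle_sub_cyc lift_shuffle_eulerian' //.
  by rewrite (contZ (cont_cyc K deg)) scalerBr.
have [<-|] := sum_eulerian'_word w; [left | by right].
by split=> [|j]; rewrite ?eulerian'_one // cyc_one subrr.
Qed.

Lemma cyc_norm_nil f : N f [::] = 0. Proof. exact: big_ord0. Qed.

(** The norm lowers the eigenvalue by the factor 2 of [cyc_norm_shuffle], hence the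
    index of the projection by one. *)
Lemma eulerian'_cyc_norm j f : e' j (N f) = N (e j.+1 f).
Proof.
have cN := cont_cyc_norm K deg.
move: j f; apply: (intertwine_projections cN (fun j => ce j.+1) ce') => [i j f|i j f|w].
- by rewrite eulerian_compC.
- apply: eulerian'_eigen => //; first exact: cyc_norm_nil.
  have [a a2] := natr_inv 1.
  rewrite -[LHS]scale1r -a2 -scalerA -cyc_norm_shuffle shuffle_eulerian //.
  by rewrite (contZ cN) scalerA exprS mulrA a2 mul1r.
have [->|w0] := eqVneq w [::].
  left; rewrite cyc_norm_tmono; split=> // j.
  rewrite (@eulerian_eigen _ _ iota _ deg char0 0) ?scale0r //.
  by rewrite shuffle_tmono scale1r.
right; have [_ _ wE w00] := word_eigen iota deg char0 w; exists (size w).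
by rewrite {1}wE big_ord_recl /= w00 // add0r.
Qed.

Lemma eulerian_nil j f : f [::] = 0 -> e j f [::] = 0.
Proof.
move=> f0; have := congr1 (fun g : T => g [::]) (preserves_length_eulerian iota deg j 0 f).
rewrite {1}/trunc /= => ->; suff -> : trunc 0 f = 0 by rewrite (cont0 (ce j)).
by apply/funext => -[|x v].
Qed.

Lemma eulerian0_eq0 f : f [::] = 0 -> e 0 f = 0.
Proof.
move=> f0; apply/funext => -[|x v]; first exact: eulerian_nil.
by rewrite eulerian0.
Qed.

Lemma P_eulerian n j f : P n f -> P n (e j f).
Proof. by case=> f0 nf; split; [exact: eulerian_nil | exact: homog_eulerian]. Qed.

Lemma P_eulerian' n j f : P n f -> P n (e' j f).
Proof. by case=> f0 nf; split=> //; exact: homog_eulerian'. Qed.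

Lemma P0 n : P n 0.
Proof. by split=> //; exact: homog0. Qed.

Lemma P_sum n (y : nat -> T) (c : seq J -> nat) :
  (forall j, P n (y j)) -> P n (fun w => \sum_(j < c w) y j w).
Proof.
move=> yP; split=> [|w]; first by rewrite big1 // => j _; have [] := yP j.
by apply: gr_sum => // j; have [_] := yP j; apply.
Qed.

(** The projections onto the parts with eigenvalue [2 ^ j], [0 < j]; on series
    without constant term the part with [j = 0] vanishes. *)
Definition eulerian_pos j : T -> T := if j is 0 then fun=> 0 else e j.

Lemma projections_eulerian n : projections (P n) eulerian_pos.
Proof.
split.
- by case=> [|j]; [exact: cont_zero | exact: ce].
- case=> [|j] l f; first exact: (cont0 (cont_trunc K J l)).
  exact: preserves_length_eulerian.
- move=> [|i] [|j] f //=; first exact: (cont0 (ce _)).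
  rewrite eulerian_compC !eqSS eq_sym.
  by case: (i == j); rewrite ?scale1r ?scale0r.
- by case=> [|j] f w //; exact: eulerian_high.
move=> f w l [f0 _] wl; rewrite -[RHS](sum_eulerian iota deg char0 f wl).
rewrite big_ord_recl [RHS]big_ord_recl /=; congr (_ + _).
by rewrite eulerian0_eq0.
Qed.

Lemma preserves_length_eulerian' j : preserves_length (e' j).
Proof.
move=> [|l] f; apply/funext => -[|x v] //.
  rewrite /trunc /= [X in eulerian _ _ _ X _](_ : _ = 0) ?(cont0 (ce j)) //.
have := congr1 (fun g : T => g v)
  (preserves_length_eulerian iota deg j l (fun u => f (x :: u))).
by rewrite /trunc /= eqSS.
Qed.

Lemma projections_eulerian' n : projections (P n) e'.
Proof.
split.
- exact: ce'.
- exact: preserves_length_eulerian'.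
- move=> i j f; rewrite eulerian'_compC eq_sym.
  by case: (i == j); rewrite ?scale1r ?scale0r.
- by move=> j f [|x v] // vj; rewrite /= eulerian_high // ltnW.
by move=> f w l [f0 _]; exact: sum_eulerian'.
Qed.

Variables (X : J -> T).
Hypothesis dX : der_data deg 1 X.
Hypothesis LX : forall j, Lhat deg (X j).
Hypothesis hX : forall j, homog gr deg (deg j + 1) (X j).
Local Notation D := (@cont_der K J deg 1 X).
Local Notation b := (@hoch K J deg 1 X).

Lemma Lhat_nil (x : T) : Lhat deg x -> x [::] = 0.
Proof.
have ct := cont_trunc K J 0; move=> Lx.
suff : trunc 0 x = 0 by move/(congr1 (fun f : T => f [::])).
move: x Lx; apply: (@cont_conv_span _ _ _ (trunc 0) (fun=> 0)) => //; first exact: cont_zero.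
move=> x [p lx]; suff x0 : x [::] = 0 by apply/funext => -[|i v].
elim: lx => [j|{}p q {}x y _ x0 _ y0]; first by rewrite /tgen tmonoN.
by rewrite /tcomm profB profZ /tmul !big_ord1 /= x0 y0 !mul0r mulr0 subrr.
Qed.

Let X0 j : X j [::] = 0 := Lhat_nil (LX j).

Lemma eulerian_der j f : e j (D f) = D (e j f).
Proof.
have cD := cont_der_id dX.
move: j f; apply: (intertwine_projections cD) => // [i j f|w]; last first.
  by right; apply: sum_eulerian_word.
apply: eulerian_eigen => //; rewrite (shuffle_der dX) ?shuffle_eulerian ?(contZ cD) //.
by move=> l; apply/primitive_Lhat/LX.
Qed.

Lemma eulerian'_hoch j f : e' j (b f) = b (e' j f).
Proof.
have cb := cont_hoch dX.
move: j f; apply: (intertwine_projections cb) => // [i j f|w].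
  apply: eulerian'_eigen => //; first exact: hoch_nil.
  by rewrite -(hoch_lift_shuffle dX) // lift_shuffle_eulerian' // (contZ cb).
have [<-|] := sum_eulerian'_word w; [left | by right].
by split=> [|j]; rewrite ?eulerian'_one // hoch_one.
Qed.

Lemma P_der n f : P n f -> P (n + 1) (D f).
Proof. by case=> f0 nf; split; [exact: der_nil | exact: homog_der]. Qed.

Lemma P_hoch n f : P n f -> P (n + 1) (b f).
Proof. by case=> f0 nf; split; [exact: hoch_nil | exact: homog_hoch]. Qed.

Lemma P_sub_cyc n f : P n f -> P n (f - z f).
Proof.
case=> f0 nf; split; last by apply: homogB => //; exact: homog_cyc.
by rewrite profB /cyc /= mul1r subrr.
Qed.

Lemma P_cyc_norm n f : P n f -> P n (N f).
Proof. by case=> f0 nf; split; [exact: cyc_norm_nil | exact: homog_cyc_norm]. Qed.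

Lemma P_linear n f g : P n f -> P n g -> P n (f + g).
Proof.
by move=> [f0 nf] [g0 ng]; split; [rewrite profD f0 g0 addr0 | exact: homogD].
Qed.

Lemma P_scale p n c f : gr p c -> P n f -> P (p + n) (c *: f).
Proof.
by move=> pc [f0 nf]; split; [rewrite profZ f0 mulr0 | exact: homogZ].
Qed.

(** Only words of length at most [l] contribute to the coefficients in length
    [l]. *)
Lemma trunc_size (A : T -> T) l f : cont A ->
  (forall w y, A (mono w) y != 0 -> (size w <= size y)%N) ->
  (forall i, (i <= l)%N -> trunc i f = 0) -> trunc l (A f) = 0.
Proof.
move=> cA Aw f0; apply/funext => y; rewrite /trunc; case: eqP => // yl.
have [F _ ->] := cont_coordE cA y; rewrite big1 // => u _.
have [nz|] := eqVneq (A (basis_elt K u) y) 0; first by rewrite nz mulr0.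
move=> /Aw; rewrite yl => /f0 /(congr1 (fun g : T => g u)).
by rewrite /trunc eqxx => ->; rewrite mul0r.
Qed.

End Splitting.

(** * The differential of a C-infinity algebra *)

Section Main.
Variables (k : fieldType) (K : comNzRingType) (iota : {rmorphism k -> K}).
Variables (gr : int -> set K) (V : gfree gr).
Local Notation I := (gf_idx V).
Local Notation T := (tens K I).
Variable m : T -> T.
Hypothesis char0 : [pchar k] =i pred0.
Hypothesis grK : even_grading gr.
Hypothesis k_deg0 : forall a, gr 0 (iota a).
Hypothesis m_Cinfty : Cinfty m.
Local Notation deg := (@sdeg K gr V).
Local Notation mono := (tmono K).
Local Notation z := (@cyc K I deg).
Local Notation N := (@cyc_norm K I deg).
Local Notation e := (eulerian iota deg).
Local Notation e' := (eulerian' iota deg).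
Local Notation X := (fun i : I => m (tgen K i)).
Local Notation D := (Cinfty_ext m).
Local Notation P := (fun n => [set f : T | f [::] = 0 /\ homog gr deg n f]).
Implicit Types (u v w : seq I) (f g h : T).

Lemma Lhat_tgen i : Lhat (K := K) deg (tgen K i).
Proof. by apply: conv_span_sub; exists (deg i); left. Qed.

Lemma Cinfty_Lhat_tgen i : Lhat deg (X i).
Proof. exact/(Cinfty_Lhat m_Cinfty)/Lhat_tgen. Qed.

Lemma Cinfty_homog_tgen i : homog gr deg (deg i + 1) (X i).
Proof.
apply: (Cinfty_degree m_Cinfty); first exact: Lhat_tgen.
by have := homog_tmono deg grK [:: i]; rewrite wdeg_cons wdeg_nil addr0.
Qed.

Lemma Cinfty_der_data : der_data deg 1 X.
Proof.
split=> [w|i]; last first.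
  by rewrite addbC -parzD; apply: (homog_par grK); exact: Cinfty_homog_tgen.
have [F FP] := Cinfty_continuous m_Cinfty w; exists (flatten F) => i.
apply: contraNT => iF; apply/eqP/FP; first exact: Lhat_tgen.
move=> u uF; apply: tmonoN; apply: contraNneq iF => ui.
by apply/flattenP; exists u => //; rewrite -ui mem_head.
Qed.

Local Notation dX := Cinfty_der_data.
Local Notation LX := Cinfty_Lhat_tgen.
Let X0 i : X i [::] = 0 := Lhat_nil (LX i).

Lemma Hoch_bE f : f [::] = 0 -> Hoch_b m f = - hoch deg 1 X f.
Proof.
move=> f0; rewrite /Hoch_b.
rewrite (Theta_inv_lie_der grK (natr_inv iota char0) dX X0 f0).
by rewrite ksgnE parz1 scaleN1r.
Qed.

(** * The Tsygan bicomplex *)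

Lemma graded_image (A : T -> T) : cont A -> 
  graded_submodule gr (fun n => A @` P (n + 1)).
Proof.
move=> cA; split=> [n|n x y [f Pf <-] [g Pg <-]|p n c x pc [f Pf <-]].
- by exists 0; [exact: P0 | exact: (cont0 cA)].
- by exists (f + g); [exact: P_linear | exact: (contD cA)].
- exists (c *: f); last exact: (contZ cA).
  by rewrite -addrA; apply: P_scale.
Qed.

(** The columns of [Gamma] are the images of shifted projections. *)
Definition column i : nat -> T -> T :=
  shift i./2 (if odd i then eulerian_pos iota deg else e').

Lemma cont_column i j : cont (column i j).
Proof.
rewrite /column /shift; case: ifP => _; last exact: cont_zero.
case: ifP => _; last exact: cont_eulerian'.
by case: (j - _)%N => [|l]; [exact: cont_zero | exact: cont_eulerian].
Qed.

Lemma set0_image n : [set 0 : T] = (fun=> 0) @` P n.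
Proof.
apply/seteqP; split=> [x -> | x [f _ <-] //].
by exists 0 => //; exact: P0.
Qed.

Lemma Gamma_column j i n : Gamma iota j i n = column i j @` P (n + 1).
Proof.
rewrite /Gamma /column /shift /Qpart /Qtilde; case: (odd i).
  rewrite [(i./2 <= j)%N]leq_eqVlt; case: eqP => [<-|_] /=.
    by rewrite ltnn subnn; exact: set0_image.
  by case: ltnP => [cj|_]; [rewrite -(subnSK cj) | exact: set0_image].
by case: ifP => // _; exact: set0_image.
Qed.

Lemma P_column i j n f : P n f -> P n (column i j f).
Proof.
move=> Pf; rewrite /column /shift; case: ifP => _; last exact: P0.
case: ifP => _; last exact: P_eulerian'.
by case: (j - _)%N => [|l]; [exact: P0 | exact: P_eulerian].
Qed.

Lemma projections_column i n :
  projections (P n) (if odd i then eulerian_pos iota deg else e').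
Proof. by case: ifP => _; [exact: projections_eulerian | exact: projections_eulerian']. Qed.

Lemma column_der i j f : odd i -> D (column i j f) = column i j (D f).
Proof.
have cD : cont D by exact: cont_der_id dX.
rewrite /column /shift => ->; case: ifP => _; last exact: (cont0 cD).
case: (j - _)%N => [|l]; first exact: (cont0 cD).
exact: esym (eulerian_der iota char0 dX LX l.+1 f).
Qed.

Lemma column_hoch i j f : ~~ odd i ->
  hoch deg 1 X (column i j f) = column i j (hoch deg 1 X f).
Proof.
have cb := cont_hoch dX.
rewrite /column /shift => /negPf ->; case: ifP => _; last exact: (cont0 cb).
exact: esym (eulerian'_hoch iota char0 dX LX _ f).
Qed.

Lemma column_sub_cyc i j f : ~~ odd i -> f [::] = 0 ->
  column i j f - z (column i j f) = column i.+1 j (f - z f).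
Proof.
move=> oi f0; rewrite /column /shift /= uphalf_half (negPf oi) /=.
case: ifP => ij; last by rewrite (cont0 (cont_cyc K deg)) subrr.
rewrite -eulerian_sub_cyc //; case: (j - _)%N => [|l] //=.
by rewrite eulerian0_eq0 // profB /cyc /= mul1r subrr.
Qed.

Lemma column_cyc_norm i j f : odd i -> N (column i j f) = column i.+1 j (N f).
Proof.
move=> oi; rewrite /column /shift /= uphalf_half oi /= add1n.
case: (ltnP i./2 j) => ij; last first.
  case: ifP => [ij'|_]; last exact: (cont0 (cont_cyc_norm K deg)).
  by rewrite (_ : (j - i./2)%N = 0%N) ?(cont0 (cont_cyc_norm K deg)) //; apply/eqP.
by rewrite (ltnW ij) -(subnSK ij) /= eulerian'_cyc_norm.
Qed.

Lemma size_CC_Tsygan (d : T -> T) y x : cont d ->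
  (forall w v, d (mono w) v != 0 -> (size w <= size v)%N) ->
  sums_to (@trunc K I) y x -> sums_to (@trunc K I) (fun j => d (y j)) (d x).
Proof.
move=> cd ds; apply: sums_to_map; first exact: truncD.
  exact: (contB cd).
by move=> l f; apply: trunc_size.
Qed.

Lemma Tsygan_product : bicomplex_product gr (@trunc K I) (CC_Tsygan m)
  (fun j => @Gamma k K iota gr V j).
Proof.
have cb := cont_hoch dX; have cD : cont D by exact: cont_der_id dX.
split=> [j|]; [|split=> [i n|i n y x yG [x0 nx] yx]].
- split=> [i n|i|i n x|i n x].
  + by rewrite Gamma_column => _ [f Pf <-]; apply: P_column.
  + rewrite (_ : Gamma _ _ _ = fun n => column i j @` P (n + 1)).
      exact/graded_image/cont_column.
    by apply/funext => n; exact: Gamma_column.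
  + rewrite !Gamma_column => -[f Pf <-] /=; case: ifP => oi.
      by exists (D f); [exact: (P_der grK dX LX Cinfty_homog_tgen) | rewrite -column_der].
    have [f0 _] := Pf.
    exists (- hoch deg 1 X f).
      rewrite -scaleN1r -[n + 1 + 1]add0r; apply: P_scale => //; first exact: (gr_sg grK true).
      exact: (P_hoch grK dX LX Cinfty_homog_tgen).
    rewrite (contN (cont_column i j)) -column_hoch ?oi // Hoch_bE //.
    by have [] := P_column i j Pf.
  + rewrite !Gamma_column => -[f Pf <-] /=; have [f0 _] := Pf; case: ifP => oi.
      by exists (N f); [exact: P_cyc_norm | rewrite -column_cyc_norm].
    by exists (f - z f); [exact: P_sub_cyc | rewrite -column_sub_cyc // oi].
- rewrite (_ : (fun j => Gamma _ _ _ _) = fun j => column i j @` P (n + 1)).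
    apply: shift_product.
    + exact: projections_column.
    + by move=> c y yP; apply: P_sum.
    + exact: P0.
    + move=> j f Pf; case: ifP => _; last exact: P_eulerian'.
      by case: j => [|l]; [exact: P0 | exact: P_eulerian].
  by apply/funext => j; exact: Gamma_column.
have y0 j : y j [::] = 0.
  have := yG j; rewrite Gamma_column => -[f Pf <-].
  by have [] := P_column i j Pf.
split=> /=; case: ifP => oi.
- by apply: size_CC_Tsygan yx => // w v; exact: der_size.
- rewrite Hoch_bE // (_ : (fun j => _) = (fun j => - hoch deg 1 X (y j))).
    apply: (size_CC_Tsygan (cont_opp cb)) yx => w v.
    by rewrite profN oppr_eq0; exact: hoch_size.
  by apply/funext => j; exact: Hoch_bE.
- apply: size_CC_Tsygan yx => [|w v]; first exact: cont_cyc_norm.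
  by rewrite cyc_norm_tmono => /cyc_der_support; rewrite cats0 => /perm_size ->.
apply: (size_CC_Tsygan (cont_sub_cyc K deg)) yx => w v.
case: w => // j w; rewrite cyc_tmono_cons profB profZ.
have [<-//|/tmonoN ->] := eqVneq (j :: w) v.
have [<-|/tmonoN ->] := eqVneq (rcons w j) v; first by rewrite size_rcons.
by rewrite mulr0 subrr eqxx.
Qed.

(** * The cyclic Hochschild complex *)

Local Notation Pc := (@Pcyc K gr V).
Local Notation cl := (@to_Pcyc K gr V).
Local Notation C := (@cyc_image K I deg).

Lemma clP f g : cl f = cl g <-> C (f - g).
Proof. exact: clsP. Qed.

Lemma cl_surj (q : Pc) : exists f, cl f = q.
Proof. by exists (repr q); exact: cls_repr. Qed.

Lemma cl_sum (J : Type) (r : seq J) (Q : pred J) (F : J -> T) :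
  cl (\sum_(i <- r | Q i) F i) = \sum_(i <- r | Q i) cl (F i).
Proof.
apply: (big_morph cl); first exact: clsD.
by apply: (addrI (cl 0)); rewrite -clsD !addr0.
Qed.

Lemma induced_cl (A : T -> T) f : cont A -> (forall f, C f -> C (A f)) ->
  induced A (cl f) = cl (A f).
Proof.
move=> cA CA; apply/clP; rewrite -(contB cA); apply/CA/clP.
exact: cls_repr.
Qed.

Lemma induced_cl_der f : induced (Hoch_b' m) (cl f) = cl (D f).
Proof.
apply: induced_cl; first exact: cont_der_id dX.
by move=> _ [g ->]; exists (hoch deg 1 X g); exact: der_sub_cyc dX g.
Qed.

Lemma induced_cl_eulerian j f : induced (e j) (cl f) = cl (e j f).
Proof.
apply: induced_cl; first exact: cont_eulerian.
by move=> _ [g ->]; exists (e' j g); exact: eulerian_sub_cyc.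
Qed.

Lemma trunc_cyc l f : trunc l (z f) = z (trunc l f).
Proof.
apply/funext => w; rewrite /cyc /trunc size_rotr.
by case: ifP => // _; rewrite mulr0.
Qed.

Lemma C_trunc l f : C f -> C (trunc l f).
Proof.
move=> [g ->]; exists (trunc l g).
by rewrite (contB (cont_trunc K I l)) trunc_cyc.
Qed.

Lemma Pcyc_comp_cl l f : Pcyc_comp l (cl f) = cl (trunc l f).
Proof. by apply: induced_cl; [exact: cont_trunc | exact: C_trunc]. Qed.

(** The preimages under [1 - z] chosen in the different lengths make up one
    series. *)
Lemma C_length f : (forall l, C (trunc l f)) -> C f.
Proof.
move=> /choice [h hE]; exists (fun w => h (size w) w); apply/funext => w.
have := congr1 (fun g : T => g w) (hE (size w)).
by rewrite /trunc eqxx => ->; rewrite !profB /cyc size_rotr.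
Qed.

Lemma sums_to_cl y x : sums_to (@trunc K I) y x ->
  sums_to (@Pcyc_comp K gr V) (fun j => cl (y j)) (cl x).
Proof.
move=> yx l; have [m0 m0P] := yx l; exists m0 => m1 /m0P E.
by rewrite -cl_sum !Pcyc_comp_cl E.
Qed.

Lemma Pcyc_compD l : {morph @Pcyc_comp K gr V l : x y / x + y}.
Proof.
move=> x y; have [[f <-] [g <-]] := (cl_surj x, cl_surj y).
rewrite -[_ + _]/(cl f + cl g) /to_Pcyc -clsD -!/(cl _) !Pcyc_comp_cl.
by rewrite truncD [LHS]clsD.
Qed.

Lemma Hoch_partP j n x : CC_Hoch_part iota j n x <->
  exists2 f : T, P (n + 1) f & x = cl (e j f).
Proof.
split=> [[_ [f Pf <-] <-]|[f Pf ->]].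
  by exists f => //; exact: induced_cl_eulerian.
by exists (cl f); [exists f | exact: induced_cl_eulerian].
Qed.

Lemma Hoch_product : complex_product gr (@Pcyc_comp K gr V) (CC_Hoch m)
  (fun j => CC_Hoch_part iota j.+1).
Proof.
have cD : cont D by exact: cont_der_id dX.
have ce j := cont_eulerian iota deg j.
split=> [j|]; [|split=> [n|n y x yQ xP yx]].
- split=> [n x /Hoch_partP [f Pf ->]||n x /Hoch_partP [f Pf ->]].
  + by exists (e j.+1 f) => //; exact: P_eulerian.
  + split=> [n|n x y|p n c x pc].
    * apply/Hoch_partP; exists 0; first exact: P0.
      rewrite (cont0 (ce _)); apply: (addrI (cl 0)).
      by rewrite -[RHS]clsD !addr0.
    * move=> /Hoch_partP [f Pf ->] /Hoch_partP [g Pg ->]; apply/Hoch_partP.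
      exists (f + g); first exact: P_linear.
      by rewrite (contD (ce _)) [RHS]clsD.
    * move=> /Hoch_partP [f Pf ->]; apply/Hoch_partP.
      exists (c *: f); first by rewrite -addrA; apply: P_scale.
      by rewrite (contZ (ce _)) [RHS]clsZ.
  + apply/Hoch_partP; exists (D f); first exact: (P_der grK dX LX Cinfty_homog_tgen).
    by rewrite [LHS]induced_cl_der; congr cl; exact: esym (eulerian_der iota char0 dX LX _ f).
- apply: direct_product_projections.
  + exact: Pcyc_compD.
  + move=> x x'; have [[f <-] [g <-]] := (cl_surj x, cl_surj x') => fg.
    apply/clP/C_length => l; rewrite (contB (cont_trunc K I l)); apply/clP.
    by rewrite -!Pcyc_comp_cl.
  + move=> j x x'; have [[f <-] [g <-]] := (cl_surj x, cl_surj x').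
    by rewrite -[_ + _]clsD !induced_cl_eulerian (contD (ce _)) [LHS]clsD.
  + move=> j l x; have [f <-] := cl_surj x.
    by rewrite !(Pcyc_comp_cl, induced_cl_eulerian) preserves_length_eulerian.
  + move=> i j x; have [f <-] := cl_surj x; rewrite !induced_cl_eulerian.
    rewrite eulerian_comp // eqSS eq_sym; case: eqP; rewrite ?scale1r ?scale0r //.
    by move=> _; apply: (addrI (cl 0)); rewrite -[LHS]clsD !addr0.
  + move=> _ [f Pf <-]; rewrite (_ : (fun j => _) = (fun j => cl (e j.+1 f))).
      apply: sums_to_cl => l; exists l => m1 lm.
      rewrite -(trunc_sum_eulerian iota deg char0 f lm) big_ord_recl /=.
      have [f0 _] := Pf; rewrite eulerian0_eq0 // add0r.
      by [].
    by apply/funext => j; exact: induced_cl_eulerian.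
  move=> y yQ.
  have /choice [f fP] : forall j, exists f, P (n + 1) f /\ y j = cl (e j.+1 f).
    by move=> j; have /Hoch_partP [f Pf yE] := yQ j; exists f.
  pose g j := e j.+1 (f j).
  have -> : y = fun j => cl (g j) by apply/funext => j; have [] := fP j.
  exists (cl (fun w => \sum_(j < (size w + 0).+1) g j w)).
    exists (fun w => \sum_(j < (size w + 0).+1) g j w) => //.
    apply: (P_sum grK (y := g) (fun w => (size w + 0).+1)) => j.
    by apply: P_eulerian => //; have [] := fP j.
  apply/sums_to_cl/tens_sum => j w; rewrite addn0 => wj.
  by apply: eulerian_high; rewrite ltnW.
apply: sums_to_map yx; first exact: Pcyc_compD.
  move=> a b; have [[f <-] [g <-]] := (cl_surj a, cl_surj b).
  have clB (u v : T) : cl u - cl v = cl (u - v).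
    by rewrite -[- cl v]scaleN1r -[_ *: _](clsZ _ (-1)) -[LHS]clsD scaleN1r.
  by rewrite clB /= !induced_cl_der (contB cD) clB.
move=> l a a0; have [f fE] := cl_surj a; rewrite -fE /= induced_cl_der Pcyc_comp_cl.
have cl0 : cl 0 = 0 by apply: (addrI (cl 0)); rewrite -[LHS]clsD !addr0.
have a0' i : (i <= l)%N -> C (trunc i f).
  by move=> /a0; rewrite -fE Pcyc_comp_cl -cl0 => /clP; rewrite subr0.
(* In length l, D f is determined by the components of f up to length l. *)
pose f' := \sum_(i < l.+1) trunc i f.
have C0 : C 0 by exact: cyc_image0.
have Cf' : C f'.
  rewrite /f'; elim/big_ind: _ => [//|u v Cu Cv|i _]; last by apply: a0'; rewrite -ltnS.
  by rewrite -[u]scale1r; apply: cyc_imageP.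
have -> : trunc l (D f) = trunc l (D f').
  apply/eqP; rewrite -subr_eq0 -(contB (cont_trunc K I l)) -(contB cD); apply/eqP.
  apply: trunc_size => // [|i il]; first exact: der_size.
  rewrite (contB (cont_trunc K I i)) (cont_sum (cont_trunc K I i)).
  rewrite (bigD1 (Ordinal (il : i < l.+1)%N)) //= trunc_comp eqxx big1 ?addr0 ?subrr //.
  move=> i' ne; rewrite trunc_comp; case: eqP => // ii'.
  by case/eqP: ne; apply: val_inj.
rewrite -cl0; apply/clP; rewrite subr0; apply: C_trunc.
have [h ->] := Cf'.
by exists (hoch deg 1 X h); exact: der_sub_cyc dX h.
Qed.

End Main.

Theorem theorem8p3 (k : fieldType) (K : comNzRingType) (iota : {rmorphism k -> K})
    (gr : int -> set K) (V : gfree gr)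
    (m : tens K (gf_idx V) -> tens K (gf_idx V))
    (char0 : [pchar k] =i pred0)
    (grK : even_grading gr)
    (k_deg0 : forall a, gr 0 (iota a))
    (m_Cinfty : Cinfty m) :
  complex_product gr (@Pcyc_comp _ _ V) (CC_Hoch m)
    (fun j => CC_Hoch_part iota j.+1) /\
  bicomplex_product gr (@trunc K (gf_idx V)) (CC_Tsygan m)
    (fun j => @Gamma k K iota gr V j).
Proof.
split; first exact: Hoch_product.
exact: Tsygan_product.
Qed.
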